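(* Let $4/3<p<\infty$ and $\alpha\in(0,2]\setminus\{1\}$. Then there is a constant $C>0$ (depending only on $p$ and $\alpha$) such that $$\left\| |D_x|^{\frac{\alpha-2}{3p}}U_\alpha(t)\phi\right\|_{L^{3p}_{xt}(\mathbb{R}^2)}\le C\|\phi\|_{\widehat{L^p}}$$ for all $\phi\in\widehat{L^p}(\mathbb{R})$.
   Context: Space dimension is one. $p'$ denotes the conjugate exponent, $1/p+1/p'=1$, and $\hat\phi$ the Fourier transform of $\phi$. The Fourier–Lebesgue space is $\widehat{L^p}(\mathbb{R})=\{\phi\in\mathcal{S}'(\mathbb{R}) : \hat\phi\in L^{p'}(\mathbb{R})\}$ with norm $\|\phi\|_{\widehat{L^p}}=\|\hat\phi\|_{L^{p'}}$. For $\sigma\in\mathbb{R}$, $|D_x|^\sigma$ is the Fourier multiplier with symbol $|\xi|^\sigma$ (up to a constant). The free fractional Schrödinger propagator is $[U_\alpha(t)\phi](x)=\int_{\mathbb{R}}e^{ix\xi-it|\xi|^\alpha}\hat\phi(\xi)\,d\xi$. $L^{3p}_{xt}(\mathbb{R}^2)$ is the Lebesgue space in the variables $(x,t)\in\mathbb{R}\times\mathbb{R}$. *)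

(* Defs.v *)
From HB Require Import structures.
From mathcomp Require Import all_boot all_order all_algebra.
From mathcomp Require Import all_classical all_reals all_analysis.
From mathcomp Require Import complex.

Set Implicit Arguments.
Unset Strict Implicit.
Unset Printing Implicit Defensive.

Import Order.TTheory GRing.Theory Num.Theory.
Import numFieldNormedType.Exports.

Local Open Scope classical_set_scope.
Local Open Scope ring_scope.
Local Open Scope complex_scope.

Notation normc := Normc.normc.

Section ComplexValued.
Context {d : measure_display} {T : measurableType d} {R : realType}.
Implicit Types (f : T -> R[i]) (mu : {measure set T -> \bar R}).

Definition cmeasurable f : Prop :=
  measurable_fun setT (@complex.Re R \o f) /\ measurable_fun setT (@complex.Im R \o f).

Definition cintegrable mu f : Prop :=
  mu.-integrable setT (EFin \o (@complex.Re R \o f)) /\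
  mu.-integrable setT (EFin \o (@complex.Im R \o f)).

Definition cintegral mu f : R[i] :=
  Rintegral mu setT (@complex.Re R \o f) +i*
  Rintegral mu setT (@complex.Im R \o f).

Definition cLnorm mu (q : \bar R) f : \bar R :=
  Lnorm mu q (fun x => (normc (f x))%:E).

End ComplexValued.

Section SchwartzSpace.
Context {R : realType}.
Implicit Types f : R -> R[i].

Definition cderiven (n : nat) f (x : R) : R[i] :=
  (derive1n n (@complex.Re R \o f) x) +i* (derive1n n (@complex.Im R \o f) x).

Definition csmooth f : Prop := forall (n : nat) (x : R),
  derivable (derive1n n (@complex.Re R \o f)) x 1 /\
  derivable (derive1n n (@complex.Im R \o f)) x 1.

Definition schwartz_seminorm (k n : nat) f : \bar R :=
  ereal_sup [set (`|x| ^+ k * normc (cderiven n f x))%:E | x in [set: R]].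

Definition schwartz f : Prop :=
  csmooth f /\ forall k n : nat, (schwartz_seminorm k n f < +oo)%E.

End SchwartzSpace.

(* A distribution is a functional of which only the values on Schwartz
   functions are meaningful; its values elsewhere are never used. *)
Definition distr (R : realType) := (R -> R[i]) -> R[i].

Section TemperedDistributions.
Context {R : realType}.
Implicit Types (T phi : distr R) (f g psi m : R -> R[i]).

Local Notation leb := (@lebesgue_measure R).

Definition expi (y : R) : R[i] := cos y +i* sin y.

Definition tempered T : Prop :=
  (forall (a : R[i]) f g, schwartz f -> schwartz g ->
    T (fun x => a * f x + g x) = a * T f + T g) /\
  (exists (C : R) (N : nat), forall f, schwartz f ->
    ((normc (T f))%:E <=
      C%:E * \sum_(k < N) \sum_(n < N) schwartz_seminorm k n f)%E).

(* The distribution T is the function f. *)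
Definition represents T f : Prop :=
  cmeasurable (f : measurableTypeR R -> R[i]) /\
  forall psi, schwartz psi ->
    cintegrable leb (fun x => f x * psi x) /\
    T psi = cintegral leb (fun x => f x * psi x).

(* The normalization is the one for which U_alpha(0) is the identity:
   fourier carries the factor 1/(2 pi) and inv_fourier carries none. *)
Definition fourier psi (xi : R) : R[i] :=
  ((2 * pi)^-1)%:C * cintegral leb (fun x => expi (- (x * xi)) * psi x).

Definition inv_fourier psi (x : R) : R[i] :=
  cintegral leb (fun xi => expi (x * xi) * psi xi).

Definition dfourier T : distr R := fun psi => T (fourier psi).

Definition dinv_fourier T : distr R := fun psi => T (inv_fourier psi).

Definition fun_distr f : distr R :=
  fun psi => cintegral leb (fun x => f x * psi x).

(* The Fourier transform of phi as a function (unique almost everywhere),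
   with default 0 when dfourier phi is not a function. *)
Definition hat phi : R -> R[i] :=
  xget (fun=> 0) [set g | represents (dfourier phi) g].

Definition Lhat_norm (p : R) phi : \bar R :=
  cLnorm leb (hoelder_conjugate p%:E) (hat phi).

Definition Lhat (p : R) : set (distr R) :=
  [set phi | [/\ tempered phi, represents (dfourier phi) (hat phi) &
                 (Lhat_norm p phi < +oo)%E]].

Definition fourier_multiplier m phi : distr R :=
  dinv_fourier (fun_distr (fun xi => m xi * hat phi xi)).

Definition absD (s : R) : distr R -> distr R :=
  fourier_multiplier (fun xi => (`|xi| `^ s)%:C).

(* For phi in Lhat p the integral of exp(i x xi - i t |xi|^alpha) hat phi(xi)
   over xi need not converge absolutely: it is the inverse Fourier transform,
   in the sense of tempered distributions, of exp(-i t |xi|^alpha) hat phi. *)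
Definition propagator (alpha t : R) : distr R -> distr R :=
  fourier_multiplier (fun xi => expi (- (t * `|xi| `^ alpha))).

(* The t-dependent distribution F is the function u of (x, t). *)
Definition represents_xt (F : R -> distr R)
    (u : measurableTypeR R * measurableTypeR R -> R[i]) : Prop :=
  cmeasurable u /\
  {ae leb, forall t : R, represents (F t) (fun x => u (x, t))}.

(* Two functions representing F agree almost everywhere, so the infimum is
   over at most one value; it is +oo when F is not a function of (x, t). *)
Definition Lxt_norm (q : R) (F : R -> distr R) : \bar R :=
  ereal_inf [set cLnorm (leb \x leb)%E q%:E u | u in represents_xt F].

End TemperedDistributions.

(* Main.v *)
(** Put Q = 3p > 4 and let q be the exponent conjugate to p. For a real density f with
    compact support in (0, +oo), the square of the extension
    E f(x, t) = int exp(i x xi - i t xi^alpha) f(xi) dxi is an oscillatory integral over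
    pairs z = (xi, eta) with density f(xi) f(eta) and frequency
    (xi + eta, xi^alpha + eta^alpha), a map with Jacobian
    J = alpha |xi^(alpha-1) - eta^(alpha-1)|. Inserting Abel weights and integrating along
    the curves gives the L^2 bound  ||(E f)^2||_2^2 <= C int int |f f|^2 / J,  while the
    L^1 norm of the density bounds (E f)^2 pointwise. Interpolating between the two by hand,
    with a splitting of the density that depends on J, yields
    ||E f||_Q^Q <= C  whenever  int int |f f|^(1+lam) J^(-lam) <= c,  lam = 2/(Q-2).
    After the substitution v = xi^(alpha-1) this double integral is a
    Hardy-Littlewood-Sobolev form, and it is controlled exactly by the L^q norm of
    xi^((2-alpha)/Q) f, which is the estimate of the theorem for such f.

    A general function h in L^q is a sum of bounded annular pieces of norms at most 4^-k M;
    the extensions of the partial sums converge almost everywhere to a function u, and u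
    pairs with Schwartz functions as the distribution does. To identify the distributions
    one needs that the Fourier transform of the propagated phi is exp(-i t |xi|^alpha) hat phi
    almost everywhere; this follows from Fourier inversion on Schwartz functions and from
    testing against smooth steps times a Gaussian. *)

From HB Require Import structures.
Require Import Defs.
From mathcomp Require Import all_boot all_order all_algebra.
From mathcomp Require Import all_classical all_reals all_analysis.
From mathcomp Require Import complex measurable_realfun ring lra.

Set Implicit Arguments.
Unset Strict Implicit.
Unset Printing Implicit Defensive.

Import Order.TTheory GRing.Theory Num.Theory.
Import numFieldNormedType.Exports.

Local Open Scope classical_set_scope.
Local Open Scope ring_scope.
Local Open Scope complex_scope.

(** * Measurability, the fundamental theorem of calculus, substitution *)

(** Squaring the extension makes half of 3p the working exponent, and 3p > 4 becomes lam < 1, the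
    range in which the kernel |v - w|^(-lam) is locally integrable. For alpha = 1 the Jacobian
    vanishes identically and the substitution v = xi^(alpha-1) degenerates.

    The map from pairs to frequencies is two-to-one and singular on the diagonal, and the L^2 bound
    avoids inverting it. Abel weights turn the squared norm into a double integral of densities
    against Poisson kernels; a Schur test with weight J reduces it to the fact that J dxi deta,
    carried to the frequency plane and smeared by the kernels, is bounded. Along a line xi + eta = s
    this is explicit, since J times the kernel is the derivative of an arctangent.

    In the claim the exceptional set of times must not depend on the test function. The limit u
    therefore comes with a majorant S that is integrable over the plane: for almost every t the
    slice S(., t) is integrable, and it serves all test functions at once. *)

Section measurability.
Context {R : realType}.

Lemma measurable_sin : measurable_fun setT (@sin R).
Proof. by apply: continuous_measurable_fun; exact: continuous_sin. Qed.

Lemma measurable_cos : measurable_fun setT (@cos R).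
Proof. by apply: continuous_measurable_fun; exact: continuous_cos. Qed.

Lemma measurable_atan : measurable_fun setT (@atan R).
Proof. by apply: continuous_measurable_fun => x; exact: continuous_atan. Qed.

Context d (T : measurableType d).
Implicit Types f g : T -> R.

(** Reciprocals are reduced to [powR] with exponent -1; a real power is meaningful only for a base
    that is not negative, so the sign is split off. *)
Lemma measurable_funV f : measurable_fun setT f -> measurable_fun setT (fun x => (f x)^-1).
Proof.
move=> mf; have -> : (fun x => (f x)^-1) =
    (fun x => if 0 <= f x then f x `^ (-1) else - (- f x) `^ (-1)).
  apply/funext => x; case: ifPn => [f0|]; first by rewrite powR_inv1.
  rewrite -ltNge => f0; rewrite powR_inv1 ?oppr_ge0 ?(ltW f0)//.
  by rewrite invrN opprK.
apply: measurable_fun_ifT => //.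
- exact: measurable_fun_ler.
- exact: (measurableT_comp (measurable_powR _)).
- apply: measurableT_comp => //; apply: (measurableT_comp (measurable_powR _)).
  exact: measurableT_comp.
Qed.

Lemma measurable_indic_bool (P : T -> bool) f : measurable_fun setT P ->
  measurable_fun setT f -> measurable_fun setT (fun x => if P x then f x else 0).
Proof. by move=> mP mf; exact: measurable_fun_ifT. Qed.

End measurability.

Ltac meas := repeat match goal with
 | |- measurable_fun _ _ => assumption
 | |- measurable_fun _ (fun _ => ?c) => exact: measurable_cst
 | |- measurable_fun _ (fun x => x) => exact: measurable_id
 | |- measurable_fun _ (EFin \o _) => apply/measurable_EFinP
 | |- measurable_fun _ (fun x => EFin _) => apply/measurable_EFinP
 | |- measurable_fun _ (fun x => fst _) => apply: (measurableT_comp measurable_fst)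
 | |- measurable_fun _ (fun x => snd _) => apply: (measurableT_comp measurable_snd)
 | |- measurable_fun _ (GRing.mul _) => apply: measurable_funM
 | |- measurable_fun _ (GRing.add _) => apply: measurable_funD
 | |- measurable_fun _ -%R => exact: oppr_measurable
 | |- measurable_fun _ (Order.le _) => apply: measurable_fun_ler
 | |- measurable_fun _ (Order.lt _) => apply: measurable_fun_ltr
 | |- measurable_fun _ GRing.inv => apply: (@measurable_funV _ _ _ (fun x => x))
 | |- measurable_fun _ sin => exact: measurable_sin
 | |- measurable_fun _ cos => exact: measurable_cos
 | |- measurable_fun _ atan => exact: measurable_atan
 | |- measurable_fun _ expR => exact: measurable_expR
 | |- measurable_fun _ ln => exact: measurable_ln
 | |- measurable_fun _ Num.norm => exact: normr_measurable
 | |- measurable_fun _ fst => exact: measurable_fst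
 | |- measurable_fun _ snd => exact: measurable_snd
 | |- measurable_fun _ (fun x => - _) => apply: measurable_funN
 | |- measurable_fun _ (fun x => _ + _) => apply: measurable_funD
 | |- measurable_fun _ (fun x => _ * _) => apply: measurable_funM
 | |- measurable_fun _ (fun x => _ ^+ _) => apply: measurable_funX
 | |- measurable_fun _ (fun x => _ ^-1) => apply: measurable_funV
 | |- measurable_fun _ (fun x => sin _) => apply: (measurableT_comp measurable_sin)
 | |- measurable_fun _ (fun x => cos _) => apply: (measurableT_comp measurable_cos)
 | |- measurable_fun _ (fun x => atan _) => apply: (measurableT_comp measurable_atan)
 | |- measurable_fun _ (fun x => expR _) => apply: (measurableT_comp (@measurable_expR _))
 | |- measurable_fun _ (fun x => ln _) => apply: (measurableT_comp (@measurable_ln _))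
 | |- measurable_fun _ (fun x => Num.norm _) => apply: (measurableT_comp (@normr_measurable _ setT))
 | |- measurable_fun _ (fun x => powR _ ?c) => apply: (measurableT_comp (@measurable_powR _ c))
 | |- measurable_fun _ (fun x => Num.min _ _) => apply: measurable_minr
 | |- measurable_fun _ (fun x => (_ <= _)%R) => apply: measurable_fun_ler
 | |- measurable_fun _ (fun x => (_ < _)%R) => apply: measurable_fun_ltr
 | |- measurable_fun _ (fun x => (_ == _)%R) => apply: measurable_fun_eqr
 | |- measurable_fun _ (fun x => (_ && _)) => apply: measurable_and
 | |- measurable_fun _ (fun x => ~~ _) => apply: measurable_neg
 | H : measurable_fun _ ?f |- measurable_fun _ (fun x => ?f _) => apply: (measurableT_comp H)
 | H : measurable_fun _ ?f |- measurable_fun _ (fun x => ?f (_, _)) => apply: (measurableT_comp H); apply/measurable_fun_pairP; split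
 | |- measurable_fun _ (fun x => (_, _)) => apply: measurable_fun_pair
 | |- measurable_fun _ _ => apply: measurable_indic_bool
 end.

Section FTC.
Context {R : realType}.
Local Notation leb := (@lebesgue_measure R).
Implicit Types (f F : R -> R) (a b l : R).

Lemma ge0_FTC2y f F a l : (forall x, a <= x -> 0 <= f x) -> continuous f ->
  (forall x : R, is_derive x 1 F (f x)) -> F x @[x --> +oo] --> l ->
  (\int[leb]_(x in `[a, +oo[) (f x)%:E = (l - F a)%:E)%E.
Proof.
move=> f0 cf dF Fl; rewrite (@ge0_continuous_FTC2y _ f F a l)//.
- exact: continuous_subspaceT.
- apply: cvg_at_right_filter; apply: differentiable_continuous.
  apply/derivable1_diffP; exact: (@ex_derive _ _ _ _ _ _ _ (dF a)).
- by move=> x _; rewrite derive1E; apply: derive_val.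
Qed.

Lemma FTC2 f F a b : a <= b -> (forall x, a <= x <= b -> {for x, continuous f}) ->
  (forall x, a <= x <= b -> is_derive x 1 F (f x)) ->
  (\int[leb]_(x in `[a, b]) (f x)%:E = (F b - F a)%:E)%E.
Proof.
move=> + cf dF; rewrite le_eqVlt => /predU1P[<-|ab].
  by rewrite set_itv1 integral_set1 subrr.
have cF x : a <= x <= b -> {for x, continuous F}.
  move=> axb; apply: differentiable_continuous; apply/derivable1_diffP.
  exact: (@ex_derive _ _ _ _ _ _ _ (dF x axb)).
rewrite (@continuous_FTC2 _ f F a b ab)//.
- by apply: continuous_in_subspaceT => x /set_mem/=; rewrite in_itv; exact: cf.
- split.
  + move=> x /[!in_itv]/= /andP[ax xb].
    by apply: (@ex_derive _ _ _ _ _ _ _ (dF x _)); rewrite !ltW.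
  + by apply: cvg_at_right_filter; apply: cF; rewrite lexx ltW.
  + by apply: cvg_at_left_filter; apply: cF; rewrite lexx ltW.
- move=> x /[!in_itv]/= /andP[ax xb]; rewrite derive1E; apply: derive_val.
  by apply: dF; rewrite !ltW.
Qed.

End FTC.

(** Together with a push-forward, this turns integration against a density into integration over the
    region below its graph. *)
Lemma ge0_integral_mrestr d (T : measurableType d) (R : realType)
    (mu : {measure set T -> \bar R}) (D : set T) (mD : measurable D) (f : T -> \bar R) :
  measurable_fun setT f -> (forall x, (0 <= f x)%E) ->
  (\int[mrestr mu mD]_x f x = \int[mu]_x (f x * (\1_D x)%:E))%E.
Proof.
move=> mf f0; transitivity (\int[mrestr mu mD]_(x in D) f x)%E.
  rewrite [LHS](@ge0_negligible_integral _ _ _ _ _ (~` D))//=.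
  - by rewrite setTD setCK.
  - exact: measurableC.
  - by rewrite /= /mrestr setICl measure0.
transitivity (\int[mu]_(x in D) f x)%E.
  by apply: eq_measure_integral => A mA AD; rewrite /= /mrestr setIidl.
rewrite integral_mkcond; apply: eq_integral => x _.
by rewrite patchE indicE; case: ifPn; rewrite ?mule1 ?mule0.
Qed.

(** * Changes of variables on the line *)

Section substitution.
Context {R : realType}.
Local Notation leb := (@lebesgue_measure R).
Implicit Types f : R -> \bar R.
Local Open Scope ereal_scope.

(** The push-forward of Lebesgue measure under a translation has the right mass on half-open
    intervals, and these determine it. The dilation below follows the same scheme. *)
Lemma ge0_integral_shift f (c : R) : measurable_fun setT f -> (forall x, 0 <= f x) ->
  \int[leb]_x f (x + c)%R = \int[leb]_x f x.
Proof.
move=> mf f0.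
have mphi : measurable_fun setT (fun x : measurableTypeR R => (x + c)%R : measurableTypeR R) by meas.
transitivity (\int[pushforward leb (fun x : measurableTypeR R => (x + c)%R : measurableTypeR R)]_x f x).
  by rewrite (ge0_integral_pushforward mphi).
apply: eq_measure_integral => A mA _; apply/esym/lebesgue_measure_unique => // _ [[a b]] _ <-.
have E : (+%R^~ c) @^-1` `]a, b] = `](a - c)%R, (b - c)%R]%classic.
  by apply/seteqP; split => x /=; rewrite !in_itv/= ltrBlDr lerBrDr.
change (leb `]a, b] = leb ((+%R^~ c) @^-1` `]a, b])); rewrite E.
rewrite !lebesgue_measure_itv/= !lte_fin ltrD2r; case: ifP => // _.
by rewrite -!EFinB; congr (_%:E); ring.
Qed.

Lemma ge0_integral_reflect f : measurable_fun setT f -> (forall x, 0 <= f x) ->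
  \int[leb]_x f (- x)%R = \int[leb]_x f x.
Proof.
move=> mf f0.
have mphi : measurable_fun setT (-%R : measurableTypeR R -> measurableTypeR R) by meas.
transitivity (\int[pushforward leb (-%R : measurableTypeR R -> measurableTypeR R)]_x f x).
  by rewrite (ge0_integral_pushforward mphi).
by apply: eq_measure_integral => A mA _; exact: lebesgue_measureN.
Qed.

Lemma integral_reflect f : measurable_fun setT f ->
  \int[leb]_x f (- x)%R = \int[leb]_x f x.
Proof.
move=> mf; rewrite integralE [RHS]integralE; congr (_ - _).
- rewrite -(ge0_integral_reflect (measurable_realfun.measurable_funepos mf))//.
  by apply: eq_integral => x _; rewrite !funeposE.
- rewrite -(ge0_integral_reflect (measurable_realfun.measurable_funeneg mf))//.
  by apply: eq_integral => x _; rewrite !funenegE.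
Qed.

Lemma ge0_integral_scale f (c : R) : (c != 0)%R ->
  measurable_fun setT f -> (forall x, 0 <= f x) ->
  `|c|%:E * \int[leb]_x f (c * x)%R = \int[leb]_x f x.
Proof.
move=> c0 mf f0.
have mphi : measurable_fun setT (fun x : measurableTypeR R => (c * x)%R : measurableTypeR R) by meas.
rewrite -(ge0_integral_pushforward mphi leb measurableT mf)//.
have nc : (0 <= `|c|)%R by [].
pose k : {nonneg R} := NngNum nc.
rewrite -[LHS](@ge0_integral_mscale _ _ _ (pushforward leb (fun x : measurableTypeR R => (c * x)%R : measurableTypeR R)) _ measurableT k)//.
apply: eq_measure_integral => A mA _; apply/esym/lebesgue_measure_unique => // _ [[a b]] _ <-.
change (leb `]a, b] = `|c|%:E * leb (( *%R c) @^-1` `]a, b])).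
(* A negative factor reverses the interval, so its preimage is closed on the left instead of the
   right; the length is not affected. *)
have [c_lt0|c_gt0|/eqP] := ltgtP c 0%R; last by rewrite (negbTE c0).
  have -> : ( *%R c) @^-1` `]a, b] = `[(c^-1 * b)%R, (c^-1 * a)%R[%classic.
    apply/seteqP; split => x /=; rewrite !in_itv/= => /andP[].
      by rewrite ler_ndivrMl// ltr_ndivlMl// => -> ->.
    by rewrite ler_ndivrMl// ltr_ndivlMl// => -> ->.
  rewrite !lebesgue_measure_itv/= !lte_fin ltr_nM2l ?invr_lt0//; case: ifP => _; last by rewrite mule0.
  by rewrite ltr0_norm// -!EFinB -EFinM; congr (_%:E); field; rewrite lt_eqF.
have -> : ( *%R c) @^-1` `]a, b] = `](c^-1 * a)%R, (c^-1 * b)%R]%classic.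
  apply/seteqP; split => x /=; rewrite !in_itv/= => /andP[].
    by rewrite ltr_pdivrMl// ler_pdivlMl// => -> ->.
  by rewrite ltr_pdivrMl// ler_pdivlMl// => -> ->.
rewrite !lebesgue_measure_itv/= !lte_fin ltr_pM2l ?invr_gt0//; case: ifP => _; last by rewrite mule0.
by rewrite gtr0_norm// -!EFinB -EFinM; congr (_%:E); field; rewrite gt_eqF.
Qed.

Lemma integral_itvV (a b : R) : (0 < a)%R -> (a <= b)%R ->
  \int[leb]_(x in `[a, b]) (x^-1)%:E = (ln b - ln a)%:E.
Proof.
move=> a0 ab; apply: FTC2 => // x /andP[ax xb].
  by apply: inv_continuous; rewrite gt_eqF// (lt_le_trans a0).
by apply: is_derive1_ln; rewrite (lt_le_trans a0).
Qed.

(** The measure dx / x on the half line is encoded as area: planar Lebesgue measure on the region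
    below the graph of 1 / x. *)
Let subgraph : set (measurableTypeR R * measurableTypeR R) :=
  [set z | [&& 0 < z.1, 0 <= z.2 & z.2 <= z.1^-1]%R].

Let msubgraph : measurable subgraph.
Proof.
have -> : subgraph = (fun z => [&& 0 < z.1, 0 <= z.2 & z.2 <= z.1^-1]%R) @^-1` [set true].
  by apply/seteqP; split => z /=.
rewrite -[_ @^-1` _]setTI; have : measurable_fun setT (fun z : measurableTypeR R * measurableTypeR R => [&& 0 < z.1, 0 <= z.2 & z.2 <= z.1^-1]%R) by meas.
exact.
Qed.

Let mlnfst : measurable_fun setT (fun z : measurableTypeR R * measurableTypeR R => ln z.1 : measurableTypeR R).
Proof. by apply: (measurableT_comp (@measurable_ln R)). Qed.

Let subgraphE (g : R -> \bar R) (x : R) :  (0 < x)%R -> 0 <= g x ->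
  \int[leb]_y (g x * (\1_subgraph (x, y))%:E) = g x * (x^-1)%:E.
Proof.
move=> x0 gx0; have xV0 : (0 < x^-1)%R by rewrite invr_gt0.
have ms : measurable (`[0%R, (x^-1)%R]%classic : set R) by [].
transitivity (\int[leb]_y (g x * (\1_(`[0%R, (x^-1)%R]%classic : set R) y)%:E)).
  apply: eq_integral => y _; congr (_ * (_ : bool)%:R%:E).
  by apply/idP/idP; rewrite !inE /subgraph/= in_itv/= x0.
rewrite ge0_integralZl//; last by apply/measurable_EFinP.
rewrite integral_indic// setIT/= lebesgue_measure_itv/= lte_fin xV0.
by rewrite oppr0 adde0.
Qed.

Let subgraph_tonelli f : measurable_fun setT f -> (forall x, 0 <= f x) ->
  \int[leb \x leb]_z (f (ln z.1) * (\1_subgraph z)%:E) =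
  \int[leb]_(x in `]0%R, +oo[) (f (ln x) * (x^-1)%:E).
Proof.
move=> mf f0; rewrite fubini_tonelli1; last 2 first.
- apply: emeasurable_funM; last exact/measurable_EFinP.
  by apply: (measurableT_comp mf).
- by move=> z; rewrite mule_ge0// lee_fin.
rewrite [RHS]integral_mkcond; apply: eq_integral => x _; rewrite /fubini_F patchE.
case: ifPn => [|x0].
  rewrite inE/= in_itv/= andbT => x0.
  by rewrite (subgraphE (g := fun x => f (ln x))).
rewrite integral0_eq// => y _; rewrite indicE memNset ?mule0//.
by rewrite /subgraph/= => /and3P[]; move: x0; rewrite notin_setE/= in_itv/= andbT.
Qed.

(** Lebesgue measure is the image of the area below 1 / x under (x, y) -> ln x: the interval ]a, b]
    receives the integral of 1 / x from exp a to exp b, which is b - a. This is [H]; applied to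
    f(exp s) exp s it gives the claim. *)
Lemma ge0_integral_expR_subst f : measurable_fun setT f -> (forall x, 0 <= f x) ->
  \int[leb]_(x in `]0%R, +oo[) f x = \int[leb]_s (f (expR s) * (expR s)%:E).
Proof.
have H g : measurable_fun setT g -> (forall x, 0 <= g x) ->
    \int[leb]_x g x = \int[leb]_(x in `]0%R, +oo[) (g (ln x) * (x^-1)%:E).
  move=> mg g0.
  rewrite -subgraph_tonelli// -(ge0_integral_mrestr _ msubgraph); last 2 first.
    exact: (measurableT_comp mg).
    by [].
  rewrite -(ge0_integral_pushforward mlnfst (mrestr (leb \x leb) msubgraph) measurableT mg)//.
  apply: eq_measure_integral => A mA _; apply/lebesgue_measure_unique => // _ [[a b]] _ <-.
  have mab : measurable (`]a, b]%classic : set R) by [].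
  change (leb `]a, b] = (leb \x leb) ([set z | `]a, b]%classic (ln z.1)] `&` subgraph)).
  have mI : measurable ([set z | `]a, b]%classic (ln z.1)] : set (measurableTypeR R * measurableTypeR R)).
    by rewrite -[X in measurable X]setTI; exact: mlnfst.
  transitivity (\int[leb \x leb]_z ((\1_(`]a, b]%classic : set R) (ln z.1))%:E * (\1_subgraph z)%:E)); last first.
    transitivity (\int[leb \x leb]_z (\1_([set z | `]a, b]%classic (ln z.1)] `&` subgraph) z)%:E).
      by apply: eq_integral => z _; rewrite -EFinM indicI.
    by rewrite integral_indic ?setIT//; exact: measurableI.
  rewrite (subgraph_tonelli (f := fun s => (\1_(`]a, b]%classic : set R) s)%:E))//; last by exact/measurable_EFinP.
  transitivity (\int[leb]_(x in `]expR a, expR b]) (x^-1)%:E); last first.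
    rewrite [LHS]integral_mkcond [RHS]integral_mkcond; apply: eq_integral => x _.
    rewrite !patchE !mem_setE/= !in_itv/= andbT; case: (ltP 0%R x) => x0; last first.
      by case: ifPn => // /andP[xa _]; have := lt_trans (expR_gt0 a) xa; rewrite ltNge x0.
    rewrite indicE mem_setE/= in_itv/= -{1}[x]lnK// -{2}[x]lnK//.
    by rewrite ltr_expR ler_expR; case: ifPn; rewrite ?mul1e ?mul0e.
  have [ab|ba] := leP a b.
    have mV : measurable_fun setT (fun x : R => (x^-1)%:E) by meas.
    rewrite (integral_itv_obnd_cbnd (measurable_funTS mV)).
    rewrite integral_itvV ?expR_gt0// ?ler_expR// !expRK.
    rewrite lebesgue_measure_itv/= lte_fin; case: ltgtP ab => // -> _.
    by rewrite subrr.
  rewrite set_itv_ge; last by rewrite bnd_simp -leNgt ltW.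
  by rewrite set_itv_ge ?measure0 ?integral_set0// bnd_simp ltr_expR -leNgt ltW.
move=> mf f0; rewrite [RHS]H; last 2 first.
- apply: emeasurable_funM; last by meas.
  by apply: (measurableT_comp mf); exact: measurable_expR.
- by move=> x; rewrite mule_ge0// lee_fin expR_ge0.
apply: eq_integral => x; rewrite inE/= in_itv/= andbT => x0.
by rewrite lnK// -muleA -EFinM divff ?mule1// gt_eqF.
Qed.

(** In the logarithmic variable a power map is the dilation by c, so the exponential substitution
    and scaling give the result, also for negative c. *)
Lemma ge0_integral_powR_subst f (c : R) : (c != 0)%R ->
  measurable_fun setT f -> (forall x, 0 <= f x) ->
  \int[leb]_(x in `]0%R, +oo[) (f ((x : R) `^ c)%R * (`|c| * (x : R) `^ (c - 1))%:E) =
  \int[leb]_(x in `]0%R, +oo[) f x.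
Proof.
move=> c0 mf f0; rewrite ge0_integral_expR_subst; last 2 first.
- by apply: emeasurable_funM; [apply: (measurableT_comp mf)|]; meas.
- by move=> x; rewrite mule_ge0// lee_fin mulr_ge0// powR_ge0.
rewrite ge0_integral_expR_subst// -[RHS](@ge0_integral_scale _ c)//; last 2 first.
- apply: emeasurable_funM; last by meas.
  by apply: (measurableT_comp mf); exact: measurable_expR.
- by move=> x; rewrite mule_ge0// lee_fin expR_ge0.
rewrite -ge0_integralZl//; last 2 first.
- apply: emeasurable_funM; last by meas.
  by apply: (measurableT_comp mf); meas.
- by move=> x _; rewrite mule_ge0// lee_fin expR_ge0.
apply: eq_integral => s _.
have E r : (expR s `^ r = expR (r * s))%R by rewrite /powR gt_eqF ?expR_gt0// expRK.
rewrite !E -muleA -EFinM muleCA; congr (_ * _); rewrite -EFinM -mulrA; congr (_ * _)%:E.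
by rewrite -expRD; congr expR; ring.
Qed.

End substitution.

(** * Poisson kernel *)

Section derivatives.
Context {R : realType}.
Implicit Types (f g : R -> R) (x a b : R).

Lemma der_cst (c : R) x : is_derive x 1 (fun _ : R => c) 0.
Proof. exact: is_derive_cst. Qed.

Lemma der_id x : is_derive x 1 (fun y : R => y) 1.
Proof. exact: is_derive_id. Qed.

Lemma derD f g x a b : is_derive x 1 f a -> is_derive x 1 g b ->
  is_derive x 1 (fun y => f y + g y) (a + b).
Proof. by move=> ? ?; exact: is_deriveD. Qed.

Lemma derN f x a : is_derive x 1 f a -> is_derive x 1 (fun y => - f y) (- a).
Proof. by move=> ?; exact: is_deriveN. Qed.

Lemma derM f g x a b : is_derive x 1 f a -> is_derive x 1 g b ->
  is_derive x 1 (fun y => f y * g y) (a * g x + f x * b).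
Proof.
move=> df dg; have := is_deriveM df dg; congr (is_derive _ _ _ _).
by rewrite addrC /GRing.scale/= [g x * _]mulrC.
Qed.

Lemma derV f x a : f x != 0 -> is_derive x 1 f a ->
  is_derive x 1 (fun y => (f y)^-1) (- (f x) ^- 2 * a).
Proof. by move=> fx0 df; have := is_deriveV fx0 df. Qed.

Lemma derX f x a n : is_derive x 1 f a ->
  is_derive x 1 (fun y => f y ^+ n.+1) (n.+1%:R * f x ^+ n * a).
Proof.
move=> df; elim: n => [|n IH].
  by rewrite (_ : (fun y => _) = f) ?expr0 ?mulr1 ?mul1r//; apply/funext => y; rewrite expr1.
rewrite (_ : (fun y => _) = (fun y => f y * f y ^+ n.+1)); last first.
  by apply/funext => y; rewrite exprS.
have := derM df IH; congr (is_derive _ _ _ _).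
by rewrite -[n.+2%:R]natr1 exprS; ring.
Qed.

Lemma der_expR f x a : is_derive x 1 f a ->
  is_derive x 1 (fun y => expR (f y)) (expR (f x) * a).
Proof. by move=> df; exact: is_derive1_comp. Qed.

Lemma der_sin f x a : is_derive x 1 f a ->
  is_derive x 1 (fun y => sin (f y)) (cos (f x) * a).
Proof. by move=> df; exact: is_derive1_comp. Qed.

Lemma der_cos f x a : is_derive x 1 f a ->
  is_derive x 1 (fun y => cos (f y)) (- sin (f x) * a).
Proof. by move=> df; exact: is_derive1_comp. Qed.

Lemma der_atan f x a : is_derive x 1 f a ->
  is_derive x 1 (fun y => atan (f y)) ((1 + f x ^+ 2)^-1 * a).
Proof. by move=> df; exact: is_derive1_comp. Qed.

Lemma der_powR f x a (c : R) : 0 < f x -> is_derive x 1 f a ->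
  is_derive x 1 (fun y => f y `^ c) (c * f x `^ (c - 1) * a).
Proof. move=> fx0 df; have h := is_derive1_powR c fx0.
exact: (@is_derive1_comp _ (fun y => y `^ c) f x _ a h df). Qed.

Lemma der_eq f x a b : is_derive x 1 f a -> a = b -> is_derive x 1 f b.
Proof. by move=> + <-. Qed.

Lemma der_continuous f x a : is_derive x 1 f a -> {for x, continuous f}.
Proof.
move=> df; apply: differentiable_continuous; apply/derivable1_diffP.
exact: (@ex_derive _ _ _ _ _ _ _ df).
Qed.

End derivatives.

Ltac der := repeat match goal with
 | H : is_derive _ _ ?f _ |- is_derive _ _ ?f _ => eexact H
 | |- is_derive _ _ (fun _ => ?c) _ => notypeclasses refine (@der_cst _ _ _)
 | |- is_derive _ _ (fun y => y) _ => notypeclasses refine (@der_id _ _)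
 | |- is_derive _ _ (GRing.mul _) _ => notypeclasses refine (@derM _ _ (fun y => y) _ _ _ _ _)
 | |- is_derive _ _ (GRing.add _) _ => notypeclasses refine (@derD _ _ (fun y => y) _ _ _ _ _)
 | |- is_derive _ _ GRing.opp _ => notypeclasses refine (@derN _ (fun y => y) _ _ _)
 | |- is_derive _ _ expR _ => notypeclasses refine (@der_expR _ (fun y => y) _ _ _)
 | |- is_derive _ _ sin _ => notypeclasses refine (@der_sin _ (fun y => y) _ _ _)
 | |- is_derive _ _ cos _ => notypeclasses refine (@der_cos _ (fun y => y) _ _ _)
 | |- is_derive _ _ (fun y => _ + _) _ => notypeclasses refine (@derD _ _ _ _ _ _ _ _)
 | |- is_derive _ _ (fun y => - _) _ => notypeclasses refine (@derN _ _ _ _ _)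
 | |- is_derive _ _ (fun y => _ * _) _ => notypeclasses refine (@derM _ _ _ _ _ _ _ _)
 | |- is_derive _ _ (fun y => _ ^+ _) _ => notypeclasses refine (@derX _ _ _ _ _ _)
 | |- is_derive _ _ (fun y => _ ^-1) _ => notypeclasses refine (@derV _ _ _ _ _ _)
 | |- is_derive _ _ (fun y => expR _) _ => notypeclasses refine (@der_expR _ _ _ _ _)
 | |- is_derive _ _ (fun y => sin _) _ => notypeclasses refine (@der_sin _ _ _ _ _)
 | |- is_derive _ _ (fun y => cos _) _ => notypeclasses refine (@der_cos _ _ _ _ _)
 | |- is_derive _ _ (fun y => atan _) _ => notypeclasses refine (@der_atan _ _ _ _ _)
 | |- is_derive _ _ (fun y => powR _ _) _ => notypeclasses refine (@der_powR _ _ _ _ _ _ _)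
 end; cbv beta.

Ltac der_to := notypeclasses refine (@der_eq _ _ _ _ _ _ _).

(** * Real-valued integrals over product measures *)

Section product_sigma_finite.
Local Open Scope ereal_scope.
Context d1 d2 (T1 : measurableType d1) (T2 : measurableType d2) (R : realType).
Variables (m1 : {sigma_finite_measure set T1 -> \bar R})
  (m2 : {sigma_finite_measure set T2 -> \bar R}).

Let product_measure_sigma_finite : sigma_finite setT (m1 \x m2).
Proof.
have /sigma_finiteP[F [TF ndF Foo]] := sigma_finiteT m1.
have /sigma_finiteP[G [TG ndG Goo]] := sigma_finiteT m2.
exists (fun n => F n `*` G n).
 rewrite -setXTT TF TG predeqE => -[x y]; split.
    move=> [/= [n _ Fnx] [k _ Gky]]; exists (maxn n k) => //; split.
    - by move: x Fnx; exact/subsetPset/ndF/leq_maxl.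
    - by move: y Gky; exact/subsetPset/ndG/leq_maxr.
  by move=> [n _ []/= ? ?]; split; exists n.
move=> k; have [? ?] := Foo k; have [? ?] := Goo k.
split; first exact: measurableX.
by rewrite product_measure1E// lte_mul_pinfty// ge0_fin_numE.
Qed.

(* The sigma-finiteness of m1 \x m2 is not inferred, so the product is packed by
   hand; sfprod is convertible to m1 \x m2. *)
Definition sfprod : {sigma_finite_measure set (T1 * T2)%type -> \bar R} :=
  HB.pack (m1 \x m2)
    (Measure_isSigmaFinite.Build _ _ _ (m1 \x m2) product_measure_sigma_finite).

End product_sigma_finite.

Section product_integral.
Context d1 d2 (T1 : measurableType d1) (T2 : measurableType d2) (R : realType).
Variables (m1 : {sigma_finite_measure set T1 -> \bar R})
  (m2 : {sigma_finite_measure set T2 -> \bar R}).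

Lemma integrable_tensor (f : T1 -> R) (g : T2 -> R) :
  m1.-integrable setT (EFin \o f) -> m2.-integrable setT (EFin \o g) ->
  (m1 \x m2)%E.-integrable setT (fun z => (f z.1 * g z.2)%:E).
Proof.
move=> intf intg.
have /measurable_EFinP mf := measurable_int _ intf.
have /measurable_EFinP mg := measurable_int _ intg.
apply/integrable12ltyP; first by meas.
have -> : (\int[m1]_x \int[m2]_y `|(f (x, y).1 * g (x, y).2)%:E| =
    (\int[m1]_x `|(f x)%:E|) * (\int[m2]_y `|(g y)%:E|))%E.
  rewrite -ge0_integralZr//; last 2 first.
    by apply: measurableT_comp => //; exact/measurable_EFinP.
    exact: integral_ge0.
  apply: eq_integral => x _; rewrite -ge0_integralZl//; last first.
    by apply: measurableT_comp => //; exact/measurable_EFinP.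
  by apply: eq_integral => y _; rewrite /= normrM EFinM.
rewrite lte_mul_pinfty//.
- exact: integral_ge0.
- by apply: integrable_fin_num => //; exact: integrable_abse.
- by case/integrableP : intg.
Qed.

Lemma Rintegral_tensor (f : T1 -> R) (g : T2 -> R) :
  m1.-integrable setT (EFin \o f) -> m2.-integrable setT (EFin \o g) ->
  \int[(m1 \x m2)%E]_z (f z.1 * g z.2) = \int[m1]_x f x * \int[m2]_y g y.
Proof.
move=> intf intg; rewrite -RintegralZr//; congr fine.
rewrite -(integral12_prod_meas1 (integrable_tensor intf intg)).
apply: eq_integral => x _; rewrite /fubini_F/=.
under eq_integral do rewrite EFinM.
rewrite integralZl// EFinM fineK//.
exact: integrable_fin_num.
Qed.

(** The inner integral is finite only almost everywhere, and [Rintegral] has a default value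
    elsewhere; this changes the extended-real iterated integrals on null sets only. *)
Lemma RFubini (F : T1 * T2 -> R) : (m1 \x m2)%E.-integrable setT (EFin \o F) ->
  \int[m1]_x \int[m2]_y F (x, y) = \int[m2]_y \int[m1]_x F (x, y).
Proof.
move=> iF; congr fine; have := Fubini iF.
have A1 := ae_integrable1 iF; have A2 := ae_integrable2 iF.
have B1 : (\int[m1]_x \int[m2]_y (EFin \o F) (x, y) =
    \int[m1]_x (\int[m2]_y F (x, y))%:E)%E.
  apply: ae_eq_integral => //.
  - exact: (measurable_int _ (integrable_fubini_F iF)).
  - apply/measurable_EFinP; apply: measurableT_comp => //.
    exact: (measurable_int _ (integrable_fubini_F iF)).
  - apply: filterS A1 => x ix _; rewrite fineK//.
    exact: integrable_fin_num ix.
have B2 : (\int[m2]_y \int[m1]_x (EFin \o F) (x, y) =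
    \int[m2]_y (\int[m1]_x F (x, y))%:E)%E.
  apply: ae_eq_integral => //.
  - exact: (measurable_fubini_G iF).
  - apply/measurable_EFinP; apply: measurableT_comp => //.
    exact: (measurable_fubini_G iF).
  - apply: filterS A2 => x ix _; rewrite fineK//.
    exact: integrable_fin_num ix.
by rewrite B1 B2.
Qed.

(** The left-hand side stays an extended-real integral, so its finiteness is part of the claim; the
    L^2 computation needs this form. *)
Lemma Fubini_EFin (F : T1 * T2 -> R) : (m1 \x m2)%E.-integrable setT (EFin \o F) ->
  (\int[m1]_x (\int[m2]_y F (x, y))%:E = (\int[m2]_y \int[m1]_x F (x, y))%:E)%E.
Proof.
move=> iF; rewrite -RFubini//; rewrite fineK//.
have := integrable_fubini_F iF.
have A1 := ae_integrable1 iF.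
move=> /(integrable_fin_num measurableT).
congr (_ \is a fin_num); apply: ae_eq_integral => //.
- exact: (measurable_int _ (integrable_fubini_F iF)).
- apply/measurable_EFinP; apply: measurableT_comp => //.
  exact: (measurable_int _ (integrable_fubini_F iF)).
- by apply: filterS A1 => x ix _; rewrite fineK//; exact: integrable_fin_num ix.
Qed.

End product_integral.

(* The cosine transform of the Abel weight wt e is the Poisson kernel pk e. *)
HB.lock Definition wt {R : realType} (e x : R) : R := expR (- (e * `|x|)).
HB.lock Definition pk {R : realType} (e a : R) : R := 2 * e / (e ^+ 2 + a ^+ 2).

Section poisson.
Context {R : realType}.
Local Notation leb := (@lebesgue_measure R).
Implicit Types (e a x : R).

Lemma wtE e : wt e = fun x => expR (- (e * `|x|)).
Proof. by rewrite unlock. Qed.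

Lemma pkE e : pk e = fun a => 2 * e / (e ^+ 2 + a ^+ 2).
Proof. by rewrite unlock. Qed.

Lemma wt_ge0 e x : 0 <= wt e x. Proof. by rewrite wtE; exact: expR_ge0. Qed.

Lemma wt_le1 e x : 0 <= e -> wt e x <= 1.
Proof. by move=> e0; rewrite wtE -expR0 ler_expR oppr_le0 mulr_ge0. Qed.

Lemma pk_ge0 e a : 0 <= e -> 0 <= pk e a.
Proof. by move=> e0; rewrite pkE divr_ge0 ?mulr_ge0 ?addr_ge0 ?sqr_ge0. Qed.

Lemma measurable_wt e : measurable_fun setT (wt e).
Proof. by rewrite wtE; meas. Qed.

Lemma measurable_pk e : measurable_fun setT (pk e).
Proof. by rewrite pkE; meas. Qed.

Lemma pk_den_gt0 e a : 0 < e -> 0 < e ^+ 2 + a ^+ 2.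
Proof. by move=> e0; rewrite ltr_wpDr ?sqr_ge0// exprn_gt0. Qed.

Lemma continuous_wt e : continuous (wt e).
Proof.
rewrite wtE => x; apply: (@continuous_comp _ _ _ (fun y => - (e * `|y|)) expR); last exact: continuous_expR.
apply: continuousN; apply: continuousM; first exact: cst_continuous.
exact: norm_continuous.
Qed.

Lemma cvg_expR_bounded (e : R) (g : R -> R) (M : R) : 0 < e -> (forall x, `|g x| <= M) ->
  expR (- (e * x)) * g x @[x --> +oo] --> 0.
Proof.
move=> e0 gM.
have M0 : 0 <= M by apply: le_trans (gM 0).
have H : M * expR (- (e * x)) @[x --> +oo] --> 0.
  rewrite -(mulr0 M); apply: cvgMr.
  apply: (@cvg_comp _ _ _ (fun x => e * x) (fun y => expR (- y)) _ (+oo)%R); last exact: cvgr_expR.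
  exact: gt0_cvgMry.
apply: (@squeeze_cvgr _ _ _ _ (fun x => - (M * expR (- (e * x)))) (fun x => M * expR (- (e * x)))) => //.
- near=> x; rewrite -ler_norml normrM ger0_norm ?expR_ge0// mulrC.
  by rewrite ler_wpM2r ?expR_ge0.
- by rewrite -oppr0; apply: cvgN.
Unshelve. all: by end_near. Qed.

(** Adding 1 to the cosine keeps the integrand nonnegative, so that the fundamental theorem of
    calculus for nonnegative integrands on a half line applies. The plain cosine transform follows
    by subtracting the integral of the weight, which comes from the case a = 0. *)
Lemma ge0_integral_wt_cos1 e a : 0 < e ->
  (\int[leb]_x (wt e x * (1 + cos (a * x)))%:E = (2 * e^-1 + pk e a)%:E)%E.
Proof.
move=> e0; have en0 : e != 0 by rewrite gt_eqF.
have dn0 : e ^+ 2 + a ^+ 2 != 0 by rewrite gt_eqF// pk_den_gt0.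
rewrite ge0_symfun_integralT; last 3 first.
- by move=> x; rewrite mulr_ge0 ?wt_ge0// -lerBlDl sub0r cos_geN1.
- move=> x; apply: (@continuousM _ _ (wt e) (fun x => 1 + cos (a * x))); first exact: continuous_wt.
  apply: continuousD; first exact: cst_continuous.
  apply: (@continuous_comp _ _ _ (fun y => a * y) cos); last exact: continuous_cos.
  by apply: continuousM; [exact: cst_continuous|exact: id].
- by move=> x /=; rewrite wtE normrN mulrN cosN.
pose f (x : R) := expR (- (e * x)) * (1 + cos (a * x)).
(* The primitive that vanishes at infinity; its value at 0 is -1 / e - e / (e^2 + a^2), and evenness
   doubles it. *)
pose F (x : R) := expR (- (e * x)) * (- e^-1 + (a * sin (a * x) - e * cos (a * x)) / (e ^+ 2 + a ^+ 2)).
have f0 x : 0 <= f x by rewrite mulr_ge0 ?expR_ge0// -lerBlDl sub0r cos_geN1.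
have cf : continuous f by move=> x; notypeclasses refine (@der_continuous _ f x _ _); unfold f; der.
have dF (x : R) : is_derive x 1 F (f x).
  der_to; first by unfold F; der.
  cbv beta; rewrite /f; move: (expR _) (sin _) (cos _) => E s c.
  rewrite !(mul0r, mulr0, add0r, addr0, mulr1).
  by field; rewrite en0 dn0.
have Fl : F x @[x --> +oo] --> 0.
  apply: (@cvg_expR_bounded _ _ (e^-1 + (`|a| + e) / (e ^+ 2 + a ^+ 2))) => // x.
  have eV : 0 <= e^-1 by rewrite invr_ge0 ltW.
  have dV : 0 <= (e ^+ 2 + a ^+ 2)^-1 by rewrite invr_ge0 ltW// pk_den_gt0.
  rewrite (le_trans (ler_normD _ _))// normrN (ger0_norm eV) lerD2l.
  rewrite normrM (ger0_norm dV) ler_wpM2r//.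
  rewrite (le_trans (ler_normB _ _))// !normrM (ger0_norm (ltW e0)).
  rewrite lerD// ler_piMr// ?(ltW e0)//.
  + by rewrite ler_norml sin_geN1 sin_le1.
  + by rewrite ler_norml cos_geN1 cos_le1.
rewrite -set_itvE.
have -> : (\int[leb]_(x in `[0%R, +oo[) (wt e x * (1 + cos (a * x)))%:E = \int[leb]_(x in `[0%R, +oo[) (f x)%:E)%E.
  apply: eq_integral => x; rewrite inE/= in_itv/= andbT => x0.
  by rewrite wtE /f ger0_norm.
rewrite (ge0_FTC2y (fun x _ => f0 x) cf dF Fl) -EFinM; congr (_%:E).
rewrite /F pkE !mulr0 oppr0 expR0 sin0 cos0; field; apply/andP; split => //.
Qed.

Lemma ge0_integral_wt e : 0 < e -> (\int[leb]_x (wt e x)%:E = (2 / e)%:E)%E.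
Proof.
move=> e0; have := ge0_integral_wt_cos1 0 e0.
under eq_integral do rewrite mul0r cos0 -mulr2n mulrC EFinM.
rewrite ge0_integralZl//; last 2 first.
- by apply/measurable_EFinP; exact: measurable_wt.
- by move=> x _; rewrite lee_fin wt_ge0.
have -> : 2 * e^-1 + pk e 0 = 2 * (2 / e).
  by rewrite pkE expr0n/= addr0; field; rewrite gt_eqF.
move=> /(congr1 (fun z => ((2^-1)%:E * z)%E)); rewrite muleA -!EFinM mulVf// mul1e => ->.
by rewrite mulKf.
Qed.

Lemma integrable_wt e : 0 < e -> leb.-integrable setT (EFin \o wt e).
Proof.
move=> e0; apply/integrableP; split.
  by apply/measurable_EFinP; exact: measurable_wt.
under eq_integral do rewrite /= ger0_norm ?wt_ge0//.
by rewrite ge0_integral_wt// ltry.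
Qed.

Lemma integrable_wtM e (g : R -> R) : 0 < e -> measurable_fun setT g ->
  (forall x, `|g x| <= 1) -> leb.-integrable setT (EFin \o (fun x => wt e x * g x)).
Proof.
move=> e0 mg g1; apply: le_integrable (integrable_wt e0) => //.
  by apply/measurable_EFinP; apply: measurable_funM => //; exact: measurable_wt.
by move=> x _ /=; rewrite lee_fin normrM ler_piMr.
Qed.

Lemma norm_cos_le1 (x : R) : `|cos x| <= 1.
Proof. by rewrite ler_norml cos_geN1 cos_le1. Qed.

Lemma norm_sin_le1 (x : R) : `|sin x| <= 1.
Proof. by rewrite ler_norml sin_geN1 sin_le1. Qed.

Lemma integrable_wt_cos e a : 0 < e ->
  leb.-integrable setT (EFin \o (fun x => wt e x * cos (a * x))).
Proof. by move=> e0; apply: integrable_wtM => // [|x]; [meas|exact: norm_cos_le1]. Qed.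

Lemma integrable_wt_sin e a : 0 < e ->
  leb.-integrable setT (EFin \o (fun x => wt e x * sin (a * x))).
Proof. by move=> e0; apply: integrable_wtM => // [|x]; [meas|exact: norm_sin_le1]. Qed.

Lemma Rintegral_wt_cos e a : 0 < e -> \int[leb]_x (wt e x * cos (a * x)) = pk e a.
Proof.
move=> e0; have := ge0_integral_wt_cos1 a e0.
under eq_integral do rewrite mulrDr mulr1 EFinD.
rewrite integralD//=; last 2 first.
- exact: integrable_wt.
- exact: integrable_wt_cos.
rewrite ge0_integral_wt// /Rintegral.
have := integrable_fin_num measurableT (integrable_wt_cos a e0).
by move=> /fineK <-; rewrite -EFinD => -[] /addrI.
Qed.

Lemma Rintegral_wt_sin e a : 0 < e -> \int[leb]_x (wt e x * sin (a * x)) = 0.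
Proof.
move=> e0; have := integral_reflect (measurable_int _ (integrable_wt_sin a e0)).
rewrite /Rintegral; have := integrable_fin_num measurableT (integrable_wt_sin a e0).
move=> h.
rewrite [in X in X = _ -> _](_ : (fun x => _) = (fun x => - (wt e x * sin (a * x))%:E)%E); last first.
  by apply/funext => x; rewrite /= wtE normrN mulrN sinN mulrN EFinN.
rewrite integralN/=; last exact/fin_num_adde_defr/integrable_pos_fin_num/integrable_wt_sin.
by move: h => /fineK <-; rewrite -EFinN => -[] /=; lra.
Qed.

(** When the cosine of the sum is expanded, the sine terms integrate to 0 by oddness and a product
    of two Poisson kernels is left. *)
Lemma Rintegral_wt2_cos e a b : 0 < e ->
  \int[(leb \x leb)%E]_z (wt e z.1 * wt e z.2 * cos (a * z.1 + b * z.2)) = pk e a * pk e b.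
Proof.
move=> e0; transitivity (\int[(leb \x leb)%E]_z ((wt e z.1 * cos (a * z.1)) * (wt e z.2 * cos (b * z.2))
   - (wt e z.1 * sin (a * z.1)) * (wt e z.2 * sin (b * z.2)))).
  by apply: eq_Rintegral => z _; rewrite cosD; ring.
have ic a' := integrable_wt_cos a' e0; have is' a' := integrable_wt_sin a' e0.
rewrite RintegralB//; last 2 first.
- exact: (integrable_tensor (ic a) (ic b)).
- exact: (integrable_tensor (is' a) (is' b)).
rewrite (Rintegral_tensor (ic a) (ic b)) (Rintegral_tensor (is' a) (is' b)).
by rewrite !Rintegral_wt_cos// !Rintegral_wt_sin// mulr0 subr0.
Qed.

Lemma der_pk e (f : R -> R) x a : 0 < e -> is_derive x 1 f a ->
  is_derive x 1 (fun y => 2 * atan (f y / e)) (pk e (f x) * a).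
Proof.
move=> e0 df; der_to; first by der.
rewrite pkE mul0r add0r mulr0 addr0.
have h1 : e != 0 by rewrite gt_eqF.
have h2 : e ^+ 2 + f x ^+ 2 != 0 by rewrite gt_eqF// pk_den_gt0.
have -> : 1 + (f x / e) ^+ 2 = (e ^+ 2 + f x ^+ 2) / e ^+ 2 by field.
by field; apply/andP.
Qed.

Lemma continuous_pk e : 0 < e -> continuous (pk e).
Proof.
move=> e0; rewrite pkE => x; notypeclasses refine (@der_continuous _ _ x _ _); der.
by rewrite gt_eqF// pk_den_gt0.
Qed.

Lemma ge0_integral_pk e : 0 < e -> (\int[leb]_x (pk e x)%:E = (2 * pi)%:E)%E.
Proof.
move=> e0; rewrite ge0_symfun_integralT; last 3 first.
- by move=> x; rewrite pk_ge0// ltW.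
- exact: continuous_pk.
- by move=> x /=; rewrite pkE sqrrN.
rewrite -set_itvE.
have dF (x : R) : is_derive x 1 (fun x => 2 * atan (x / e)) (pk e x).
  by have := der_pk e0 (der_id x); rewrite mulr1.
have Fl : 2 * atan (x / e) @[x --> +oo] --> pi.
  rewrite [X in _ --> X](_ : _ = 2 * (pi / 2)); last by field.
  apply: cvgMr; apply: (@cvg_comp _ _ _ (fun x => x / e) (@atan R) _ (+oo)%R); last exact: cvgy_atan.
  by apply: gt0_cvgMly => //; rewrite invr_gt0.
rewrite (ge0_FTC2y (fun x _ => pk_ge0 _ (ltW e0)) (continuous_pk e0) dF Fl).
by rewrite mul0r atan0 mulr0 subr0.
Qed.

(** Up to sign the integrand is the derivative of 2 atan((c - h) / e), which stays between -pi and
    pi; the bound is thus uniform in e and c. The constant sign of h' removes the absolute value. *)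
Lemma FTC_pk_le e (h h' : R -> R) (l m c : R) : 0 < e -> l <= m ->
  (forall x, l <= x <= m -> {for x, continuous h'}) ->
  (forall x, l <= x <= m -> is_derive x 1 h (h' x)) ->
  (forall x, l <= x <= m -> 0 <= h' x) \/ (forall x, l <= x <= m -> h' x <= 0) ->
  (\int[leb]_(x in `[l, m]) (`|h' x| * pk e (c - h x))%:E <= (2 * pi)%:E)%E.
Proof.
move=> e0 lm ch' dh sh.
have at_le (y : R) : `|2 * atan y| <= pi.
  rewrite normrM ger0_norm// -ler_pdivlMl//.
  by rewrite ler_norml mulrC !ltW// ?atan_gtNpi2 ?atan_ltpi2.
have cpk x : l <= x <= m -> {for x, continuous (fun x => pk e (c - h x))}.
  move=> lxm; apply: (@continuous_comp _ _ _ (fun x => c - h x) (pk e)).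
    by have dhx := dh x lxm; notypeclasses refine (@der_continuous _ _ _ _ _); der.
  exact: continuous_pk.
have dP x : l <= x <= m -> is_derive x 1 (fun y => 2 * atan ((c - h y) / e)) (pk e (c - h x) * (- h' x)).
  move=> lxm; have dhx := dh x lxm.
  der_to; first (notypeclasses refine (@der_pk _ _ _ _ _ _); [exact: e0|der]).
  by rewrite sub0r.
have cg x : l <= x <= m -> {for x, continuous (fun x => h' x * pk e (c - h x))}.
  by move=> lxm; apply: continuousM; [exact: ch'|exact: cpk].
case: sh => sh.
- have dN x : l <= x <= m -> is_derive x 1 (fun y => - (2 * atan ((c - h y) / e))) (h' x * pk e (c - h x)).
    by move=> lxm; have := derN (dP x lxm); rewrite mulrN opprK mulrC.
  rewrite (_ : (\int[leb]_(x in _) _)%E = (\int[leb]_(x in `[l, m]) (h' x * pk e (c - h x))%:E)%E); last first.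
    by apply: eq_integral => x; rewrite inE/= in_itv/= => lxm; rewrite ger0_norm ?sh.
  rewrite (FTC2 lm cg dN) lee_fin.
  have := at_le ((c - h l) / e); have := at_le ((c - h m) / e).
  rewrite !ler_norml => /andP[? ?] /andP[? ?]; lra.
- have cN x : l <= x <= m -> {for x, continuous (fun x => - (h' x * pk e (c - h x)))}.
    by move=> lxm; apply: continuousN; exact: cg.
  have dN x : l <= x <= m -> is_derive x 1 (fun y => 2 * atan ((c - h y) / e)) (- (h' x * pk e (c - h x))).
    by move=> lxm; have := dP x lxm; rewrite mulrN mulrC.
  rewrite (_ : (\int[leb]_(x in _) _)%E = (\int[leb]_(x in `[l, m]) (- (h' x * pk e (c - h x)))%:E)%E); last first.
    by apply: eq_integral => x; rewrite inE/= in_itv/= => lxm; rewrite ler0_norm ?sh// mulNr.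
  rewrite (FTC2 lm cN dN) lee_fin.
  have := at_le ((c - h l) / e); have := at_le ((c - h m) / e).
  rewrite !ler_norml => /andP[? ?] /andP[? ?]; lra.
Qed.

Lemma pkN e a : pk e (- a) = pk e a.
Proof. by rewrite pkE sqrrN. Qed.

Lemma pk_le_pk0 e a : 0 < e -> pk e a <= pk e 0.
Proof.
move=> e0; rewrite !pkE expr0n addr0 ler_pM2l ?mulr_gt0//.
by rewrite lef_pV2 ?posrE ?pk_den_gt0 ?exprn_gt0// lerDl sqr_ge0.
Qed.

Lemma wt_monotone (n m : nat) x : (n <= m)%N -> wt n.+1%:R^-1 x <= wt m.+1%:R^-1 x.
Proof.
move=> nm; rewrite !wtE ler_expR lerN2 ler_wpM2r// lef_pV2 ?posrE//.
by rewrite ler_nat ltnS.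
Qed.

Lemma cvg_wt x : wt n.+1%:R^-1 x @[n --> \oo] --> (1 : R).
Proof.
rewrite (_ : (fun n => _) = (fun n => expR (- (n.+1%:R^-1 * `|x|)))); last first.
  by apply/funext => n; rewrite wtE.
rewrite -[X in _ --> X]expR0; apply: continuous_cvg; first exact: continuous_expR.
rewrite -oppr0 -[X in _ --> - X](mul0r `|x|); apply: cvgN; apply: cvgMl.
exact: cvg_harmonic.
Qed.

End poisson.

(** * The L^2 bound for oscillatory integrals *)

Ltac nneg := repeat first [ assumption | done | apply: sqr_ge0 | apply: mulr_ge0 | apply: addr_ge0
  | rewrite invr_ge0 | apply: normr_ge0 | apply: powR_ge0 | apply: wt_ge0 | apply: ltW; assumption
  | match goal with H : forall _, is_true (0 <= _) |- _ => apply: H end ].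

Section parameter.
Context d1 d2 (T1 : measurableType d1) (T2 : measurableType d2) (R : realType).
Variable mu : {sigma_finite_measure set T2 -> \bar R}.

Lemma measurable_Rintegral_param (F : T1 * T2 -> R) : measurable_fun setT F ->
  measurable_fun setT (fun x => \int[mu]_y F (x, y)).
Proof.
move=> mF; have mFe : measurable_fun setT (EFin \o F) by meas.
apply: (measurableT_comp (fine_measurable measurableT)).
rewrite (_ : (fun x => _) = (fun x => \int[mu]_y (EFin \o F)^\+ (x, y) - \int[mu]_y (EFin \o F)^\- (x, y))%E); last first.
  apply/funext => x; rewrite integralE; congr (_ - _)%E; apply: eq_integral => y _.
    by rewrite !funeposE.
  by rewrite !funenegE.
apply: emeasurable_funB.
- by apply: (measurable_fun_fubini_tonelli_F (m2 := mu) (EFin \o F)^\+)%E => //; exact: measurable_realfun.measurable_funepos.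
- by apply: (measurable_fun_fubini_tonelli_F (m2 := mu) (EFin \o F)^\-)%E => //; exact: measurable_realfun.measurable_funeneg.
Qed.

End parameter.

Section weighted_fubini.
Context d1 d2 (Y : measurableType d1) (W : measurableType d2) (R : realType).
Variables (nu : {sigma_finite_measure set Y -> \bar R}) (M : {sigma_finite_measure set W -> \bar R}).
Variables (p q w : Y -> R) (a b g : W -> R) (P : W -> R).
Hypotheses (mp : measurable_fun setT p) (mq : measurable_fun setT q).
Hypotheses (ma : measurable_fun setT a) (mb : measurable_fun setT b).
Hypotheses (iw : nu.-integrable setT (EFin \o w)) (ig : M.-integrable setT (EFin \o g)).
Hypothesis hP : forall z, \int[nu]_y (w y * cos (a z * p y + b z * q y)) = P z.

(** Fubini's theorem lets the weight w act on the oscillating factor first, which produces its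
    cosine transform P. *)
Lemma weighted_cos_Fubini :
  (\int[nu]_y (w y * \int[M]_z (cos (a z * p y + b z * q y) * g z))%:E = (\int[M]_z (P z * g z))%:E)%E.
Proof.
have mw : measurable_fun setT w by apply/measurable_EFinP; exact: measurable_int iw.
have mg : measurable_fun setT g by apply/measurable_EFinP; exact: measurable_int ig.
pose F (yz : Y * W) := w yz.1 * cos (a yz.2 * p yz.1 + b yz.2 * q yz.1) * g yz.2.
have iF : (nu \x M)%E.-integrable setT (EFin \o F).
  have := integrable_tensor iw ig; apply: le_integrable => //.
    by apply/measurable_EFinP; rewrite /F; meas.
  move=> [y z] _; rewrite /F/= lee_fin !normrM ler_wpM2r//= ler_piMr//.
  exact: norm_cos_le1.
transitivity (\int[nu]_y (\int[M]_z F (y, z))%:E)%E.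
  apply: eq_integral => y _; congr EFin; rewrite -RintegralZl//; last first.
    apply: le_integrable ig => //; first by meas.
    move=> z _ /=; rewrite lee_fin normrM ler_piMl//; exact: norm_cos_le1.
  by apply: eq_Rintegral => z _; rewrite /F/= mulrA.
rewrite Fubini_EFin//; congr EFin; apply: eq_Rintegral => z _.
rewrite /F/= -hP -RintegralZr//.
apply: le_integrable iw => //; first by meas.
move=> y _ /=; rewrite lee_fin normrM ler_piMr//; exact: norm_cos_le1.
Qed.

End weighted_fubini.

Section oscillatory_L2.
Context d (Z : measurableType d) (R : realType).
Variable mu : {sigma_finite_measure set Z -> \bar R}.
Local Notation leb := (@lebesgue_measure R).
Local Notation leb2 := (leb \x leb)%E.
Local Notation RR := (measurableTypeR R * measurableTypeR R)%type.
Variables (zeta tau g k : Z -> R).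
Hypotheses (mzeta : measurable_fun setT zeta) (mtau : measurable_fun setT tau).
Hypothesis ig : mu.-integrable setT (EFin \o g).

Let mg : measurable_fun setT g.
Proof. by apply/measurable_EFinP; exact: measurable_int ig. Qed.

(** Real and imaginary part of the oscillatory integral over an arbitrary measure space: later the
    line, for the extension itself, and the plane of pairs, for its square. *)
Definition oscC (y : RR) := \int[mu]_z (cos (y.1 * zeta z - y.2 * tau z) * g z).
Definition oscS (y : RR) := \int[mu]_z (sin (y.1 * zeta z - y.2 * tau z) * g z).

Lemma measurable_oscC : measurable_fun setT oscC.
Proof.
apply: (measurable_Rintegral_param mu (F := fun w : RR * Z => cos (w.1.1 * zeta w.2 - w.1.2 * tau w.2) * g w.2)).
by meas.
Qed.

Lemma measurable_oscS : measurable_fun setT oscS.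
Proof.
apply: (measurable_Rintegral_param mu (F := fun w : RR * Z => sin (w.1.1 * zeta w.2 - w.1.2 * tau w.2) * g w.2)).
by meas.
Qed.

Let ibg (h : Z -> R) : measurable_fun setT h -> (forall z, `|h z| <= 1) ->
  mu.-integrable setT (EFin \o (fun z => h z * g z)).
Proof.
move=> mh h1; apply: le_integrable ig => //; first by meas.
by move=> z _ /=; rewrite lee_fin normrM ler_piMl.
Qed.

Let imgg : (mu \x mu)%E.-integrable setT (fun w => (g w.1 * g w.2)%:E).
Proof. exact: integrable_tensor. Qed.

Let icos (y : RR) : mu.-integrable setT (EFin \o (fun z => cos (y.1 * zeta z - y.2 * tau z) * g z)).
Proof. by apply: ibg => [|z]; [meas|exact: norm_cos_le1]. Qed.

Let isin (y : RR) : mu.-integrable setT (EFin \o (fun z => sin (y.1 * zeta z - y.2 * tau z) * g z)).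
Proof. by apply: ibg => [|z]; [meas|exact: norm_sin_le1]. Qed.

(** The squared modulus is an integral over pairs of points in which only the difference of the
    phases remains. *)
Lemma oscE (y : RR) : oscC y ^+ 2 + oscS y ^+ 2 =
  \int[(mu \x mu)%E]_w (cos ((zeta w.1 - zeta w.2) * y.1 + (tau w.2 - tau w.1) * y.2) * (g w.1 * g w.2)).
Proof.
rewrite !expr2 -(Rintegral_tensor (icos y) (icos y)) -(Rintegral_tensor (isin y) (isin y)).
rewrite -RintegralD//; last 2 first.
- exact: (integrable_tensor (icos y) (icos y)).
- exact: (integrable_tensor (isin y) (isin y)).
apply: eq_Rintegral => w _.
transitivity (cos (y.1 * zeta w.1 - y.2 * tau w.1 - (y.1 * zeta w.2 - y.2 * tau w.2)) * (g w.1 * g w.2)).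
  by rewrite [X in _ = X * _]cosB; ring.
by congr (cos _ * _); ring.
Qed.

Let pk2 (e : R) (w : Z * Z) : R := pk e (zeta w.1 - zeta w.2) * pk e (tau w.2 - tau w.1).

Lemma weighted_oscE e : 0 < e ->
  (\int[leb2]_y (wt e y.1 * wt e y.2 * (oscC y ^+ 2 + oscS y ^+ 2))%:E =
  (\int[(mu \x mu)%E]_w (pk2 e w * (g w.1 * g w.2)))%:E)%E.
Proof.
move=> e0; under eq_integral do rewrite oscE.
have := @weighted_cos_Fubini _ _ _ _ R (sfprod leb leb) (sfprod mu mu) fst snd (fun y => wt e y.1 * wt e y.2)
  (fun w => zeta w.1 - zeta w.2) (fun w => tau w.2 - tau w.1) (fun w => g w.1 * g w.2) (pk2 e).
apply.
- exact: measurable_fst.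
- exact: measurable_snd.
- by meas.
- by meas.
- exact: (integrable_tensor (f := wt e : measurableTypeR R -> R) (g := wt e : measurableTypeR R -> R) (integrable_wt e0) (integrable_wt e0)).
- exact: imgg.
- by move=> w; exact: Rintegral_wt2_cos.
Qed.

Hypothesis mk : measurable_fun setT k.
Hypothesis k_ge0 : forall z, 0 <= k z.
Hypothesis k_gt0 : forall z, g z != 0 -> 0 < k z.

(** The right-hand side minus the left-hand side is (|g z| k z' - |g z'| k z)^2 / (2 k z k z').
    Points where g vanishes are treated apart, because k may vanish there. *)
Lemma schur_pointwise (z z' : Z) :
  `|g z * g z'| <= 2^-1 * (g z ^+ 2 / k z * k z' + g z' ^+ 2 / k z' * k z).
Proof.
have [->|gz] := eqVneq (g z) 0.
  rewrite mul0r normr0 mulr_ge0// expr0n/= mul0r mul0r add0r.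
  by rewrite mulr_ge0// divr_ge0// sqr_ge0.
have [->|gz'] := eqVneq (g z') 0.
  rewrite mulr0 normr0 mulr_ge0// expr0n/= mul0r mul0r addr0.
  by rewrite mulr_ge0// divr_ge0// sqr_ge0.
have kz := k_gt0 gz; have kz' := k_gt0 gz'.
have kzn : k z != 0 by rewrite gt_eqF.
have kzn' : k z' != 0 by rewrite gt_eqF.
rewrite -subr_ge0 normrM -(real_normK (num_real (g z))) -(real_normK (num_real (g z'))).
have -> : 2^-1 * (`|g z| ^+ 2 / k z * k z' + `|g z'| ^+ 2 / k z' * k z) - `|g z| * `|g z'| =
   2^-1 * (`|g z| * k z' - `|g z'| * k z) ^+ 2 / (k z * k z').
  by field; rewrite kzn kzn'.
by nneg.
Qed.

Variable K : R.
(** The image of the measure k mu under (zeta, tau), smeared at scale e by Poisson kernels, is at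
    most K at every point (a, b). As e tends to 0 this bounds, up to a constant, the density of the
    image. *)
Hypothesis hK : forall e a b, 0 < e ->
  (\int[mu]_z (k z * pk e (a - zeta z) * pk e (b - tau z))%:E <= K%:E)%E.

Let I := (\int[mu]_z (g z ^+ 2 / k z)%:E)%E.

Let mpk e := @measurable_pk R e.

(** For fixed z the weight k z' is integrated in z' against the kernels centred at (zeta z, tau z),
    which costs K; the integral of g^2 / k is left. *)
Lemma schur_half e : 0 < e ->
  (\int[mu \x mu]_w (g w.1 ^+ 2 / k w.1 * k w.2 * pk e (zeta w.1 - zeta w.2) * pk e (tau w.1 - tau w.2))%:E
   <= K%:E * I)%E.
Proof.
move=> e0; have mp := mpk e.
have p0 (a : R) : 0 <= pk e a by rewrite pk_ge0// ltW.
have q0 z : 0 <= g z ^+ 2 / k z by rewrite divr_ge0// sqr_ge0.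
rewrite fubini_tonelli1; last 2 first.
- by meas.
- by move=> w; rewrite lee_fin; nneg.
have K0 : 0 <= K.
  rewrite -lee_fin; apply: le_trans (hK 0 0 e0).
  by apply: integral_ge0 => z _; rewrite lee_fin; nneg.
rewrite muleC -ge0_integralZr//; last 2 first.
- by meas.
- by move=> z _; rewrite lee_fin.
apply: ge0_le_integral => //.
- by move=> z _; apply: integral_ge0 => z' _; rewrite /= lee_fin; nneg.
- apply: (measurable_fun_fubini_tonelli_F (fun w => (g w.1 ^+ 2 / k w.1 * k w.2 * pk e (zeta w.1 - zeta w.2) * pk e (tau w.1 - tau w.2))%:E)).
  by meas.
- by move=> w; rewrite lee_fin; nneg.
- by apply: emeasurable_funM; meas.
move=> z _; rewrite /fubini_F/=.
pose h z' := k z' * pk e (zeta z - zeta z') * pk e (tau z - tau z').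
have -> : (\int[mu]_z' (g z ^+ 2 / k z * k z' * pk e (zeta z - zeta z') * pk e (tau z - tau z'))%:E =
    (g z ^+ 2 / k z)%:E * \int[mu]_z' (h z')%:E)%E.
  rewrite -ge0_integralZl//.
  - by apply: eq_integral => z' _; rewrite -EFinM /h; congr EFin; ring.
  - by rewrite /h; meas.
  - by move=> z' _; rewrite lee_fin /h; nneg.
  - by rewrite lee_fin.
by rewrite lee_wpmul2l ?lee_fin//; exact: hK.
Qed.

(** Schur test: [schur_pointwise] splits the double integral into two halves, which are exchanged by
    swapping z and z' because the kernels are even. *)
Lemma schur_bound e : 0 < e ->
  (\int[leb2]_y (wt e y.1 * wt e y.2 * (oscC y ^+ 2 + oscS y ^+ 2))%:E <= K%:E * I)%E.
Proof.
move=> e0; have mp := mpk e.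
have p0 (a : R) : 0 <= pk e a by rewrite pk_ge0// ltW.
have pN (a : R) : pk e (- a) = pk e a by exact: pkN.
have q0 z : 0 <= g z ^+ 2 / k z by rewrite divr_ge0// sqr_ge0.
rewrite weighted_oscE//.
pose G w := pk e (zeta w.1 - zeta w.2) * pk e (tau w.2 - tau w.1) * (g w.1 * g w.2).
pose H w := g w.1 ^+ 2 / k w.1 * k w.2 * pk e (zeta w.1 - zeta w.2) * pk e (tau w.1 - tau w.2).
have mH : measurable_fun setT H by rewrite /H; meas.
have H0 w : 0 <= H w by rewrite /H; nneg.
have -> : (K%:E * I = 2^-1%:E * (K%:E * I) + 2^-1%:E * (K%:E * I))%E.
  rewrite -ge0_muleDl ?lee_fin//; last 1 first.
  rewrite -EFinD (_ : 2^-1 + 2^-1 = 1 :> R) ?mul1e//; lra.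
have half2 : (\int[mu \x mu]_w (H (w.2, w.1))%:E <= K%:E * I)%E.
  rewrite fubini_tonelli2; last 2 first.
  - by apply/measurable_EFinP; meas.
  - by move=> w; rewrite lee_fin.
  apply: le_trans (schur_half e0); rewrite (fubini_tonelli1 (fun w => (H w)%:E))//; last by meas.
apply: (@le_trans _ _ (\int[mu \x mu]_w (2^-1%:E * (H w)%:E + 2^-1%:E * (H (w.2, w.1))%:E)))%E; last first.
  have mH1 : measurable_fun setT (fun w => (H w)%:E) by meas.
  have mH2 : measurable_fun setT (fun w : Z * Z => (H (w.2, w.1))%:E) by meas.
  have Z1 : (\int[mu \x mu]_w (2^-1%:E * (H w)%:E) = 2^-1%:E * \int[mu \x mu]_w (H w)%:E)%E.
    by apply: ge0_integralZl => // w _; rewrite lee_fin.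
  have Z2 : (\int[mu \x mu]_w (2^-1%:E * (H (w.2, w.1))%:E) = 2^-1%:E * \int[mu \x mu]_w (H (w.2, w.1))%:E)%E.
    by apply: ge0_integralZl => // w _; rewrite lee_fin.
  have -> : (\int[mu \x mu]_w (2^-1%:E * (H w)%:E + 2^-1%:E * (H (w.2, w.1))%:E) =
     \int[mu \x mu]_w (2^-1%:E * (H w)%:E) + \int[mu \x mu]_w (2^-1%:E * (H (w.2, w.1))%:E))%E.
    by apply: ge0_integralD => //; [move=> w _; rewrite mule_ge0// lee_fin|exact: emeasurable_funM
      |move=> w _; rewrite mule_ge0// lee_fin|exact: emeasurable_funM].
  rewrite Z1 Z2.
  apply: leeD; rewrite lee_wpmul2l ?lee_fin//; exact: schur_half.
have iG : (mu \x mu)%E.-integrable setT (EFin \o G).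
  have := imgg => ig2.
  apply: (@le_integrable _ _ _ _ _ measurableT _ (fun w => (pk e 0 * pk e 0)%:E * (g w.1 * g w.2)%:E)%E).
  - by rewrite /G; meas.
  - move=> w _; rewrite -EFinM /= lee_fin /G !normrM.
    have pm (a : R) : `|pk e a| <= pk e 0 by rewrite ger0_norm// pk_le_pk0.
    rewrite (ger0_norm (p0 0)).
    by rewrite ler_wpM2r ?mulr_ge0//= ler_pM.
  - exact: (integrableZl measurableT _ ig2).
rewrite fineK; last exact: integrable_fin_num.
apply: le_trans (_ : \int[mu \x mu]_w `|G w|%:E <= _)%E.
  apply: le_integral => //.
    exact: (integrable_abse iG).
  by move=> w _; rewrite lee_fin ler_norm.
apply: ge0_le_integral => //.
- by apply/measurable_EFinP; apply: measurableT_comp => //; rewrite /G; meas.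
- by apply: emeasurable_funD; apply: emeasurable_funM; meas.
- move=> w _; rewrite -!EFinM -EFinD lee_fin /G /H/=.
  have -> : pk e (tau w.1 - tau w.2) = pk e (tau w.2 - tau w.1) by rewrite -opprB pN.
  have -> : pk e (zeta w.2 - zeta w.1) = pk e (zeta w.1 - zeta w.2) by rewrite -opprB pN.
  have := p0 (zeta w.1 - zeta w.2); have := p0 (tau w.2 - tau w.1).
  move: (pk e _) (pk e _) => P1 P2 P10 P20.
  rewrite normrM (ger0_norm (mulr_ge0 P20 P10)) mulrC.
  apply: (le_trans (ler_wpM2r (mulr_ge0 P20 P10) (schur_pointwise w.1 w.2))).
  by rewrite le_eqVlt; apply/orP; left; apply/eqP; ring.
Qed.

Let osc2 (y : RR) := oscC y ^+ 2 + oscS y ^+ 2.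

Let mosc2 : measurable_fun setT osc2.
Proof. by have := measurable_oscC; have := measurable_oscS => ? ?; rewrite /osc2; meas. Qed.

Let osc2_ge0 y : 0 <= osc2 y. Proof. by rewrite /osc2; nneg. Qed.

(** The Schur bound does not depend on e, and the Abel weights increase to 1 along e = 1 / (n + 1),
    so monotone convergence removes them. *)
Lemma oscillatory_L2_bound : (\int[leb2]_y (oscC y ^+ 2 + oscS y ^+ 2)%:E <= K%:E * I)%E.
Proof.
pose f (n : nat) (y : RR) := (wt n.+1%:R^-1 y.1 * wt n.+1%:R^-1 y.2 * osc2 y)%:E.
have mf n : measurable_fun setT (f n) by have := measurable_wt (n.+1%:R^-1 : R) => mw; rewrite /f; meas.
have fc y : f n y @[n --> \oo] --> (osc2 y)%:E.
  apply: cvg_EFin; first by near=> n.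
  rewrite -[X in _ --> X]mul1r -[X in X * _ ]mul1r.
  by apply: cvgMl; apply: cvgM; exact: cvg_wt.
have -> : (\int[leb2]_y (oscC y ^+ 2 + oscS y ^+ 2)%:E = \int[leb2]_y limn (f ^~ y))%E.
  by apply: eq_integral => y _; apply/esym/cvg_lim => //; exact: fc.
rewrite monotone_convergence//; last 2 first.
- by move=> n y _; rewrite lee_fin mulr_ge0// mulr_ge0// wt_ge0.
- move=> y _ n m nm; rewrite lee_fin ler_wpM2r//.
  by rewrite ler_pM ?wt_monotone// wt_ge0.
apply: lime_le.
  apply: ereal_nondecreasing_is_cvgn => n m nm; apply: ge0_le_integral => //.
  - by move=> y _; rewrite lee_fin mulr_ge0// mulr_ge0// wt_ge0.
  move=> y _; rewrite lee_fin ler_wpM2r//.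
  by rewrite ler_pM ?wt_monotone// wt_ge0.
by near=> n; apply: schur_bound; rewrite invr_gt0.
Unshelve. all: by end_near. Qed.

End oscillatory_L2.

(** * The Jacobian of the map from pairs to frequencies *)

Section curve.
Context {R : realType}.
Local Notation leb := (@lebesgue_measure R).
Local Notation leb2 := (leb \x leb)%E.
Local Notation RR := (measurableTypeR R * measurableTypeR R)%type.

Lemma le_powR_base (x y c : R) : 0 < x -> x <= y -> 0 <= c -> x `^ c <= y `^ c.
Proof. by move=> x0 xy c0; rewrite ge0_ler_powR// nnegrE ?ltW// (lt_le_trans x0). Qed.

Lemma ge_powR_base (x y c : R) : 0 < x -> x <= y -> c <= 0 -> y `^ c <= x `^ c.
Proof.
move=> x0 xy c0; have y0 := lt_le_trans x0 xy.
rewrite -[c]opprK (powRN y (- c)) (powRN x (- c)) lef_pV2 ?posrE ?powR_gt0//.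
by rewrite le_powR_base// oppr_ge0.
Qed.

Variables (alpha a b : R).
Hypotheses (a0 : 0 < a) (alpha0 : 0 < alpha).

Let jac (x y : R) := alpha * (x `^ (alpha - 1) - y `^ (alpha - 1)).

Let box (x y : R) : bool := [&& a <= x, x <= b, a <= y & y <= b].

(** On the line x + y = s the function h(x) = x^alpha + (s - x)^alpha has derivative
    [jac x (s - x)], which changes sign at most at the midpoint s / 2. Each half contributes at most
    2 pi. *)
Lemma curve_inner (e B s : R) : 0 < e ->
  (\int[leb]_x (if box x (s - x) then `|jac x (s - x)| * pk e (B - (x `^ alpha + (s - x) `^ alpha)) else 0)%:E
   <= (4 * pi)%:E)%E.
Proof.
move=> e0; pose l := Num.max a (s - b); pose u := Num.min b (s - a).
have boxE x : box x (s - x) = (l <= x <= u).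
  rewrite /box /l /u ge_max le_min.
  by apply/idP/idP => [/and4P[h1 h2 h3 h4]|/andP[/andP[h1 h2] /andP[h3 h4]]];
    [apply/andP; split; apply/andP; split|apply/and4P; split]; lra.
pose h x := x `^ alpha + (s - x) `^ alpha.
pose f x := `|jac x (s - x)| * pk e (B - h x).
have f0 x : 0 <= f x by rewrite /f mulr_ge0// pk_ge0// ltW.
have mf : measurable_fun setT f.
  by have mp := @measurable_pk R e; rewrite /f /h /jac; meas.
have -> : (\int[leb]_x (if box x (s - x) then `|jac x (s - x)| * pk e (B - (x `^ alpha + (s - x) `^ alpha)) else 0)%:E
   = \int[leb]_(x in `[l, u]) (f x)%:E)%E.
  rewrite [RHS]integral_mkcond; apply: eq_integral => x _.
  by rewrite patchE mem_setE in_itv/= -boxE; case: ifP.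
have [lu|ul] := leP l u; last first.
  rewrite set_itv_ge ?integral_set0 ?lee_fin ?mulr_ge0 ?pi_ge0//.
  by rewrite bnd_simp -ltNge.
(* The box is symmetric in the two variables, so the admissible interval is symmetric about s / 2
   and contains it. *)
have lus : l + u = s.
  rewrite /l /u; have [h1|h1] := leP a (s - b).
    by rewrite min_l; [ring|lra].
  by rewrite min_r; [ring|lra].
pose m := s / 2.
have lm : l <= m by rewrite /m; lra.
have mu : m <= u by rewrite /m; lra.
have posx x : l <= x <= u -> 0 < x /\ 0 < s - x.
  rewrite -boxE => /and4P[ax _ asx _].
  by split; apply: lt_le_trans a0 _.
have dh x : l <= x <= u -> is_derive x 1 h (jac x (s - x)).
  move=> /posx[x0 sx0]; der_to; first by (unfold h; der).
  by cbv beta; rewrite /jac; ring.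
have cjac x : l <= x <= u -> {for x, continuous (fun x => jac x (s - x))}.
  move=> /posx[x0 sx0]; notypeclasses refine (@der_continuous _ _ x _ _).
  unfold jac; der => //.
have half p q : l <= p -> p <= q -> q <= u ->
   (forall x, p <= x <= q -> 0 <= jac x (s - x)) \/ (forall x, p <= x <= q -> jac x (s - x) <= 0) ->
   (\int[leb]_(x in `[p, q]) (f x)%:E <= (2 * pi)%:E)%E.
  move=> lp pq qu sg; apply: (@FTC_pk_le _ e h (fun x => jac x (s - x))) => //.
  - by move=> x /andP[px xq]; apply: cjac; rewrite (le_trans lp) ?(le_trans xq).
  - by move=> x /andP[px xq]; apply: dh; rewrite (le_trans lp) ?(le_trans xq).
(* Whether x^(alpha - 1) increases or decreases is decided by the sign of alpha - 1, and with it the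
   sign of the derivative on each half. *)
have sgn : (forall x y, 0 < x -> x <= y -> 0 <= jac x y /\ jac y x <= 0) \/
           (forall x y, 0 < x -> x <= y -> jac x y <= 0 /\ 0 <= jac y x).
  have jN x y : jac y x = - jac x y by rewrite /jac; ring.
  have [c0|c0] := leP 0 (alpha - 1); [right|left] => x y x0 xy; rewrite (jN x y) ?oppr_ge0 ?oppr_le0; split;
    rewrite /jac ?pmulr_rge0 ?pmulr_rle0// ?subr_ge0 ?subr_le0;
    by [exact: le_powR_base|exact: ge_powR_base (ltW c0)].
apply: (@le_trans _ _ (\int[leb]_(x in `[l, m]) (f x)%:E + \int[leb]_(x in `[m, u]) (f x)%:E)%E); last first.
  rewrite (_ : 4 * pi = 2 * pi + 2 * pi); last by ring.
  rewrite EFinD; apply: leeD; apply: half => //.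
  - case: sgn => sg; [left|right] => x /andP[lx xm]; apply sg.
    + by apply: (posx x _).1; rewrite lx (le_trans xm).
    + by rewrite /m in xm; lra.
    + by apply: (posx x _).1; rewrite lx (le_trans xm).
    + by rewrite /m in xm; lra.
  - case: sgn => sg; [right|left] => x /andP[mx xu]; apply sg.
    + by apply: (posx x _).2; rewrite xu (le_trans lm).
    + by rewrite /m in mx; lra.
    + by apply: (posx x _).2; rewrite xu (le_trans lm).
    + by rewrite /m in mx; lra.
have -> : `[l, u]%classic = `[l, m]%classic `|` `]m, u]%classic.
  by rewrite -itv_bndbnd_setU// ?bnd_simp.
rewrite ge0_integral_setU//=; last 3 first.
- by apply: measurable_funTS; meas.
- by move=> x _; rewrite lee_fin.
- rewrite disj_set2E; apply/eqP; apply/seteqP; split => x //=.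
  by rewrite !in_itv/= => -[/andP[_ xm] /andP[mx _]]; move: mx; rewrite ltNge xm.
rewrite leeD2l// ge0_subset_integral//.
- by apply: measurable_funTS; meas.
- by move=> x _; rewrite lee_fin.
- by apply: subset_itvr; rewrite bnd_simp.
Qed.

(** After the shear (x, y) -> (x, x + y) the inner integral is at most 4 pi for every s, and the
    remaining Poisson kernel in s has mass 2 pi. *)
Lemma curve_Jacobian_bound (e A B : R) : 0 < e ->
  (\int[leb2]_z ((if box z.1 z.2 then `|jac z.1 z.2| else 0) * pk e (A - (z.1 + z.2))
     * pk e (B - (z.1 `^ alpha + z.2 `^ alpha)))%:E <= (8 * pi ^+ 2)%:E)%E.
Proof.
move=> e0; have mp := @measurable_pk R e.
have p0 (x : R) : 0 <= pk e x by rewrite pk_ge0// ltW.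
pose F (x y : R) := (if box x y then `|jac x y| else 0) * pk e (A - (x + y)) * pk e (B - (x `^ alpha + y `^ alpha)).
have F0 x y : 0 <= F x y by rewrite /F !mulr_ge0//; case: ifP.
have mF : measurable_fun [set: RR] (fun z : RR => F z.1 z.2).
  by rewrite /F /box /jac; meas.
rewrite (fubini_tonelli1 (fun z : RR => (F z.1 z.2)%:E)); last 2 first.
- by apply/measurable_EFinP.
- by move=> z; rewrite lee_fin.
rewrite /fubini_F/=.
have -> : (\int[leb]_x \int[leb]_y (F x y)%:E = \int[leb]_x \int[leb]_s (F x (s - x))%:E)%E.
  apply: eq_integral => x _; rewrite -(@ge0_integral_shift _ (fun y => (F x y)%:E) (- x))//.
    by apply/measurable_EFinP; rewrite /F /box /jac; meas.
  by move=> y; rewrite lee_fin.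
have -> : (\int[leb]_x \int[leb]_s (F x (s - x))%:E = \int[leb]_s \int[leb]_x (F x (s - x))%:E)%E.
  apply: (fubini_tonelli (m1 := leb) (m2 := leb) (fun z : RR => (F z.1 (z.2 - z.1))%:E)).
  - by apply/measurable_EFinP; rewrite /F /box /jac; meas.
  - by move=> z; rewrite lee_fin.
apply: (@le_trans _ _ (\int[leb]_s ((pk e (A - s))%:E * (4 * pi)%:E))%E).
  apply: ge0_le_integral => //.
  - by move=> s _; apply: integral_ge0 => x _; rewrite lee_fin.
  - apply: (measurable_fun_fubini_tonelli_G (m1 := leb) (fun z : RR => (F z.1 (z.2 - z.1))%:E)).
      by apply/measurable_EFinP; rewrite /F /box /jac; meas.
    by move=> z; rewrite lee_fin.
  - by apply: emeasurable_funM; meas.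
  move=> s _; pose g (x : R) := if box x (s - x) then `|jac x (s - x)| * pk e (B - (x `^ alpha + (s - x) `^ alpha)) else 0.
  have -> : (\int[leb]_x (F x (s - x))%:E = (pk e (A - s))%:E * \int[leb]_x (g x)%:E)%E.
    rewrite -ge0_integralZl//; last 3 first.
    - by apply/measurable_EFinP; rewrite /g /box /jac; meas.
    - by move=> x _; rewrite lee_fin /g; case: ifP => // _; rewrite mulr_ge0.
    - by rewrite lee_fin.
    apply: eq_integral => x _; rewrite -EFinM /F /g (addrC x) subrK.
    by congr EFin; case: ifP => _; ring.
  by rewrite lee_wpmul2l ?lee_fin//; exact: curve_inner.
rewrite ge0_integralZr//; last 3 first.
- by meas.
- by move=> s _; rewrite lee_fin.
- by rewrite lee_fin mulr_ge0// pi_ge0.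
have -> : (\int[leb]_s (pk e (A - s))%:E = (2 * pi)%:E)%E.
  have mpE : measurable_fun setT (fun s => (pk e s)%:E) by meas.
  rewrite -(@ge0_integral_pk R e e0) -[RHS](@ge0_integral_shift _ _ (- A) mpE); last first.
    by move=> s; rewrite lee_fin.
  by apply: eq_integral => s _; rewrite -opprB pkN.
by rewrite -EFinM lee_fin le_eqVlt; apply/orP; left; apply/eqP; ring.
Qed.

End curve.

(** * Hardy-Littlewood-Sobolev inequality *)

Section power_integrals.
Context {R : realType}.
Local Notation leb := (@lebesgue_measure R).

Lemma powR_expR (s r : R) : expR s `^ r = expR (r * s).
Proof. by rewrite /powR gt_eqF ?expR_gt0// expRK. Qed.

Lemma ge0_integral_expRN (c t : R) : 0 < c ->
  (\int[leb]_(s in `[t, +oo[) (expR (- (c * s)))%:E = (expR (- (c * t)) / c)%:E)%E.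
Proof.
move=> c0; pose F (s : R) := - (expR (- (c * s)) / c).
have dF (s : R) : is_derive s 1 F (expR (- (c * s))).
  der_to; first by unfold F; der.
  by cbv beta; field; rewrite gt_eqF.
have cf : continuous (fun s : R => expR (- (c * s))).
  by move=> s; notypeclasses refine (@der_continuous _ _ s _ _); der.
have Fl : F s @[s --> +oo] --> 0.
  rewrite -oppr0; apply: cvgN; apply: (@cvg_expR_bounded _ _ (fun=> c^-1) `|c^-1|) => //.
rewrite (ge0_FTC2y (fun s _ => expR_ge0 _) cf dF Fl) /F.
by rewrite opprK add0r.
Qed.

Lemma ge0_integral_powR_near (c d : R) : 0 < c -> 0 < d ->
  (\int[leb]_(y in `]0%R, +oo[) (if y <= d then y `^ (c - 1) else 0)%:E = (d `^ c / c)%:E)%E.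
Proof.
move=> c0 d0; rewrite ge0_integral_expR_subst; last 2 first.
- by meas.
- by move=> y; rewrite lee_fin; case: ifP => // _; exact: powR_ge0.
pose g (s : R) := (if s <= ln d then expR (c * s) else 0).
have mg : measurable_fun setT (fun s => (g s)%:E) by rewrite /g; meas.
transitivity (\int[leb]_s (g s)%:E)%E.
  apply: eq_integral => s _; rewrite -EFinM /g; congr EFin.
  rewrite -[X in _ <= X](lnK d0) ler_expR; case: ifP => _; last by rewrite mul0r.
  by rewrite powR_expR -expRD; congr expR; ring.
rewrite -(ge0_integral_reflect mg); last first.
  by move=> s; rewrite lee_fin /g; case: ifP => // _; exact: expR_ge0.
transitivity (\int[leb]_(s in `[(- ln d)%R, +oo[) (expR (- (c * s)))%:E)%E.
  rewrite [RHS]integral_mkcond; apply: eq_integral => s _.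
  rewrite patchE mem_setE in_itv/= andbT /g lerNl; case: ifP => // _.
  by rewrite mulrN.
by rewrite ge0_integral_expRN// mulrN opprK -powR_expR lnK.
Qed.

Lemma ge0_integral_powR_far (d : R) : 0 < d ->
  (\int[leb]_(y in `]0%R, +oo[) (if (d <= y)%R then y `^ (- 2) else 0)%:E = (d^-1)%:E)%E.
Proof.
move=> d0; rewrite ge0_integral_expR_subst; last 2 first.
- by meas.
- by move=> y; rewrite lee_fin; case: ifP => // _; exact: powR_ge0.
transitivity (\int[leb]_(s in `[ln d, +oo[) (expR (- (1 * s)))%:E)%E.
  rewrite [RHS]integral_mkcond; apply: eq_integral => s _.
  rewrite patchE mem_setE in_itv/= andbT -EFinM.
  rewrite -[X in X <= _](lnK d0) ler_expR; case: ifP => _; last by rewrite mul0r.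
  by rewrite powR_expR -expRD; congr (expR _)%:E; ring.
by rewrite ge0_integral_expRN// mul1r divr1 expRN lnK.
Qed.

Lemma ge0_integral_radial (f : R -> R) (x : R) : measurable_fun setT f -> (forall y, 0 <= f y) ->
  f 0 = 0 ->
  (\int[leb]_y (f `|x - y|)%:E = 2%:E * \int[leb]_(y in `]0%R, +oo[) (f y)%:E)%E.
Proof.
move=> mf f0 f00.
have mabs : measurable_fun setT (fun y : R => (f `|y|)%:E) by meas.
have mabs2 : measurable_fun setT (fun y : R => (f `|- y|)%:E) by meas.
have -> : (\int[leb]_y (f `|x - y|)%:E = \int[leb]_y (f `|y|)%:E)%E.
  rewrite -[RHS](@ge0_integral_shift _ _ (- x) mabs); last by move=> y; rewrite lee_fin.
  by apply: eq_integral => y _; rewrite distrC.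
pose g (y : R) := if 0 < y then f y else 0.
have g0 y : 0 <= g y by rewrite /g; case: ifP.
have mg : measurable_fun setT (fun y : R => (g y)%:E) by rewrite /g; meas.
have mgN : measurable_fun setT (fun y : R => (g (- y))%:E) by rewrite /g; meas.
transitivity (\int[leb]_y ((g y)%:E + (g (- y))%:E))%E.
  apply: eq_integral => y _; rewrite -EFinD /g oppr_gt0; congr EFin.
  have [y0|y0|y0] := ltgtP 0 y.
  - by rewrite gtr0_norm// addr0.
  - by rewrite ltr0_norm// add0r.
  - by rewrite -y0 normr0 f00 addr0.
rewrite ge0_integralD//; last 2 first.
- by move=> y _; rewrite lee_fin.
- by move=> y _; rewrite lee_fin.
have -> : (\int[leb]_y (g (- y))%:E = \int[leb]_y (g y)%:E)%E.
  by apply: (ge0_integral_reflect mg) => y; rewrite lee_fin.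
have -> : (\int[leb]_y (g y)%:E = \int[leb]_(y in `]0%R, +oo[) (f y)%:E)%E.
  rewrite [RHS]integral_mkcond; apply: eq_integral => y _.
  by rewrite patchE mem_setE in_itv/= andbT /g; case: ifP.
by rewrite -[2%:E]/((1 + 1)%:E) EFinD ge0_muleDl ?lee_fin// mul1e.
Qed.

End power_integrals.

Section HLS.
Context {R : realType}.
Local Notation leb := (@lebesgue_measure R).
Local Notation RR := (measurableTypeR R * measurableTypeR R)%type.
Variables (lam : R) (F : R -> R).
Hypotheses (lam0 : 0 < lam) (lam1 : lam < 1).

Let lam1_gt0 : 0 < 1 - lam. Proof. by rewrite subr_gt0. Qed.

Let lam2_gt0 : 0 < 2 - lam.
Proof. by rewrite -[2]/(1 + 1) -addrA addr_gt0. Qed.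

Hypotheses (mF : measurable_fun setT F) (F0 : forall x, 0 <= F x).

(** The exponent forced by scaling: 2 / s + lam = 2. *)
Let s : R := 2 / (2 - lam).

Hypothesis F1 : (\int[leb]_x (F x `^ s)%:E <= 1)%E.

(** In [inner] below, 2 / (1 - lam) comes from the near part and 3 = 1 + 2 from the two terms of the
    far part. *)
Let C1 : R := 2 / (1 - lam) + 3.

Let s_gt1 : 1 < s.
Proof. by rewrite /s ltr_pdivlMr// mul1r ltrBlDr ltrDl. Qed.

Let nearE (x d : R) : 0 < d ->
  (\int[leb]_y (if `|x - y| <= d then `|x - y| `^ (- lam) else 0)%:E = (2 / (1 - lam) * d `^ (1 - lam))%:E)%E.
Proof.
move=> d0; rewrite (@ge0_integral_radial _ (fun r => if r <= d then r `^ (- lam) else 0)).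
- have := @ge0_integral_powR_near R (1 - lam) d _ d0.
  rewrite (_ : 1 - lam - 1 = - lam); last by ring.
  move=> -> //.
  by rewrite -EFinM; congr EFin; ring.
- by meas.
- by move=> y; case: ifP => // _; exact: powR_ge0.
- by rewrite powR0 ?oppr_eq0 ?gt_eqF// if_same.
Qed.

Let farE (x d : R) : 0 < d ->
  (\int[leb]_y (if d <= `|x - y| then `|x - y| `^ (- 2) else 0)%:E = (2 / d)%:E)%E.
Proof.
move=> d0; rewrite (@ge0_integral_radial _ (fun r => if d <= r then r `^ (- 2) else 0)).
- by rewrite ge0_integral_powR_far// -EFinM.
- by meas.
- by move=> y; case: ifP => // _; exact: powR_ge0.
- by rewrite powR0 ?oppr_eq0 ?gt_eqF// if_same.
Qed.

(* The integral is split at |x - y| = F(x)^-s, the radius at which the bounds by F x and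
   by F y balance. *)
Let inner x : (\int[leb]_y (Num.min (F x) (F y) * `|x - y| `^ (- lam))%:E <= (C1 * F x `^ (s - 1))%:E)%E.
Proof.
have [b0|b0] := eqVneq (F x) 0.
  rewrite [in leRHS]b0 powR0 ?mulr0; last by rewrite subr_eq0 (gt_eqF s_gt1).
  rewrite integral0_eq// => y _; congr EFin.
  by rewrite b0 min_l ?mul0r.
have {}b0 : 0 < F x by rewrite lt_neqAle eq_sym b0 F0.
set b := F x in b0 *; pose d := b `^ (- s).
have d0 : 0 < d by rewrite powR_gt0.
pose s' : R := 2 / lam.
have s'0 : 0 < s' by rewrite divr_gt0.
have s0 : 0 < s by apply: lt_trans s_gt1.
have ss' : s^-1 + s'^-1 = 1.
  by rewrite /s /s'; field; rewrite !gt_eqF.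
pose n y := if `|x - y| <= d then `|x - y| `^ (- lam) else 0.
pose f y := if d <= `|x - y| then `|x - y| `^ (- 2) else 0.
pose e := d `^ (- (lam / 2)).
have e0 : 0 <= e by exact: powR_ge0.
have n0 y : 0 <= n y by rewrite /n; case: ifP => // _; exact: powR_ge0.
have f0 y : 0 <= f y by rewrite /f; case: ifP => // _; exact: powR_ge0.
(* Inside the radius d the minimum is replaced by F x. Outside, Young's inequality with exponents s
   and s' = 2 / lam separates F y from the kernel, and lam s' = 2 gives the integrable decay |x -
   y|^(-2). The powers of d are distributed so that both far terms have size e. *)
have pw y : Num.min b (F y) * `|x - y| `^ (- lam) <= b * n y + e * (F y `^ s + d * f y).
  rewrite /n /f; have [xyd|dxy] := leP `|x - y| d.
    rewrite -[X in X <= _]addr0 lerD//.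
      by rewrite ler_wpM2r ?powR_ge0// ge_min lexx.
    by rewrite mulr_ge0// addr_ge0 ?powR_ge0// mulr_ge0 ?(ltW d0)//; case: ifP => // _; exact: powR_ge0.
  rewrite mulr0 add0r (ltW dxy).
  have xy0 : 0 < `|x - y| by apply: lt_trans dxy.
  apply: (@le_trans _ _ (F y * `|x - y| `^ (- lam))).
    by rewrite ler_wpM2r ?powR_ge0// ge_min lexx orbT.
  have -> : `|x - y| `^ (- lam) = e * (d `^ (lam / 2) * `|x - y| `^ (- lam)).
    by rewrite mulrA -powRD ?(gt_eqF d0) ?implybT// addNr powRr0 mul1r.
  rewrite mulrCA ler_wpM2l//.
  apply: (le_trans (conjugate_powR (F0 y) _ s0 s'0 ss')).
    by rewrite mulr_ge0// powR_ge0.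
  rewrite lerD//.
    by rewrite ler_pdivrMr// ler_peMr ?powR_ge0// ltW.
  rewrite powRM ?powR_ge0// -!powRrM /s'.
  have -> : lam / 2 * (2 / lam) = 1 by field; rewrite gt_eqF.
  have -> : - lam * (2 / lam) = - 2 by field; rewrite gt_eqF.
  rewrite mulr1 -/d ler_pdivrMr ?divr_gt0// ler_peMr//.
    by rewrite mulr_ge0 ?powR_ge0// ltW.
  by rewrite ler_pdivlMr// mul1r ltW// (lt_trans lam1)// ltr1n.
have mn : measurable_fun setT (fun y => (n y)%:E) by rewrite /n; meas.
have mf : measurable_fun setT (fun y => (f y)%:E) by rewrite /f; meas.
have mFs : measurable_fun setT (fun y => (F y `^ s)%:E) by meas.
apply: (@le_trans _ _ (\int[leb]_y (b%:E * (n y)%:E + e%:E * ((F y `^ s)%:E + d%:E * (f y)%:E)))%E).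
  apply: ge0_le_integral => //.
  - by move=> y _; rewrite lee_fin mulr_ge0 ?powR_ge0// le_min (ltW b0) F0.
  - by meas.
  - apply: emeasurable_funD; first by apply: emeasurable_funM; meas.
    apply: emeasurable_funM; first by meas.
    by apply: emeasurable_funD => //; apply: emeasurable_funM; meas.
  - by move=> y _; exact: (pw y).
have I1 : (\int[leb]_y (b%:E * (n y)%:E) = b%:E * \int[leb]_y (n y)%:E)%E.
  by apply: ge0_integralZl => //; [move=> y _; rewrite lee_fin|rewrite lee_fin ltW].
have I2 : (\int[leb]_y (d%:E * (f y)%:E) = d%:E * \int[leb]_y (f y)%:E)%E.
  by apply: ge0_integralZl => //; [move=> y _; rewrite lee_fin|rewrite lee_fin ltW].
have mdf : measurable_fun setT (fun y => d%:E * (f y)%:E)%E by apply: emeasurable_funM; meas.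
have I3 : (\int[leb]_y ((F y `^ s)%:E + d%:E * (f y)%:E) = \int[leb]_y (F y `^ s)%:E + \int[leb]_y (d%:E * (f y)%:E))%E.
  apply: ge0_integralD => //.
  - by move=> y _; rewrite lee_fin powR_ge0.
  - by move=> y _; rewrite mule_ge0 ?lee_fin// ltW.
have mS : measurable_fun setT (fun y => (F y `^ s)%:E + d%:E * (f y)%:E)%E by apply: emeasurable_funD.
have S0 y : (0 <= (F y `^ s)%:E + d%:E * (f y)%:E)%E.
  by rewrite adde_ge0 ?mule_ge0 ?lee_fin ?powR_ge0// ltW.
have I4 : (\int[leb]_y (e%:E * ((F y `^ s)%:E + d%:E * (f y)%:E)) = e%:E * \int[leb]_y ((F y `^ s)%:E + d%:E * (f y)%:E))%E.
  by apply: ge0_integralZl.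
have -> : (\int[leb]_y (b%:E * (n y)%:E + e%:E * ((F y `^ s)%:E + d%:E * (f y)%:E)) =
   \int[leb]_y (b%:E * (n y)%:E) + \int[leb]_y (e%:E * ((F y `^ s)%:E + d%:E * (f y)%:E)))%E.
  apply: ge0_integralD => //.
  - by move=> y _; rewrite mule_ge0 ?lee_fin// ltW.
  - by apply: emeasurable_funM; meas.
  - by move=> y _; apply: mule_ge0; [rewrite lee_fin|exact: S0].
  - by apply: emeasurable_funM => //; meas.
rewrite I1 I4 I3 I2 (farE x d0) (nearE x d0).
apply: (@le_trans _ _ (b%:E * (2 / (1 - lam) * d `^ (1 - lam))%:E + e%:E * (1 + d%:E * (2 / d)%:E)))%E.
  by rewrite leeD2l// lee_wpmul2l ?lee_fin// leeD2r.
change ((b * (2 / (1 - lam) * d `^ (1 - lam)) + e * (1 + d * (2 / d)))%:E <= (C1 * b `^ (s - 1))%:E)%E.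
rewrite lee_fin.
have -> : d * (2 / d) = 2 by field; rewrite gt_eqF.
have E1 : b * d `^ (1 - lam) = b `^ (s - 1).
  rewrite /d -powRrM -{1}[b](@powRr1 _ b) ?(ltW b0)// -powRD ?(gt_eqF b0) ?implybT//.
  by congr powR; rewrite /s; field; rewrite gt_eqF.
have E2 : e = b `^ (s - 1).
  by rewrite /e /d -powRrM; congr powR; rewrite /s; field; rewrite gt_eqF.
rewrite E2 mulrCA E1 /C1 le_eqVlt; apply/orP; left; apply/eqP; ring.
Qed.

(** The product F x F y is the maximum times the minimum, hence at most the sum of F x and F y times
    the minimum. With the minimum in the kernel, [inner] bounds the y-integral pointwise by F(x)^(s
    - 1), and the x-integral becomes that of F^s. *)
Lemma HLS_bound :
  (\int[leb]_x \int[leb]_y (F x * F y * `|x - y| `^ (- lam))%:E <= (2 * C1)%:E)%E.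
Proof.
pose m (x y : R) := F x * (Num.min (F x) (F y) * `|x - y| `^ (- lam)).
have m0 x y : 0 <= m x y by rewrite /m !mulr_ge0 ?powR_ge0// le_min !F0.
have C10 : 0 <= C1 by rewrite /C1 addr_ge0// divr_ge0// ltW.
have half : (\int[leb]_x \int[leb]_y (m x y)%:E <= C1%:E)%E.
  apply: (@le_trans _ _ (\int[leb]_x (C1%:E * (F x `^ s)%:E))%E); last first.
    rewrite ge0_integralZl//.
    - by rewrite -[leRHS]mule1 lee_wpmul2l ?lee_fin.
    - by meas.
    - by move=> x _; rewrite lee_fin powR_ge0.
  apply: ge0_le_integral => //.
  - by move=> x _; apply: integral_ge0 => y _; rewrite lee_fin.
  - apply: (measurable_fun_fubini_tonelli_F (m2 := leb) (fun z : RR => (m z.1 z.2)%:E)).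
      by rewrite /m; meas.
    by move=> z; rewrite lee_fin.
  - by apply: emeasurable_funM; meas.
  move=> x _.
  have -> : (\int[leb]_y (m x y)%:E = (F x)%:E * \int[leb]_y (Num.min (F x) (F y) * `|x - y| `^ (- lam))%:E)%E.
    rewrite -ge0_integralZl//.
    - by meas.
    - by move=> y _; rewrite lee_fin mulr_ge0 ?powR_ge0// le_min !F0.
    - by rewrite lee_fin.
  apply: (le_trans (lee_wpmul2l _ (inner x))); first by rewrite lee_fin.
  rewrite -!EFinM lee_fin mulrCA mulr_powRB1//.
  by apply: lt_trans s_gt1.
have half' : (\int[leb]_x \int[leb]_y (m y x)%:E <= C1%:E)%E.
  apply: le_trans half; rewrite (fubini_tonelli (m1 := leb) (m2 := leb) (fun z : RR => (m z.2 z.1)%:E))//.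
    by rewrite /m; meas.
  by move=> z; rewrite lee_fin.
apply: (@le_trans _ _ (\int[leb]_x (\int[leb]_y (m x y)%:E + \int[leb]_y (m y x)%:E))%E).
  apply: ge0_le_integral => //.
  - by move=> x _; apply: integral_ge0 => y _; rewrite lee_fin !mulr_ge0 ?powR_ge0.
  - apply: (measurable_fun_fubini_tonelli_F (m2 := leb) (fun z : RR => (F z.1 * F z.2 * `|z.1 - z.2| `^ (- lam))%:E)).
      by meas.
    by move=> z; rewrite lee_fin !mulr_ge0 ?powR_ge0.
  - apply: emeasurable_funD.
      apply: (measurable_fun_fubini_tonelli_F (m2 := leb) (fun z : RR => (m z.1 z.2)%:E)).
        by rewrite /m; meas.
      by move=> z; rewrite lee_fin.
    apply: (measurable_fun_fubini_tonelli_F (m2 := leb) (fun z : RR => (m z.2 z.1)%:E)).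
      by rewrite /m; meas.
    by move=> z; rewrite lee_fin.
  move=> x _; rewrite -ge0_integralD//.
  - apply: ge0_le_integral => //.
    + by move=> y _; rewrite lee_fin !mulr_ge0 ?powR_ge0.
    + by meas.
    + by apply: emeasurable_funD; rewrite /m; meas.
    + move=> y _; rewrite -EFinD lee_fin /m (distrC y).
      have k0 : 0 <= `|x - y| `^ (- lam) by exact: powR_ge0.
      have [xy|yx] := leP (F x) (F y).
        by rewrite [X in _ <= _ + X]mulrA [F y * F x]mulrC lerDr !mulr_ge0.
      by rewrite -mulrA lerDl !mulr_ge0.
  - by move=> y _; rewrite lee_fin.
  - by rewrite /m; meas.
  - by move=> y _; rewrite lee_fin.
  - by rewrite /m; meas.
rewrite ge0_integralD//.
- by rewrite (_ : 2 * C1 = C1 + C1) ?EFinD; [exact: leeD half half'|ring].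
- by move=> x _; apply: integral_ge0 => y _; rewrite lee_fin.
- apply: (measurable_fun_fubini_tonelli_F (m2 := leb) (fun z : RR => (m z.1 z.2)%:E)).
    by rewrite /m; meas.
  by move=> z; rewrite lee_fin.
- by move=> x _; apply: integral_ge0 => y _; rewrite lee_fin.
- apply: (measurable_fun_fubini_tonelli_F (m2 := leb) (fun z : RR => (m z.2 z.1)%:E)).
    by rewrite /m; meas.
  by move=> z; rewrite lee_fin.
Qed.

End HLS.

(** * Interpolation *)

Section power_layers.
Context {R : realType}.
Local Notation leb := (@lebesgue_measure R).

Lemma ge0_integral_powR_below (c d : R) : 0 < c -> 0 <= d ->
  (\int[leb]_y (if (0 < y) && (y <= d) then y `^ (c - 1) else 0)%:E = (d `^ c / c)%:E)%E.
Proof.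
move=> c0; rewrite le_eqVlt => /predU1P[<-|d0].
  rewrite powR0 ?gt_eqF// mul0r integral0_eq// => y _.
  by case: ltP => //= y0; rewrite leNgt y0.
rewrite -(ge0_integral_powR_near c0 d0) [RHS]integral_mkcond.
apply: eq_integral => y _; rewrite patchE mem_setE in_itv/= andbT.
by case: (0 < y).
Qed.

Lemma powRV (x c : R) : 0 <= x -> x^-1 `^ c = x `^ (- c).
Proof. by move=> x0; rewrite -powR_inv1// -powRrM mulN1r. Qed.

Lemma level_arith (m u v a b : R) : u <= a + m / 4 -> v <= b + m / 4 -> m <= u + v ->
  m <= 2 * (a + b).
Proof. by move=> *; lra. Qed.

End power_layers.

Section marcinkiewicz.
Context d (Z : measurableType d) (R : realType).
Variable mu : {sigma_finite_measure set Z -> \bar R}.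
Local Notation leb := (@lebesgue_measure R).
Local Notation leb2 := (leb \x leb)%E.
Local Notation RR := (measurableTypeR R * measurableTypeR R)%type.

Lemma norm_Rintegral_approx (h g g' : Z -> R) : measurable_fun setT h -> (forall z, `|h z| <= 1) ->
  mu.-integrable setT (EFin \o g) -> mu.-integrable setT (EFin \o g') ->
  `|\int[mu]_z (h z * g z)| <= `|\int[mu]_z (h z * g' z)| + \int[mu]_z `|g z - g' z|.
Proof.
move=> mh h1 ig ig'.
have mg : measurable_fun setT g by apply/measurable_EFinP; exact: measurable_int ig.
have mg' : measurable_fun setT g' by apply/measurable_EFinP; exact: measurable_int ig'.
have iD : mu.-integrable setT (EFin \o (fun z => g z - g' z)).
  by have := integrableB measurableT ig ig'; apply: eq_integrable => // z _; rewrite /= EFinB.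
have ih f : mu.-integrable setT (EFin \o f) -> mu.-integrable setT (EFin \o (fun z => h z * f z)).
  move=> if_; have mf : measurable_fun setT f by apply/measurable_EFinP; exact: measurable_int if_.
  apply: le_integrable if_ => //; first by meas.
  by move=> z _ /=; rewrite lee_fin normrM ler_piMl.
have -> : \int[mu]_z (h z * g z) = \int[mu]_z (h z * g' z) + \int[mu]_z (h z * (g z - g' z)).
  rewrite -RintegralD//; [|exact: ih|exact: ih].
  by apply: eq_Rintegral => z _; ring.
apply: (le_trans (ler_normD _ _)); rewrite lerD2l.
apply: (le_trans (le_normr_Rintegral _ _)) => //; first exact: ih.
apply: le_Rintegral => //.
- by have := integrable_abse (ih _ iD); apply: eq_integrable => // z _.
- by have := integrable_abse iD; apply: eq_integrable => // z _.
- by move=> z _; rewrite normrM ler_piMl.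
Qed.

Variables (zeta tau g k : Z -> R) (W : RR -> R) (p c0 K : R).
Hypotheses (mzeta : measurable_fun setT zeta) (mtau : measurable_fun setT tau).
Hypothesis ig : mu.-integrable setT (EFin \o g).
Hypothesis mk : measurable_fun setT k.
Hypothesis k_ge0 : forall z, 0 <= k z.
Hypothesis k_gt0 : forall z, g z != 0 -> 0 < k z.
Hypothesis hK : forall e a b, 0 < e ->
  (\int[mu]_z (k z * pk e (a - zeta z) * pk e (b - tau z))%:E <= K%:E)%E.
Hypotheses (p2 : 0 < p - 2) (c00 : 0 < c0).
Hypotheses (mW : measurable_fun setT W) (W0 : forall y, 0 <= W y).
Hypothesis hW : forall y, W y <= `|oscC mu zeta tau g y| + `|oscS mu zeta tau g y|.

Let p1 : 0 < p - 1.
Proof. by rewrite (lt_trans p2)// ltrD2l ltrN2 ltr1n. Qed.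

Let p0 : 0 < p.
Proof. by rewrite (lt_trans p1)// gtrBl. Qed.

(** For Q = 2 p this is 2 / (Q - 2). *)
Let lam : R := (p - 1)^-1.

Let lam0 : 0 < lam. Proof. by rewrite invr_gt0. Qed.

Hypothesis hN : (\int[mu]_z (`|g z| `^ (1 + lam) * k z `^ (- lam))%:E <= c0%:E)%E.

Let mg : measurable_fun setT g.
Proof. by apply/measurable_EFinP; exact: measurable_int ig. Qed.

(* At the level m the part of g that is not far has L^1 norm at most m / 4, hence it
   contributes at most m / 2 to W; the far part is estimated in L^2. *)
Let far (m : R) (z : Z) : bool := m * `|g z| `^ lam <= 4 * c0 * k z `^ lam.

Let gf (m : R) (z : Z) : R := if far m z then g z else 0.

Let mgf m : measurable_fun setT (gf m).
Proof. by rewrite /gf /far; meas. Qed.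

Let igf m : mu.-integrable setT (EFin \o gf m).
Proof.
apply: le_integrable ig => //; first by apply/measurable_EFinP; exact: mgf.
move=> z _ /=; rewrite lee_fin /gf.
by case: ifP => // _; rewrite normr0.
Qed.

(** Where z is not far, the quotient m |g|^lam / (4 c0 k^lam) exceeds 1; multiplying |g| by it gives
    m / (4 c0) times the integrand of [hN], whose integral is at most c0. *)
Let near_small (m : R) : 0 < m -> \int[mu]_z `|g z - gf m z| <= m / 4.
Proof.
move=> m0.
have i1 : mu.-integrable setT (EFin \o (fun z => `|g z - gf m z|)).
  apply: le_integrable ig => //; first by have := mgf m => mgm; meas.
  move=> z _ /=; rewrite lee_fin normr_id /gf; case: ifP => _; first by rewrite subrr normr0.
  by rewrite subr0.
rewrite -lee_fin fineK; last exact: (integrable_fin_num measurableT i1).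
apply: (@le_trans _ _ (\int[mu]_z ((m / (4 * c0))%:E * (`|g z| `^ (1 + lam) * k z `^ (- lam))%:E))%E).
  apply: ge0_le_integral => //.
  - by have := mgf m => mgm; meas.
  - by apply: emeasurable_funM; meas.
  move=> z _; rewrite -EFinM lee_fin /gf; case: ifPn => [_|].
    by rewrite subrr normr0; nneg.
  rewrite /far -ltNge => near.
  rewrite subr0.
  have g0 : g z != 0.
    apply: contraTneq near => ->; rewrite normr0 powR0 ?gt_eqF// mulr0 -leNgt.
    by nneg.
  have k0 := k_gt0 g0; have ng0 : 0 < `|g z| by rewrite normr_gt0.
  rewrite powRD ?(gt_eqF ng0) ?implybT// powRr1// powRN.
  have kl0 : 0 < k z `^ lam by rewrite powR_gt0.
  rewrite (_ : _ * _ = `|g z| * (m * `|g z| `^ lam / (4 * c0 * k z `^ lam))); last first.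
    by field; rewrite !gt_eqF.
  rewrite ler_peMr// ler_pdivlMr ?mul1r; first exact: ltW.
  by rewrite !mulr_gt0.
rewrite ge0_integralZl//; last 3 first.
- by meas.
- by move=> z _; rewrite lee_fin; nneg.
- by rewrite lee_fin; nneg.
apply: (@le_trans _ _ ((m / (4 * c0))%:E * c0%:E)%E).
  by apply: lee_wpmul2l => //; rewrite lee_fin; nneg.
rewrite -EFinM lee_fin le_eqVlt; apply/orP; left; apply/eqP.
by field; rewrite gt_eqF.
Qed.

Let A (m : R) := oscC mu zeta tau (gf m).
Let B (m : R) := oscS mu zeta tau (gf m).

(** The near part accounts for at most m / 4 in each of the two components, so m <= W y implies m <=
    2 (|A| + |B|); squaring gives the factor 8. *)
Let level (m : R) (y : RR) : 0 < m -> m <= W y -> m ^+ 2 <= 8 * (A m y ^+ 2 + B m y ^+ 2).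
Proof.
move=> m0 mW'.
have c1 : `|oscC mu zeta tau g y| <= `|A m y| + m / 4.
  apply: (le_trans (@norm_Rintegral_approx _ g (gf m) _ _ ig (igf m))).
  - by meas.
  - by move=> z; exact: norm_cos_le1.
  - by rewrite lerD2l near_small.
have s1 : `|oscS mu zeta tau g y| <= `|B m y| + m / 4.
  apply: (le_trans (@norm_Rintegral_approx _ g (gf m) _ _ ig (igf m))).
  - by meas.
  - by move=> z; exact: norm_sin_le1.
  - by rewrite lerD2l near_small.
have h : m <= 2 * (`|A m y| + `|B m y|).
  exact: level_arith c1 s1 (le_trans mW' (hW y)).
apply: (@le_trans _ _ ((2 * (`|A m y| + `|B m y|)) ^+ 2)).
  by rewrite ler_pXn2r// nnegrE ?(ltW m0)//; nneg.
rewrite -(real_normK (num_real (A m y))) -(real_normK (num_real (B m y))).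
move: (`|A m y|) (`|B m y|) => u v; rewrite -subr_ge0.
by rewrite (_ : _ - _ = 4 * (u - v) ^+ 2); [nneg|ring].
Qed.

Let K0 : 0 <= K.
Proof.
rewrite -lee_fin; apply: le_trans (hK 0 0 ltr01).
by apply: integral_ge0 => z _; rewrite lee_fin; apply: mulr_ge0; [apply: mulr_ge0|]; rewrite ?pk_ge0.
Qed.

Let farL2 (m : R) : 0 < m ->
  (\int[leb2]_y (A m y ^+ 2 + B m y ^+ 2)%:E <= K%:E * \int[mu]_z (gf m z ^+ 2 / k z)%:E)%E.
Proof.
move=> m0; apply: oscillatory_L2_bound => //.
move=> z; rewrite /gf; case: ifP => _; [exact: k_gt0|by rewrite eqxx].
Qed.

(** The last level at which z counts as far. For fixed z the condition [far m z] becomes m <=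
    [Lam z], so the levels can be integrated first. *)
Let Lam z : R := 4 * c0 * (k z / `|g z|) `^ lam.

Let farE m z : g z != 0 -> far m z = (m <= Lam z).
Proof.
move=> gz0; have ng0 : 0 < `|g z| by rewrite normr_gt0.
rewrite /far /Lam powRM ?invr_ge0 ?k_ge0//.
rewrite powRV// powRN mulrA.
by rewrite ler_pdivlMr ?powR_gt0.
Qed.

Let ypow (m : R) : R := if 0 < m then m `^ (p - 2 - 1) else 0.

Let ypow0 m : 0 <= ypow m. Proof. by rewrite /ypow; case: ifP => // _; nneg. Qed.

(** The integral of m^(p - 3) up to [Lam z] converges at 0 because p > 2 and gives the power p - 2.
    As lam (p - 2) = 1 - lam, it combines with g^2 / k to the integrand of [hN]. *)
Let swap : (\int[leb]_m \int[mu]_z (ypow m * (gf m z ^+ 2 / k z))%:E =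
   \int[mu]_z (((4 * c0) `^ (p - 2) / (p - 2)) * (`|g z| `^ (1 + lam) * k z `^ (- lam)))%:E)%E.
Proof.
rewrite (fubini_tonelli (m1 := leb) (m2 := mu) (fun w : measurableTypeR R * Z => (ypow w.1 * (gf w.1 w.2 ^+ 2 / k w.2))%:E))//; last 2 first.
- by rewrite /ypow /gf /far; meas.
- by move=> w; rewrite lee_fin; nneg.
apply: eq_integral => z _.
have [gz0|gz0] := eqVneq (g z) 0.
  rewrite gz0 normr0 powR0; last by rewrite gt_eqF// addr_gt0.
  rewrite mul0r mulr0; apply: integral0_eq => m _.
  by rewrite /gf gz0 if_same expr0n mul0r mulr0.
have k0 := k_gt0 gz0; have ng0 : 0 < `|g z| by rewrite normr_gt0.
have L0 : 0 <= Lam z by rewrite /Lam; nneg.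
transitivity (\int[leb]_m ((g z ^+ 2 / k z)%:E * (if (0 < m) && (m <= Lam z) then m `^ (p - 2 - 1) else 0)%:E))%E.
  apply: eq_integral => m _; rewrite -EFinM /ypow /gf farE//; congr EFin.
  by case: (0 < m); case: (m <= Lam z) => /=; ring.
rewrite ge0_integralZl//; last 3 first.
- by meas.
- by move=> m _; rewrite lee_fin; case: ifP => // _; nneg.
- by rewrite lee_fin; nneg.
rewrite ge0_integral_powR_below// -EFinM; congr EFin.
rewrite /Lam powRM; [|by nneg|by nneg].
rewrite -powRrM (_ : lam * (p - 2) = 1 - lam); last first.
  by rewrite /lam; field; rewrite gt_eqF.
rewrite (powRM (1 - lam) (k_ge0 z)) ?invr_ge0//.
have -> : `|g z|^-1 `^ (1 - lam) = `|g z| `^ (1 + lam) / g z ^+ 2.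
  rewrite powRV// -(real_normK (num_real (g z))).
  rewrite -powR_mulrn// -powRN -powRD ?(gt_eqF ng0) ?implybT//.
  by congr powR; ring.
have -> : k z `^ (1 - lam) = k z * k z `^ (- lam).
  by rewrite powRD ?(gt_eqF k0) ?implybT// powRr1// ltW.
by field; rewrite gz0 !gt_eqF.
Qed.

(** Layer-cake formula: W^p is p times the integral of m^(p - 1) over 0 < m <= W. On these levels
    m^2 is exchanged for the squared far part by [level], which costs 8; the L^2 bound supplies K,
    and [swap] with [hN] the remaining factors. *)
Lemma oscillatory_marcinkiewicz :
  (\int[leb2]_y (W y `^ p)%:E <= (8 * p * K * ((4 * c0) `^ (p - 2) / (p - 2)) * c0)%:E)%E.
Proof.
pose w (m : R) (y : RR) : R := if (0 < m) && (m <= W y) then m `^ (p - 1) else 0.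
have w0 m y : 0 <= w m y by rewrite /w; case: ifP => // _; nneg.
have -> : (\int[leb2]_y (W y `^ p)%:E = \int[leb2]_y (p%:E * \int[leb]_m (w m y)%:E))%E.
  apply: eq_integral => y _; rewrite /w ge0_integral_powR_below// -EFinM; congr EFin.
  by field; rewrite gt_eqF.
have mw2 : measurable_fun setT (fun v : RR * measurableTypeR R => (w v.2 v.1)%:E).
  by rewrite /w; meas.
rewrite ge0_integralZl//; last 3 first.
- by apply: (measurable_fun_fubini_tonelli_F (m2 := leb) _ mw2) => v; rewrite lee_fin.
- by move=> y _; apply: integral_ge0 => m _; rewrite lee_fin.
- by rewrite lee_fin ltW.
have -> : (\int[leb2]_y \int[leb]_m (w m y)%:E = \int[leb]_m \int[leb2]_y (w m y)%:E)%E.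
  apply: (fubini_tonelli (m1 := sfprod leb leb) (m2 := leb) _ mw2).
  by move=> v; rewrite lee_fin.
have step m : (\int[leb2]_y (w m y)%:E <= (8 * K * ypow m)%:E * \int[mu]_z (gf m z ^+ 2 / k z)%:E)%E.
  rewrite /w /ypow; have [m0|m0] := ltP 0 m; last first.
    by rewrite mulr0 mul0e integral0_eq.
  have mA : measurable_fun setT (A m) by exact: measurable_oscC.
  have mB : measurable_fun setT (B m) by exact: measurable_oscS.
  apply: (@le_trans _ _ (\int[leb2]_y ((8 * m `^ (p - 2 - 1))%:E * (A m y ^+ 2 + B m y ^+ 2)%:E))%E).
    apply: ge0_le_integral => //.
    - by move=> y _; rewrite lee_fin /=; case: ifP => // _; nneg.
    - by meas.
    - by apply: emeasurable_funM; meas.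
    move=> y _; rewrite -EFinM lee_fin /=; case: ifP => [mW'|_]; last by nneg.
    have -> : p - 1 = (p - 2 - 1) + 2%:R by ring.
    rewrite powRD ?(gt_eqF m0) ?implybT// powR_mulrn ?(ltW m0)//.
    by rewrite [leRHS]mulrAC [leRHS]mulrC ler_wpM2l ?powR_ge0// level.
  rewrite ge0_integralZl//; last 3 first.
  - by meas.
  - by move=> y _; rewrite lee_fin; nneg.
  - by rewrite lee_fin; nneg.
  rewrite (_ : 8 * K * m `^ (p - 2 - 1) = (8 * m `^ (p - 2 - 1)) * K); last by ring.
  rewrite [X in (_ <= X * _)%E]EFinM -muleA; apply: lee_wpmul2l; last exact: farL2.
  by rewrite lee_fin; nneg.
have mzz : measurable_fun setT (fun v : measurableTypeR R * Z => (ypow v.1 * (gf v.1 v.2 ^+ 2 / k v.2))%:E).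
  by rewrite /ypow /gf /far; meas.
have zz0 (v : measurableTypeR R * Z) : (0 <= (ypow v.1 * (gf v.1 v.2 ^+ 2 / k v.2))%:E)%E.
  by rewrite lee_fin; nneg.
have main : (\int[leb]_m \int[leb2]_y (w m y)%:E <=
    (8 * K)%:E * \int[leb]_m \int[mu]_z (ypow m * (gf m z ^+ 2 / k z))%:E)%E.
  rewrite -ge0_integralZl//; last 3 first.
  - by apply: (measurable_fun_fubini_tonelli_F (m2 := mu) _ mzz).
  - by move=> m _; apply: integral_ge0 => z _; exact: (zz0 (m, z)).
  - by rewrite lee_fin; nneg.
  apply: ge0_le_integral => //.
  - by move=> m _; apply: integral_ge0 => y _; rewrite lee_fin.
  - apply: (measurable_fun_fubini_tonelli_G (m1 := sfprod leb leb) _ mw2).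
    by move=> v; rewrite lee_fin.
  - apply: emeasurable_funM => //.
    by apply: (measurable_fun_fubini_tonelli_F (m2 := mu) _ mzz).
  move=> m _; apply: (le_trans (step m)).
  rewrite [X in (X * _)%E]EFinM -muleA; apply: lee_wpmul2l; first by rewrite lee_fin; nneg.
  rewrite -ge0_integralZl//.
  - by have := mgf m => mgm; meas.
  - by move=> z _; rewrite lee_fin; nneg.
  - by rewrite lee_fin.
rewrite swap in main.
have c1 : 0 <= (4 * c0) `^ (p - 2) / (p - 2) by rewrite divr_ge0 ?powR_ge0// ltW.
have E : (\int[mu]_z ((4 * c0) `^ (p - 2) / (p - 2) * (`|g z| `^ (1 + lam) * k z `^ (- lam)))%:E =
   ((4 * c0) `^ (p - 2) / (p - 2))%:E * \int[mu]_z (`|g z| `^ (1 + lam) * k z `^ (- lam))%:E)%E.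
  rewrite -ge0_integralZl//.
  - by meas.
  - by move=> z _; rewrite lee_fin; nneg.
rewrite E in main.
apply: (@le_trans _ _ (p%:E * ((8 * K)%:E * (((4 * c0) `^ (p - 2) / (p - 2))%:E * c0%:E)))%E).
  apply: lee_wpmul2l; first by rewrite lee_fin ltW.
  apply: (le_trans main); apply: lee_wpmul2l; first by rewrite lee_fin; nneg.
  by apply: lee_wpmul2l.
by rewrite -!EFinM lee_fin le_eqVlt; apply/orP; left; apply/eqP; ring.
Qed.

End marcinkiewicz.

(** * Extension of densities on the half line *)

Section half_line.
Context {R : realType}.
Local Notation leb := (@lebesgue_measure R).
Local Notation leb2 := (leb \x leb)%E.
Local Notation RR := (measurableTypeR R * measurableTypeR R)%type.
(* This p is half of the exponent 3p of the theorem: the square of the extension of f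
   is estimated in L^p. *)
Variables (alpha p : R).
Hypotheses (alpha0 : 0 < alpha) (alpha1 : alpha - 1 != 0) (p2 : 0 < p - 2).

Let p1 : 0 < p - 1.
Proof. by rewrite (lt_trans p2)// ltrD2l ltrN2 ltr1n. Qed.

Let p23 : 0 < 2 * p - 3.
Proof.
rewrite (_ : 2 * p - 3 = (p - 1) + (p - 2)); last by ring.
by rewrite addr_gt0.
Qed.

Let lam : R := (p - 1)^-1.
Let s : R := 2 / (2 - lam).
Let c : R := alpha - 1.
(** Chosen so that gam^s |c| = 1, where |c| is the factor in dv = |c| x^(c - 1) dx; [del] undoes gam
    |c| in each substitution. *)
Let gam : R := `|c| `^ (- s^-1).
Let del : R := (gam * `|c|)^-1.

Let lam0 : 0 < lam. Proof. by rewrite invr_gt0. Qed.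

Let lam1 : lam < 1.
Proof. by rewrite invf_lt1// -subr_gt0 -addrA -opprD. Qed.

Let sE : s = (2 * p - 2) / (2 * p - 3).
Proof.
rewrite /s /lam; field.
rewrite (gt_eqF p1)/= (_ : _ - _ = 2 * p - 3); last by ring.
by rewrite !gt_eqF.
Qed.

Let s0 : 0 < s.
Proof.
rewrite sE divr_gt0//.
by rewrite (_ : 2 * p - 2 = 2 * (p - 1)) ?mulr_gt0//; ring.
Qed.

Let nc0 : 0 < `|c|. Proof. by rewrite normr_gt0. Qed.

Let gam0 : 0 < gam. Proof. by rewrite powR_gt0. Qed.

Let del0 : 0 < del. Proof. by rewrite invr_gt0 mulr_gt0. Qed.

(** The factor alpha^(-lam) of the Jacobian, [del] for each of the two substitutions, and the
    Hardy-Littlewood-Sobolev constant. *)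
Let c0 : R := alpha `^ (- lam) * del ^+ 2 * (2 * (2 / (1 - lam) + 3)).

Let c00 : 0 < c0.
Proof.
by rewrite !mulr_gt0 ?powR_gt0 ?exprn_gt0// addr_gt0// divr_gt0 ?subr_gt0.
Qed.

Variables (a b : R) (f : R -> R) (M : R).
Hypotheses (a0 : 0 < a) (mf : measurable_fun setT f) (fM : forall x, `|f x| <= M).
Hypothesis fab : forall x, f x != 0 -> a <= x <= b.
(** With q = 2 p / (2 p - 3), this says that x^((2 - alpha) / (2 p)) f has L^q norm at most 1. *)
Hypothesis fq :
  (\int[leb]_x (`|f x| `^ (2 * p / (2 * p - 3)) * x `^ ((2 - alpha) / (2 * p - 3)))%:E <= 1)%E.

(* |f|^(1 + lam) in the variable v = x^(alpha - 1), in which the Jacobian is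
   alpha |v - w|; gam normalizes its L^s norm. *)
Let F (v : R) : R := if 0 < v then gam * (`|f (v `^ c^-1)| `^ (1 + lam) * v `^ (- ((c - 1) / c))) else 0.

Let F0 v : 0 <= F v.
Proof. by rewrite /F; case: ifP => // _; rewrite !mulr_ge0 ?powR_ge0// ltW. Qed.

Let mF : measurable_fun setT F.
Proof.
have mfv : measurable_fun setT (fun v : R => f (v `^ c^-1)).
  by apply: (measurableT_comp mf); meas.
by rewrite /F; meas.
Qed.

Let F_powR x : 0 < x -> F (x `^ c) = gam * (`|f x| `^ (1 + lam) * x `^ (- (c - 1))).
Proof.
move=> x0; rewrite /F powR_gt0// -!powRrM.
by rewrite mulfV// powRr1 ?(ltW x0)// (_ : c * - ((c - 1) / c) = - (c - 1)) //; field.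
Qed.

Let subst (k : R -> \bar R) : measurable_fun setT k -> (forall v, (0 <= k v)%E) ->
  (\int[leb]_x ((`|f x| `^ (1 + lam))%:E * k (x `^ c)%R) = del%:E * \int[leb]_v ((F v)%:E * k v))%E.
Proof.
move=> mk k0.
have mFk : measurable_fun setT (fun v => (F v)%:E * k v)%E.
  by apply: emeasurable_funM => //; meas.
have Fk0 v : (0 <= (F v)%:E * k v)%E by rewrite mule_ge0// lee_fin.
have -> : (\int[leb]_v ((F v)%:E * k v) = \int[leb]_(v in `]0%R, +oo[) ((F v)%:E * k v))%E.
  rewrite [RHS]integral_mkcond; apply: eq_integral => v _.
  by rewrite patchE mem_setE in_itv/= andbT /F; case: ifP => // _; rewrite mul0e.
rewrite -(ge0_integral_powR_subst alpha1 mFk Fk0) -/c.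
rewrite -ge0_integralZl//; last 3 first.
- apply: measurable_funTS; apply: emeasurable_funM; last by meas.
  have mxc : measurable_fun setT (fun x : R => x `^ c) by meas.
  by exact: (measurableT_comp mFk mxc).
- by move=> x _; rewrite mule_ge0// lee_fin; nneg.
- by rewrite lee_fin ltW.
rewrite [RHS]integral_mkcond; apply: eq_integral => x _.
rewrite patchE mem_setE in_itv/= andbT; case: ifPn => [x0|x0]; last first.
  rewrite (_ : f x = 0); first by rewrite normr0 powR0 ?mul0e// gt_eqF// addr_gt0.
  apply/eqP; apply: contraNT x0 => /fab/andP[ax _]; exact: lt_le_trans ax.
rewrite muleAC -EFinM muleA -EFinM; congr (_%:E * _)%E; rewrite F_powR// powRN /del.
by field; rewrite !gt_eqF ?powR_gt0.
Qed.

(** The exponents close up: (1 + lam) s = 2 p / (2 p - 3), and the powers of x left by the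
    substitution combine to x^((2 - alpha) / (2 p - 3)). *)
Let F1 : (\int[leb]_v (F v `^ s)%:E <= 1)%E.
Proof.
apply: le_trans fq.
have mFs : measurable_fun setT (fun v => (F v `^ s)%:E) by meas.
have Fs0 v : (0 <= (F v `^ s)%:E)%E by rewrite lee_fin; nneg.
have -> : (\int[leb]_v (F v `^ s)%:E = \int[leb]_(v in `]0%R, +oo[) (F v `^ s)%:E)%E.
  rewrite [RHS]integral_mkcond; apply: eq_integral => v _.
  rewrite patchE mem_setE in_itv/= andbT /F; case: ifP => // _.
  by rewrite powR0// gt_eqF.
rewrite -(ge0_integral_powR_subst alpha1 mFs Fs0) -/c.
apply: (@le_trans _ _ (\int[leb]_(x in `]0%R, +oo[) (`|f x| `^ (2 * p / (2 * p - 3)) * x `^ ((2 - alpha) / (2 * p - 3)))%:E)%E); last first.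
  apply: ge0_subset_integral => //; first by meas.
  by move=> x _; rewrite lee_fin; nneg.
apply: ge0_le_integral => //.
- by move=> x _; rewrite mule_ge0// lee_fin; nneg.
- apply: measurable_funTS; apply: emeasurable_funM; last by meas.
  have mxc : measurable_fun setT (fun x : R => x `^ c) by meas.
  by exact: (measurableT_comp mFs mxc).
- by apply: measurable_funTS; meas.
move=> x; rewrite /= in_itv/= andbT => x0.
rewrite -EFinM lee_fin F_powR// powRM; [|exact: ltW|by nneg].
rewrite powRM; [|by nneg|by nneg].
rewrite /gam -!powRrM mulNr mulVf ?gt_eqF// powR_inv1//.
have -> : (1 + lam) * s = 2 * p / (2 * p - 3).
  by rewrite sE /lam; field; rewrite !gt_eqF.
rewrite le_eqVlt; apply/orP; left; apply/eqP.
have -> : x `^ ((2 - alpha) / (2 * p - 3)) = x `^ (- (c - 1) * s) * x `^ (c - 1).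
  rewrite -powRD ?(gt_eqF x0) ?implybT//; congr powR.
  by rewrite sE /c; field; rewrite gt_eqF.
by field; rewrite gt_eqF.
Qed.

Let box (x y : R) : bool := [&& a <= x, x <= b, a <= y & y <= b].
Let k (z : RR) : R := if box z.1 z.2 then `|alpha * (z.1 `^ (alpha - 1) - z.2 `^ (alpha - 1))| else 0.
(** The density is set to 0 where k vanishes, since the L^2 bound divides by k. Within the support
    of the product this concerns the diagonal only. *)
Let g (z : RR) : R := if k z == 0 then 0 else f z.1 * f z.2.

Let mk : measurable_fun setT k.
Proof. by rewrite /k /box; meas. Qed.

Let k0 z : 0 <= k z.
Proof. by rewrite /k; case: ifP. Qed.

Let mg : measurable_fun setT g.
Proof.
rewrite (_ : g = fun z => if k z <= 0 then 0 else f z.1 * f z.2).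
  apply: measurable_fun_ifT; first by meas.
    exact: measurable_cst.
  by meas.
by apply/funext => z; rewrite /g [k z <= 0]le_eqVlt [k z < 0]ltNge k0 orbF.
Qed.

Let if_ : leb.-integrable setT (EFin \o f).
Proof.
have fin : (leb [set` `[a, b]] < +oo)%E.
  by rewrite lebesgue_measure_itv; case: ifP => _; rewrite ?ltry.
apply/integrableP; split; first by meas.
have M0 : 0 <= M by apply: le_trans (fM 0).
apply: (@le_lt_trans _ _ (\int[leb]_(x in `[a, b]) (cst M%:E x))%E); last first.
  by rewrite integral_cst//; apply: lte_mul_pinfty => //; rewrite lee_fin.
rewrite [leRHS]integral_mkcond; apply: ge0_le_integral => //.
- by apply: measurableT_comp => //; meas.
- by apply/(measurable_restrictT _ _).1.
move=> x _; rewrite patchE mem_setE in_itv/=; case: ifPn => [_|xab]; first by rewrite lee_fin.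
have [->|/fab] := eqVneq (f x) 0; first by rewrite normr0.
by rewrite (negbTE xab).
Qed.

Let iff : leb2.-integrable setT (fun z => (f z.1 * f z.2)%:E).
Proof. exact: (integrable_tensor if_ if_). Qed.

Let ig : leb2.-integrable setT (EFin \o g).
Proof.
apply: le_integrable iff => //; first by apply/measurable_EFinP.
move=> z _ /=; rewrite lee_fin /g; case: ifP => // _.
by rewrite normr0.
Qed.

(** The power alpha - 1 is injective on the positive half line, so for fixed x the two densities
    differ at most at y = x. *)
Let diagonal : \int[leb2]_z `|f z.1 * f z.2 - g z| = 0.
Proof.
rewrite /Rintegral (fubini_tonelli1 (fun z : RR => `|f z.1 * f z.2 - g z|%:E)); last 2 first.
- by meas.
- by move=> z; rewrite lee_fin.
rewrite /fubini_F/= integral0_eq// => x _.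
rewrite -(integral_set1 (fun y => `|f x * f y - g (x, y)|%:E) x) [RHS]integral_mkcond.
apply: eq_integral => y _; rewrite patchE; case: ifPn => //.
rewrite notin_setE/= => /eqP xy; congr EFin; rewrite /g; case: ifPn => [/eqP k0'|_]; last by rewrite subrr normr0.
rewrite subr0/=; apply/eqP; rewrite normr_eq0 mulf_eq0; apply: contraNT xy => /norP[fx fy].
have /andP[ax xb] := fab fx; have /andP[ay yb] := fab fy.
move: k0'; rewrite /k /box/= ax xb ay yb/= => /eqP; rewrite normr_eq0 mulf_eq0 (gt_eqF alpha0)/= subr_eq0.
move=> /eqP E; apply/eqP.
rewrite -(@powRr1 _ y) ?(le_trans (ltW a0))// -(@powRr1 _ x) ?(le_trans (ltW a0))//.
by rewrite -(mulfV alpha1) !powRrM E.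
Qed.

Let zeta (z : RR) : R := z.1 + z.2.
Let tau (z : RR) : R := z.1 `^ alpha + z.2 `^ alpha.
Let C := oscC leb id (fun x => x `^ alpha) f.
Let S := oscS leb id (fun x => x `^ alpha) f.

Let icos (y : RR) : leb.-integrable setT (EFin \o (fun x : R => cos (y.1 * x - y.2 * x `^ alpha) * f x)).
Proof.
apply: le_integrable if_ => //; first by meas.
by move=> x _ /=; rewrite lee_fin normrM ler_piMl// norm_cos_le1.
Qed.

Let isin (y : RR) : leb.-integrable setT (EFin \o (fun x : R => sin (y.1 * x - y.2 * x `^ alpha) * f x)).
Proof.
apply: le_integrable if_ => //; first by meas.
by move=> x _ /=; rewrite lee_fin normrM ler_piMl// norm_sin_le1.
Qed.

(** The real part of the squared extension as an oscillatory integral over pairs; [prodS] is the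
    imaginary part. *)
Let prodC (y : RR) : C y ^+ 2 - S y ^+ 2 = \int[leb2]_z (cos (y.1 * zeta z - y.2 * tau z) * (f z.1 * f z.2)).
Proof.
rewrite !expr2 -(Rintegral_tensor (icos y) (icos y)) -(Rintegral_tensor (isin y) (isin y)).
rewrite -RintegralB//; last 2 first.
- exact: (integrable_tensor (icos y) (icos y)).
- exact: (integrable_tensor (isin y) (isin y)).
apply: eq_Rintegral => z _; rewrite /zeta /tau.
have -> : y.1 * (z.1 + z.2) - y.2 * (z.1 `^ alpha + z.2 `^ alpha) =
  (y.1 * z.1 - y.2 * z.1 `^ alpha) + (y.1 * z.2 - y.2 * z.2 `^ alpha) by ring.
by move: (f z.1) (f z.2) (y.1 * z.1 - _) (y.1 * z.2 - _) => u v s1 s2; rewrite cosD; ring.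
Qed.

Let prodS (y : RR) : 2 * (C y * S y) = \int[leb2]_z (sin (y.1 * zeta z - y.2 * tau z) * (f z.1 * f z.2)).
Proof.
rewrite mulr_natl mulr2n [X in _ + X]mulrC -(Rintegral_tensor (icos y) (isin y)) -(Rintegral_tensor (isin y) (icos y)).
rewrite -RintegralD//; last 2 first.
- exact: (integrable_tensor (icos y) (isin y)).
- exact: (integrable_tensor (isin y) (icos y)).
apply: eq_Rintegral => z _; rewrite /zeta /tau.
have -> : y.1 * (z.1 + z.2) - y.2 * (z.1 `^ alpha + z.2 `^ alpha) =
  (y.1 * z.1 - y.2 * z.1 `^ alpha) + (y.1 * z.2 - y.2 * z.2 `^ alpha) by ring.
by move: (f z.1) (f z.2) (y.1 * z.1 - _) (y.1 * z.2 - _) => u v s1 s2; rewrite sinD; ring.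
Qed.

Let mu2 := sfprod leb leb.

(** The left-hand side is the modulus of the squared extension, at most the sum of the moduli of its
    two parts; by [diagonal] the product density may be replaced by g. *)
Let W_bound (y : RR) : C y ^+ 2 + S y ^+ 2 <= `|oscC mu2 zeta tau g y| + `|oscS mu2 zeta tau g y|.
Proof.
have mzeta : measurable_fun [set: RR] (fun z : RR => y.1 * zeta z - y.2 * tau z).
  by rewrite /zeta /tau; meas.
have hC : `|C y ^+ 2 - S y ^+ 2| <= `|oscC mu2 zeta tau g y|.
  rewrite prodC -[leRHS]addr0 -[X in _ <= _ + X]diagonal.
  apply: (@norm_Rintegral_approx _ _ _ mu2 _ (fun z => f z.1 * f z.2) g) => //.
    by meas.
  by move=> z; exact: norm_cos_le1.
have hS : `|2 * (C y * S y)| <= `|oscS mu2 zeta tau g y|.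
  rewrite prodS -[leRHS]addr0 -[X in _ <= _ + X]diagonal.
  apply: (@norm_Rintegral_approx _ _ _ mu2 _ (fun z => f z.1 * f z.2) g) => //.
    by meas.
  by move=> z; exact: norm_sin_le1.
apply: le_trans (lerD hC hS); move: (C y) (S y) => u v.
rewrite -(@ler_pXn2r _ 2)// ?nnegrE; [|by nneg|by nneg].
rewrite [leRHS]sqrrD !real_normK ?num_real// -subr_ge0.
(* Since (u^2 + v^2)^2 = (u^2 - v^2)^2 + (2 u v)^2, the mixed term of the squared sum is all that is
   left. *)
by rewrite (_ : _ - _ = (`|u ^+ 2 - v ^+ 2| * `|2 * (u * v)|) *+ 2); [rewrite mulrn_wge0//; nneg|ring].
Qed.

Let K_bound (e A B : R) : 0 < e ->
  (\int[mu2]_z (k z * pk e (A - zeta z) * pk e (B - tau z))%:E <= (8 * pi ^+ 2)%:E)%E.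
Proof. exact: curve_Jacobian_bound. Qed.

(** The Jacobian depends on x^c and y^c only, and |g|^(1 + lam) is at most a product, so [subst] in
    each variable leads to the Hardy-Littlewood-Sobolev form of F. *)
Let N_bound : (\int[mu2]_z (`|g z| `^ (1 + lam) * k z `^ (- lam))%:E <= c0%:E)%E.
Proof.
pose h (x : R) : R := `|f x| `^ (1 + lam).
have mh : measurable_fun setT h by rewrite /h; meas.
have h0 x : 0 <= h x by rewrite /h; nneg.
pose D (v w : R) : R := `|v - w| `^ (- lam).
have D0 v w : 0 <= D v w by rewrite /D; nneg.
pose E (z : RR) : R := alpha `^ (- lam) * (h z.1 * (h z.2 * D (z.1 `^ c) (z.2 `^ c))).
have mE : measurable_fun [set: RR] E by rewrite /E /D; meas.
have E0 z : 0 <= E z by rewrite /E; nneg.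
apply: (@le_trans _ _ (\int[leb2]_z (E z)%:E)%E).
  apply: ge0_le_integral => //.
  - by move=> z _; rewrite lee_fin; nneg.
  - by meas.
  - by meas.
  move=> z _; rewrite lee_fin /g /k; case: ifPn => [_|].
    by rewrite normr0 powR0 ?mul0r// gt_eqF// addr_gt0.
  case: ifPn; last by rewrite eqxx.
  move=> _ _; rewrite normrM powRM// normrM (gtr0_norm alpha0) powRM ?(ltW alpha0)//.
  rewrite /E /h /D -/c le_eqVlt; apply/orP; left; apply/eqP; ring.
rewrite (fubini_tonelli1 (fun z : RR => (E z)%:E)); last 2 first.
- by meas.
- by move=> z; rewrite lee_fin.
rewrite /fubini_F/=.
pose I (v : R) := (\int[leb]_w ((F w)%:E * (D v w)%:E))%E.
have mFD : measurable_fun [set: RR] (fun z : RR => ((F z.2)%:E * (D z.1 z.2)%:E)%E).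
  by apply: emeasurable_funM; rewrite /D; meas.
have mI : measurable_fun setT I.
  apply: (measurable_fun_fubini_tonelli_F (m2 := leb) _ mFD) => z.
  by rewrite mule_ge0// lee_fin.
have I0 v : (0 <= I v)%E by apply: integral_ge0 => w _; rewrite mule_ge0// lee_fin.
have inner x : (\int[leb]_y (E (x, y))%:E = (alpha `^ (- lam) * h x)%:E * (del%:E * I (x `^ c)%R))%E.
  rewrite /I -(@subst (fun w => (D (x `^ c) w)%:E)); last 2 first.
  - by rewrite /D; meas.
  - by move=> w; rewrite lee_fin.
  rewrite -ge0_integralZl//.
  - by apply: eq_integral => y _; rewrite -!EFinM /E/=; congr EFin; rewrite /h; ring.
  - by apply: emeasurable_funM; rewrite /D; meas.
  - by move=> y _; rewrite mule_ge0// lee_fin; nneg.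
  - by rewrite lee_fin; nneg.
have -> : (\int[leb]_x \int[leb]_y (E (x, y))%:E =
    (alpha `^ (- lam) * del)%:E * \int[leb]_x ((h x)%:E * I (x `^ c)%R))%E.
  rewrite -ge0_integralZl//.
  - apply: eq_integral => x _; rewrite inner !EFinM !muleA; congr (_ * _)%E.
    by rewrite muleAC.
  - have mxc : measurable_fun setT (fun x : R => x `^ c) by meas.
    apply: emeasurable_funM; first by meas.
    exact: (measurableT_comp mI mxc).
  - by move=> x _; rewrite mule_ge0// lee_fin.
  - by rewrite lee_fin mulr_ge0 ?powR_ge0// ltW.
rewrite (subst mI I0) muleA -EFinM.
have H := HLS_bound lam0 lam1 mF F0 F1.
have -> : (\int[leb]_v ((F v)%:E * I v) = \int[leb]_v \int[leb]_w (F v * F w * `|v - w| `^ (- lam))%:E)%E.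
  apply: eq_integral => v _; rewrite /I -ge0_integralZl//.
  - by apply: eq_integral => w _; rewrite -!EFinM mulrA.
  - by apply: emeasurable_funM; rewrite /D; meas.
  - by move=> w _; rewrite mule_ge0// lee_fin.
  - by rewrite lee_fin.
apply: (le_trans (lee_wpmul2l _ H)).
  by rewrite lee_fin !mulr_ge0 ?powR_ge0// ltW.
by rewrite -EFinM lee_fin /c0 expr2 mulrA.
Qed.

Lemma half_line_bound :
  (\int[leb2]_y ((oscC leb id (fun x => x `^ alpha) f y ^+ 2 +
     oscS leb id (fun x => x `^ alpha) f y ^+ 2) `^ p)%:E <=
   (8 * p * (8 * pi ^+ 2) * ((4 * c0) `^ (p - 2) / (p - 2)) * c0)%:E)%E.
Proof.
apply: (@oscillatory_marcinkiewicz _ _ _ mu2 zeta tau g k) => //.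
- by rewrite /zeta; meas.
- by rewrite /tau; meas.
- by move=> z; rewrite /g lt0r k0 andbT; case: ifP => //; rewrite eqxx.
- have mid : measurable_fun [set: measurableTypeR R] (fun x : R => x) by exact: measurable_id.
  have mpw : measurable_fun [set: measurableTypeR R] (fun x : R => x `^ alpha) by meas.
  have m1 := @measurable_oscC _ _ _ leb _ _ _ mid mpw if_.
  have m2 := @measurable_oscS _ _ _ leb _ _ _ mid mpw if_.
  by meas.
- by move=> y; nneg.
Qed.

End half_line.

(** * Extension of densities on the line *)

Section power_sums.
Context {R : realType}.
Local Notation leb := (@lebesgue_measure R).

Lemma powR_sum2 (x y p : R) : 0 <= x -> 0 <= y -> 0 <= p ->
  (2 * (x + y)) `^ p <= 4 `^ p * (x `^ p + y `^ p).
Proof.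
move=> x0 y0 p0; pose m := Num.max x y.
have m0 : 0 <= m by rewrite /m le_max x0.
apply: (@le_trans _ _ ((4 * m) `^ p)).
  apply: ge0_ler_powR => //; rewrite ?nnegrE ?mulr_ge0 ?addr_ge0//.
  rewrite (_ : 4 * m = 2 * (m + m)); last by ring.
  by rewrite ler_wpM2l// lerD// /m le_max lexx ?orbT.
rewrite powRM// ler_wpM2l ?powR_ge0// /m.
by case: (leP x y) => _; rewrite ?lerDr ?lerDl powR_ge0.
Qed.

Lemma ge0_integral_powR_sum2 d (T : measurableType d) (mu : {measure set T -> \bar R})
    (W U V : T -> R) (p K : R) : 0 <= p ->
  measurable_fun setT W -> measurable_fun setT U -> measurable_fun setT V ->
  (forall y, 0 <= W y) -> (forall y, 0 <= U y) -> (forall y, 0 <= V y) ->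
  (forall y, W y <= 2 * (U y + V y)) ->
  (\int[mu]_y (U y `^ p)%:E <= K%:E)%E -> (\int[mu]_y (V y `^ p)%:E <= K%:E)%E ->
  (\int[mu]_y (W y `^ p)%:E <= (4 `^ p * (2 * K))%:E)%E.
Proof.
move=> p0 mW mU mV W0 U0 V0 WUV hU hV.
apply: (@le_trans _ _ (\int[mu]_y ((4 `^ p)%:E * ((U y `^ p)%:E + (V y `^ p)%:E)))%E).
  apply: ge0_le_integral => //.
  - by move=> y _; rewrite lee_fin; nneg.
  - by meas.
  - by apply: emeasurable_funM; [meas|apply: emeasurable_funD; meas].
  move=> y _; rewrite -EFinD -EFinM lee_fin.
  apply: le_trans (powR_sum2 (U0 y) (V0 y) p0).
  by apply: ge0_ler_powR => //; rewrite ?nnegrE ?mulr_ge0 ?addr_ge0.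
rewrite ge0_integralZl//; last 2 first.
- by apply: emeasurable_funD; meas.
- by move=> y _; rewrite adde_ge0// lee_fin; nneg.
rewrite ge0_integralD//; last 4 first.
- by move=> y _; rewrite lee_fin; nneg.
- by meas.
- by move=> y _; rewrite lee_fin; nneg.
- by meas.
rewrite EFinM; apply: lee_wpmul2l; first by rewrite lee_fin; nneg.
by rewrite (_ : 2 * K = K + K); [rewrite EFinD; exact: leeD|ring].
Qed.

Lemma integrable_bddM d (T : measurableType d) (mu : {measure set T -> \bar R}) (h f : T -> R) :
  measurable_fun setT h -> (forall x, `|h x| <= 1) -> mu.-integrable setT (EFin \o f) ->
  mu.-integrable setT (EFin \o (fun x => h x * f x)).
Proof.
move=> mh h1 if_; have mf : measurable_fun setT f by apply/measurable_EFinP; exact: measurable_int if_.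
apply: le_integrable if_ => //; first by meas.
by move=> x _ /=; rewrite lee_fin normrM ler_piMl.
Qed.

Lemma integrable_bounded_support (f : R -> R) (a b M : R) :
  measurable_fun [set: measurableTypeR R] f -> (forall x, `|f x| <= M) ->
  (forall x, f x != 0 -> a <= x <= b) -> leb.-integrable setT (EFin \o f).
Proof.
move=> mf fM fab.
have fin : (leb [set` `[a, b]] < +oo)%E.
  by rewrite lebesgue_measure_itv; case: ifP => _; rewrite ?ltry.
apply/integrableP; split; first by meas.
have M0 : 0 <= M by apply: le_trans (fM 0).
apply: (@le_lt_trans _ _ (\int[leb]_(x in `[a, b]) (cst M%:E x))%E); last first.
  by rewrite integral_cst//; apply: lte_mul_pinfty => //; rewrite lee_fin.
rewrite [leRHS]integral_mkcond; apply: ge0_le_integral => //.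
- by apply: measurableT_comp => //; meas.
- by apply/(measurable_restrictT _ _).1.
move=> x _; rewrite patchE mem_setE in_itv/=; case: ifPn => [_|xab]; first by rewrite lee_fin.
have [->|/fab] := eqVneq (f x) 0; first by rewrite normr0.
by rewrite (negbTE xab).
Qed.

Lemma ge0_integral_reflect1 (F : measurableTypeR R * measurableTypeR R -> \bar R) :
  measurable_fun setT F -> (forall y, (0 <= F y)%E) ->
  (\int[leb \x leb]_y F (- y.1, y.2)%R = \int[leb \x leb]_y F y)%E.
Proof.
move=> mF F0.
have mFN : measurable_fun [set: measurableTypeR R * measurableTypeR R]
    (fun y : measurableTypeR R * measurableTypeR R => F (- y.1, y.2)%R).
  apply: (measurableT_comp mF); apply: measurable_fun_pair => /=; last exact: measurable_snd.
  by meas.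
rewrite (fubini_tonelli2 _ mFN)// (fubini_tonelli2 _ mF)//.
apply: eq_integral => t _; rewrite /fubini_G/= -[RHS]ge0_integral_reflect//.
by apply: (measurableT_comp mF); exact: pair2_measurable.
Qed.

End power_sums.

Section full_line.
Context {R : realType}.
Local Notation leb := (@lebesgue_measure R).
Local Notation leb2 := (leb \x leb)%E.
Local Notation RR := (measurableTypeR R * measurableTypeR R)%type.
Variables (alpha p : R).
Hypotheses (alpha0 : 0 < alpha) (alpha1 : alpha - 1 != 0) (p2 : 0 < p - 2).

Let sigma : R := (alpha - 2) / (2 * p).
Let q : R := 2 * p / (2 * p - 3).

Let p0 : 0 < p.
Proof. by rewrite (lt_trans p2)// gtrBl. Qed.

Let p23 : 0 < 2 * p - 3.
Proof.
rewrite (_ : 2 * p - 3 = (p - 2) + (p - 1)); last by ring.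
by rewrite addr_gt0// (lt_trans p2)// ltrD2l ltrN2 ltr1n.
Qed.

Let q0 : 0 < q. Proof. by rewrite divr_gt0// mulr_gt0. Qed.

(** The squared modulus of the extension of a real density on the whole line. *)
Definition oscn (f : R -> R) (y : RR) : R :=
  oscC leb id (fun x => `|x| `^ alpha) f y ^+ 2 + oscS leb id (fun x => `|x| `^ alpha) f y ^+ 2.

Lemma oscn_ge0 f y : 0 <= oscn f y. Proof. by rewrite /oscn; nneg. Qed.

Lemma measurable_oscn f : leb.-integrable setT (EFin \o f) -> measurable_fun setT (oscn f).
Proof.
move=> if_.
have mid : measurable_fun [set: measurableTypeR R] (fun x : R => x) by exact: measurable_id.
have mpw : measurable_fun [set: measurableTypeR R] (fun x : R => `|x| `^ alpha) by meas.
have m1 := @measurable_oscC _ _ _ leb _ _ _ mid mpw if_.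
have m2 := @measurable_oscS _ _ _ leb _ _ _ mid mpw if_.
by rewrite /oscn; meas.
Qed.

Lemma powR_le_ends (a b x c : R) : 0 < a -> a <= x -> x <= b -> x `^ c <= a `^ c + b `^ c.
Proof.
move=> a0 ax xb; have [c0|/ltW c0] := leP 0 c.
  by apply: (le_trans (le_powR_base (lt_le_trans a0 ax) xb c0)); rewrite lerDr powR_ge0.
by apply: (le_trans (ge_powR_base a0 ax c0)); rewrite lerDl powR_ge0.
Qed.

Lemma oscnZ (m : R) (f : R -> R) (y : RR) : leb.-integrable setT (EFin \o f) ->
  oscn (fun x => m * f x) y = m ^+ 2 * oscn f y.
Proof.
move=> if_.
have mt : measurable_fun [set: measurableTypeR R] (fun x : R => y.1 * x - y.2 * `|x| `^ alpha) by meas.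
have E (trig : R -> R) : measurable_fun setT trig -> (forall x, `|trig x| <= 1) ->
    \int[leb]_x (trig (y.1 * x - y.2 * `|x| `^ alpha) * (m * f x)) =
    m * \int[leb]_x (trig (y.1 * x - y.2 * `|x| `^ alpha) * f x).
  move=> mtr t1.
  have mtt : measurable_fun [set: measurableTypeR R] (fun x : R => trig (y.1 * x - y.2 * `|x| `^ alpha)).
    exact: (measurableT_comp mtr mt).
  rewrite -RintegralZl//; last exact: integrable_bddM.
  by apply: eq_Rintegral => x _; rewrite mulrCA.
rewrite /oscn /oscC /oscS (E cos) ?(E sin)//; last 4 first.
- exact: measurable_sin.
- exact: norm_sin_le1.
- exact: measurable_cos.
- exact: norm_cos_le1.
by rewrite !exprMn mulrDr.
Qed.

Section weighted.
Variables (a b N M : R) (v : R -> R).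
Hypotheses (a0 : 0 < a) (M0 : 0 < M) (mv : measurable_fun [set: measurableTypeR R] v).
Hypotheses (vN : forall x, `|v x| <= N) (vab : forall x, v x != 0 -> a <= `|x| <= b).
Hypothesis vq : (\int[leb]_x (`|v x| `^ q)%:E <= (M `^ q)%:E)%E.

Definition weighted (x : R) : R := `|x| `^ sigma * v x.

Lemma measurable_weighted : measurable_fun [set: measurableTypeR R] weighted.
Proof. by rewrite /weighted; meas. Qed.

Lemma weighted_bounded x : `|weighted x| <= (a `^ sigma + b `^ sigma) * N.
Proof.
have N0 : 0 <= N by apply: le_trans (vN 0).
rewrite /weighted normrM ger0_norm ?powR_ge0//.
have [->|/vab/andP[ax xb]] := eqVneq (v x) 0.
  by rewrite normr0 mulr0; nneg.
by apply: ler_pM => //; exact: powR_le_ends.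
Qed.

Lemma weighted_support x : weighted x != 0 -> a <= `|x| <= b.
Proof. by rewrite /weighted mulf_eq0 => /norP[_ /vab]. Qed.

Lemma integrable_weighted : leb.-integrable setT (EFin \o weighted).
Proof.
apply: (@integrable_bounded_support _ _ (- b) b _ measurable_weighted weighted_bounded).
by move=> x /weighted_support/andP[_]; rewrite ler_norml.
Qed.

End weighted.

(** The constant of [half_line_bound] with its section abbreviations unfolded; the squared factor is
    [del]. *)
Definition half_constant : R :=
  let lam := (p - 1)^-1 in
  let c0 := alpha `^ (- lam) * ((`|alpha - 1| `^ (- (2 / (2 - lam))^-1) * `|alpha - 1|)^-1) ^+ 2
     * (2 * (2 / (1 - lam) + 3)) in
  8 * p * (8 * pi ^+ 2) * ((4 * c0) `^ (p - 2) / (p - 2)) * c0.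

(** Division by M reduces to the normalised density; the squared extension is quadratic in it,
    whence the power M^(2 p). *)
Lemma positive_bound (a b N M : R) (v : R -> R) : 0 < a -> 0 < M ->
  measurable_fun [set: measurableTypeR R] v ->
  (forall x, `|v x| <= N) -> (forall x, v x != 0 -> a <= x <= b) ->
  (\int[leb]_x (`|v x| `^ q)%:E <= (M `^ q)%:E)%E ->
  (\int[leb2]_y (oscn (weighted v) y `^ p)%:E <= (half_constant * M `^ (2 * p))%:E)%E.
Proof.
move=> a0 M0 mv vN vab vq.
have vab' x : v x != 0 -> a <= `|x| <= b.
  by move=> /vab/andP[ax xb]; rewrite ger0_norm ?ax ?xb// (le_trans (ltW a0)).
have iw := integrable_weighted a0 mv vN vab'.
have mw := measurable_weighted mv.
pose f x := M^-1 * weighted v x.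
have mf : measurable_fun setT f by rewrite /f; meas.
have fab x : f x != 0 -> a <= x <= b.
  by rewrite /f mulf_eq0 => /norP[_]; rewrite /weighted mulf_eq0 => /norP[_ /vab].
have fM x : `|f x| <= M^-1 * ((a `^ sigma + b `^ sigma) * N).
  rewrite /f normrM gtr0_norm ?invr_gt0// ler_wpM2l ?invr_ge0 ?(ltW M0)//.
  exact: weighted_bounded.
have fq : (\int[leb]_x (`|f x| `^ (2 * p / (2 * p - 3)) * x `^ ((2 - alpha) / (2 * p - 3)))%:E <= 1)%E.
  apply: (@le_trans _ _ (\int[leb]_x ((M `^ (- q))%:E * (`|v x| `^ q)%:E))%E).
    apply: ge0_le_integral => //.
    - by move=> x _; rewrite lee_fin; nneg.
    - by meas.
    - by apply: emeasurable_funM; meas.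
    move=> x _; rewrite -EFinM lee_fin -/q /f /weighted.
    have [->|/vab/andP[ax _]] := eqVneq (v x) 0.
      by rewrite !mulr0 normr0 powR0 ?gt_eqF// mul0r; nneg.
    have x0 : 0 < x by exact: lt_le_trans ax.
    rewrite !normrM (gtr0_norm x0) (ger0_norm (powR_ge0 _ _)) gtr0_norm ?invr_gt0//.
    rewrite powRM ?invr_ge0 ?(ltW M0) ?mulr_ge0 ?powR_ge0// powRM ?powR_ge0//.
    rewrite powRV ?(ltW M0)// -powRrM.
    have -> : x `^ ((2 - alpha) / (2 * p - 3)) = x `^ (- (sigma * q)).
      by congr powR; rewrite /sigma /q; field; rewrite !gt_eqF.
    rewrite [X in _ * X <= _]powRN le_eqVlt; apply/orP; left; apply/eqP; field.
    by rewrite gt_eqF// powR_gt0.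
  rewrite ge0_integralZl//; last 2 first.
  - by meas.
  - by rewrite lee_fin; nneg.
  apply: (le_trans (lee_wpmul2l _ vq)); first by rewrite lee_fin; nneg.
  by rewrite -EFinM lee_fin powRN mulVf// gt_eqF// powR_gt0.
have oscE y : oscC leb id (fun x => x `^ alpha) f y ^+ 2 + oscS leb id (fun x => x `^ alpha) f y ^+ 2 = oscn f y.
  have E (trig : R -> R) : \int[leb]_x (trig (y.1 * x - y.2 * x `^ alpha) * f x) =
      \int[leb]_x (trig (y.1 * x - y.2 * `|x| `^ alpha) * f x).
    apply: eq_Rintegral => x _; have [->|/fab/andP[ax _]] := eqVneq (f x) 0; first by rewrite !mulr0.
    by rewrite ger0_norm// (le_trans (ltW a0)).
  by rewrite /oscn /oscC /oscS (E cos) (E sin).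
have H := half_line_bound alpha0 alpha1 p2 a0 mf fM fab fq.
have if_ : leb.-integrable setT (EFin \o f) by exact: integrable_bounded_support mf fM fab.
have -> : weighted v = fun x => M * f x.
  by apply/funext => x; rewrite /f mulrA mulfV ?mul1r// gt_eqF.
under eq_integral => y _ do rewrite oscnZ// powRM ?sqr_ge0 ?oscn_ge0// -powR_mulrn ?(ltW M0)// -powRrM EFinM.
have mo := measurable_oscn if_.
rewrite ge0_integralZl//; last 3 first.
- by meas.
- by move=> y _; rewrite lee_fin; nneg.
- by rewrite lee_fin; nneg.
rewrite muleC EFinM; apply: lee_wpmul2r; first by rewrite lee_fin; nneg.
apply: le_trans H; rewrite le_eqVlt; apply/orP; left; apply/eqP.
by apply: eq_integral => y _; rewrite oscE.
Qed.

(** The phase |x|^alpha is even, so reflecting the density only reverses the space variable. This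
    carries the half-line bound to negative frequencies. *)
Lemma oscn_reflect (f : R -> R) (y : RR) : measurable_fun [set: measurableTypeR R] f ->
  oscn (fun x => f (- x)) y = oscn f (- y.1, y.2).
Proof.
move=> mf.
have E (trig : R -> R) : measurable_fun setT trig ->
  \int[leb]_x (trig (y.1 * x - y.2 * `|x| `^ alpha) * f (- x)) =
  \int[leb]_x (trig (- y.1 * x - y.2 * `|x| `^ alpha) * f x).
  move=> mt; congr fine.
  rewrite -[RHS]integral_reflect; last first.
    apply/measurable_EFinP; apply: measurable_funM => //.
    by apply: (measurableT_comp mt); meas.
  by apply: eq_integral => x _; rewrite normrN mulrNN.
by rewrite /oscn /oscC /oscS (E cos)// ?(E sin)//; [exact: measurable_sin|exact: measurable_cos].
Qed.

Lemma oscnD (f g : R -> R) (y : RR) :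
  leb.-integrable setT (EFin \o f) -> leb.-integrable setT (EFin \o g) ->
  oscn (fun x => f x + g x) y <= 2 * (oscn f y + oscn g y).
Proof.
move=> if_ ig.
have mt : measurable_fun [set: measurableTypeR R] (fun x : R => y.1 * x - y.2 * `|x| `^ alpha) by meas.
have E (trig : R -> R) : measurable_fun setT trig -> (forall x, `|trig x| <= 1) ->
    \int[leb]_x (trig (y.1 * x - y.2 * `|x| `^ alpha) * (f x + g x)) =
    \int[leb]_x (trig (y.1 * x - y.2 * `|x| `^ alpha) * f x) +
    \int[leb]_x (trig (y.1 * x - y.2 * `|x| `^ alpha) * g x).
  move=> mtr t1.
  have mtt : measurable_fun [set: measurableTypeR R] (fun x : R => trig (y.1 * x - y.2 * `|x| `^ alpha)).
    exact: (measurableT_comp mtr mt).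
  rewrite -RintegralD//; [|exact: integrable_bddM|exact: integrable_bddM].
  by apply: eq_Rintegral => x _; rewrite mulrDr.
rewrite /oscn /oscC /oscS (E cos) ?(E sin)//; last 4 first.
- exact: measurable_sin.
- exact: norm_sin_le1.
- exact: measurable_cos.
- exact: norm_cos_le1.
move: (Rintegral _ _ _) (Rintegral _ _ _) (Rintegral _ _ _) (Rintegral _ _ _) => s1 s2 s3 s4.
rewrite -subr_ge0 (_ : _ - _ = (s1 - s2) ^+ 2 + (s3 - s4) ^+ 2); last by ring.
by nneg.
Qed.

Definition line_constant : R := 4 `^ p * (2 * half_constant).

(** The density is cut at 0 and its negative half reflected. Both halves obey [positive_bound], and
    the parallelogram inequality [oscnD] adds them. *)
Lemma real_bound (a b N M : R) (v : R -> R) : 0 < a -> 0 < M ->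
  measurable_fun [set: measurableTypeR R] v ->
  (forall x, `|v x| <= N) -> (forall x, v x != 0 -> a <= `|x| <= b) ->
  (\int[leb]_x (`|v x| `^ q)%:E <= (M `^ q)%:E)%E ->
  (\int[leb2]_y (oscn (weighted v) y `^ p)%:E <= (line_constant * M `^ (2 * p))%:E)%E.
Proof.
move=> a0 M0 mv vN vab vq.
have N0 : 0 <= N by apply: le_trans (vN 0).
pose v1 (x : R) := if 0 < x then v x else 0.
pose v2 (x : R) := if 0 < x then v (- x) else 0.
have mv1 : measurable_fun [set: measurableTypeR R] v1 by rewrite /v1; meas.
have mvN : measurable_fun [set: measurableTypeR R] (fun x : R => v (- x)).
  by apply: (measurableT_comp mv); meas.
have mv2 : measurable_fun [set: measurableTypeR R] v2 by rewrite /v2; meas.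
have v1N x : `|v1 x| <= N by rewrite /v1; case: ifP; rewrite ?normr0.
have v2N x : `|v2 x| <= N by rewrite /v2; case: ifP; rewrite ?normr0.
have v1ab x : v1 x != 0 -> a <= x <= b.
  by rewrite /v1; case: ifPn => [x0 /vab|]; rewrite ?eqxx// gtr0_norm.
have v2ab x : v2 x != 0 -> a <= x <= b.
  by rewrite /v2; case: ifPn => [x0 /vab|]; rewrite ?eqxx// normrN gtr0_norm.
have v1ab' x : v1 x != 0 -> a <= `|x| <= b.
  by move=> /v1ab/andP[ax xb]; rewrite ger0_norm ?ax ?xb// (le_trans (ltW a0)).
have v2ab' x : v2 x != 0 -> a <= `|x| <= b.
  by move=> /v2ab/andP[ax xb]; rewrite ger0_norm ?ax ?xb// (le_trans (ltW a0)).
have v1q : (\int[leb]_x (`|v1 x| `^ q)%:E <= (M `^ q)%:E)%E.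
  apply: le_trans vq; apply: ge0_le_integral => //.
  - by meas.
  - by meas.
  move=> x _; rewrite lee_fin /v1; case: ifP => // _.
  by rewrite normr0 powR0 ?gt_eqF// powR_ge0.
have v2q : (\int[leb]_x (`|v2 x| `^ q)%:E <= (M `^ q)%:E)%E.
  apply: le_trans vq.
  rewrite -(@ge0_integral_reflect _ (fun x => (`|v x| `^ q)%:E)); last 2 first.
  - by meas.
  - by move=> x; rewrite lee_fin; nneg.
  apply: ge0_le_integral => //.
  - by meas.
  - by meas.
  move=> x _; rewrite lee_fin /v2; case: ifP => // _.
  by rewrite normr0 powR0 ?gt_eqF// powR_ge0.
have B1 := positive_bound a0 M0 mv1 v1N v1ab v1q.
have B2 := positive_bound a0 M0 mv2 v2N v2ab v2q.
have i1 := integrable_weighted a0 mv1 v1N v1ab'.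
have i2 := integrable_weighted a0 mv2 v2N v2ab'.
have i := integrable_weighted a0 mv vN vab.
have mw2 := measurable_weighted mv2.
have i2N : leb.-integrable setT (EFin \o (fun x => weighted v2 (- x))).
  apply: (@integrable_bounded_support _ _ (- b) b ((a `^ sigma + b `^ sigma) * N)).
  - by apply: (measurableT_comp mw2); meas.
  - by move=> x; exact: weighted_bounded.
  - move=> x /(weighted_support v2ab')/andP[_]; by rewrite normrN ler_norml.
have Wsum : weighted v = fun x => weighted v1 x + weighted v2 (- x).
  apply/funext => x; rewrite /weighted /v1 /v2 opprK oppr_gt0 normrN.
  have [x0|x0|<-] := ltgtP 0 x; rewrite ?mulr0 ?addr0 ?add0r//.
  (* The origin belongs to neither half; the support condition excludes it because a > 0. *)
  rewrite (_ : v 0 = 0) ?mulr0//.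
  apply/eqP; apply: contraT => /vab; rewrite normr0 => /andP[a0' _].
  by move: a0'; rewrite leNgt a0.
have mo1 := measurable_oscn i1; have mo2 := measurable_oscn i2.
have mo2N : measurable_fun [set: RR] (fun y : RR => oscn (weighted v2) (- y.1, y.2)).
  have -> : (fun y : RR => oscn (weighted v2) (- y.1, y.2)) = oscn (fun x => weighted v2 (- x)).
    by apply/funext => y; rewrite oscn_reflect.
  exact: measurable_oscn.
have i' : leb.-integrable setT (EFin \o (fun x => weighted v1 x + weighted v2 (- x))) by rewrite -Wsum.
rewrite /line_constant; move: half_constant B1 B2 => hc B1 B2.
rewrite -mulrA -[2 * _ * _]mulrA.
have sum_le (y : RR) : oscn (weighted v) y <= 2 * (oscn (weighted v1) y + oscn (weighted v2) (- y.1, y.2)).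
  by rewrite Wsum -oscn_reflect//; exact: oscnD.
have mo : measurable_fun setT (oscn (weighted v)) by exact: measurable_oscn.
have o0 f (y : RR) : 0 <= oscn f y by exact: oscn_ge0.
refine (@ge0_integral_powR_sum2 _ _ _ _ _ _ _ p _ (ltW p0) mo mo1 mo2N (o0 _) (o0 _) (fun y => o0 _ (- y.1, y.2)) sum_le B1 _).
apply: le_trans B2; rewrite le_eqVlt; apply/orP; left; apply/eqP.
refine (ge0_integral_reflect1 _ (fun y => _)); last by rewrite lee_fin powR_ge0.
by apply/measurable_EFinP; exact: (measurableT_comp (@measurable_powR R p) mo2).
Qed.

End full_line.

(** * Complex-valued functions *)

Section complex_numbers.
Context {R : realType}.
Implicit Types z w : R[i].

Lemma ReD z w : complex.Re (z + w) = complex.Re z + complex.Re w.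
Proof. by case: z w => a b []. Qed.

Lemma ImD z w : complex.Im (z + w) = complex.Im z + complex.Im w.
Proof. by case: z w => a b []. Qed.

Lemma ReN z : complex.Re (- z) = - complex.Re z. Proof. by case: z. Qed.

Lemma ImN z : complex.Im (- z) = - complex.Im z. Proof. by case: z. Qed.

Lemma ReM z w : complex.Re (z * w) = complex.Re z * complex.Re w - complex.Im z * complex.Im w.
Proof. by case: z w => a b []. Qed.

Lemma ImM z w : complex.Im (z * w) = complex.Re z * complex.Im w + complex.Im z * complex.Re w.
Proof. by case: z w => a b []. Qed.

Lemma complex_eta z : z = complex.Re z +i* complex.Im z. Proof. by case: z. Qed.

Lemma normcE z : normc z = Num.sqrt (complex.Re z ^+ 2 + complex.Im z ^+ 2).
Proof. by case: z. Qed.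

Lemma normc_ge0 z : 0 <= normc z. Proof. by rewrite normcE sqrtr_ge0. Qed.

Lemma normc_sqr z : normc z ^+ 2 = complex.Re z ^+ 2 + complex.Im z ^+ 2.
Proof. by rewrite normcE sqr_sqrtr// addr_ge0 ?sqr_ge0. Qed.

Lemma norm_Re_le z : `|complex.Re z| <= normc z.
Proof.
rewrite -(@ler_pXn2r _ 2) ?nnegrE ?normc_ge0// normc_sqr real_normK ?num_real//.
by rewrite lerDl sqr_ge0.
Qed.

Lemma norm_Im_le z : `|complex.Im z| <= normc z.
Proof.
rewrite -(@ler_pXn2r _ 2) ?nnegrE ?normc_ge0// normc_sqr real_normK ?num_real//.
by rewrite lerDr sqr_ge0.
Qed.

Lemma normc_le_sum z : normc z <= `|complex.Re z| + `|complex.Im z|.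
Proof.
rewrite -(@ler_pXn2r _ 2) ?nnegrE ?normc_ge0 ?addr_ge0// normc_sqr sqrrD !real_normK ?num_real//.
by rewrite lerD2r lerDl mulrn_wge0// mulr_ge0.
Qed.

Lemma normc_real (x : R) : normc x%:C = `|x|.
Proof. by rewrite normcE/= expr0n addr0 sqrtr_sqr. Qed.

Lemma normc_expi (y : R) : normc (expi y) = 1.
Proof. by rewrite normcE/= cos2Dsin2 sqrtr1. Qed.

Lemma expiD (x y : R) : expi (x + y) = expi x * expi y.
Proof.
rewrite [RHS]complex_eta ReM ImM /= /expi cosD sinD.
by congr (_ +i* _); rewrite addrC.
Qed.

End complex_numbers.

Section complex_measurable.
Context d (T : measurableType d) (R : realType).
Implicit Types f g : T -> R[i].

Lemma cmeasurableM f g : cmeasurable f -> cmeasurable g -> cmeasurable (fun x => f x * g x).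
Proof.
move=> [f1 f2] [g1 g2]; split.
  by rewrite (_ : _ \o _ = fun x => complex.Re (f x) * complex.Re (g x) - complex.Im (f x) * complex.Im (g x));
    [meas|apply/funext => x /=; rewrite ReM].
by rewrite (_ : _ \o _ = fun x => complex.Re (f x) * complex.Im (g x) + complex.Im (f x) * complex.Re (g x));
  [meas|apply/funext => x /=; rewrite ImM].
Qed.

Lemma cmeasurableD f g : cmeasurable f -> cmeasurable g -> cmeasurable (fun x => f x + g x).
Proof.
move=> [f1 f2] [g1 g2]; split.
  by rewrite (_ : _ \o _ = fun x => complex.Re (f x) + complex.Re (g x));
    [meas|apply/funext => x /=; rewrite ReD].
by rewrite (_ : _ \o _ = fun x => complex.Im (f x) + complex.Im (g x));
  [meas|apply/funext => x /=; rewrite ImD].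
Qed.

Lemma cmeasurableN f : cmeasurable f -> cmeasurable (fun x => - f x).
Proof.
move=> [f1 f2]; split.
  by rewrite (_ : _ \o _ = fun x => - complex.Re (f x)); [meas|apply/funext => x /=; rewrite ReN].
by rewrite (_ : _ \o _ = fun x => - complex.Im (f x)); [meas|apply/funext => x /=; rewrite ImN].
Qed.

Lemma cmeasurableB f g : cmeasurable f -> cmeasurable g -> cmeasurable (fun x => f x - g x).
Proof. by move=> mf mg; apply: cmeasurableD => //; exact: cmeasurableN. Qed.

Lemma cmeasurable_real (f : T -> R) : measurable_fun setT f -> cmeasurable (fun x => (f x)%:C).
Proof. by move=> mf; split => //; exact: measurable_cst. Qed.

Lemma cmeasurable_expi (f : T -> R) : measurable_fun setT f -> cmeasurable (fun x => expi (f x)).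
Proof.
move=> mf; split.
  by rewrite (_ : _ \o _ = fun x => cos (f x)); [meas|apply/funext].
by rewrite (_ : _ \o _ = fun x => sin (f x)); [meas|apply/funext].
Qed.

Lemma cmeasurable_if (P : T -> bool) f : measurable_fun setT P -> cmeasurable f ->
  cmeasurable (fun x => if P x then f x else 0).
Proof.
move=> mP [f1 f2]; split.
  rewrite (_ : _ \o _ = fun x => if P x then complex.Re (f x) else 0); first exact: measurable_indic_bool.
  by apply/funext => x /=; case: ifP.
rewrite (_ : _ \o _ = fun x => if P x then complex.Im (f x) else 0); first exact: measurable_indic_bool.
by apply/funext => x /=; case: ifP.
Qed.

Lemma measurable_normc f : cmeasurable f -> measurable_fun setT (fun x => normc (f x)).
Proof.
move=> [f1 f2]; rewrite (_ : (fun _ => _) = fun x => (complex.Re (f x) ^+ 2 + complex.Im (f x) ^+ 2) `^ 2^-1).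
  by meas.
by apply/funext => x; rewrite normcE powR12_sqrt// addr_ge0 ?sqr_ge0.
Qed.

End complex_measurable.

Section complex_integral.
Context d (T : measurableType d) (R : realType) (mu : {measure set T -> \bar R}).
Implicit Types (f g : T -> R[i]).

Lemma cintegrable_le f (h : T -> R) : cmeasurable f -> mu.-integrable setT (EFin \o h) ->
  (forall x, normc (f x) <= h x) -> cintegrable mu f.
Proof.
move=> [f1 f2] ih fh; split; apply: le_integrable ih => //.
- by apply/measurable_EFinP.
- move=> x _ /=; rewrite lee_fin; apply: le_trans (norm_Re_le _) _.
  exact: le_trans (fh x) (ler_norm _).
- by apply/measurable_EFinP.
- move=> x _ /=; rewrite lee_fin; apply: le_trans (norm_Im_le _) _.
  exact: le_trans (fh x) (ler_norm _).
Qed.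

Lemma cintegrable_cmeasurable f : cintegrable mu f -> cmeasurable f.
Proof.
by move=> [i1 i2]; split; apply/measurable_EFinP; [exact: measurable_int i1|exact: measurable_int i2].
Qed.

Lemma integrable_normc f : cintegrable mu f -> mu.-integrable setT (EFin \o (fun x => normc (f x))).
Proof.
move=> cf; have mf := cintegrable_cmeasurable cf; have mn := measurable_normc mf.
case: cf => i1 i2.
have := integrableD measurableT (integrable_abse i1) (integrable_abse i2).
apply: le_integrable => //; first by apply/measurable_EFinP.
move=> x _ /=; rewrite ger0_norm ?normc_ge0//.
exact: (le_trans (normc_le_sum (f x)) (ler_norm _)).
Qed.

Lemma cintegrable_expiM (theta : T -> R) f : measurable_fun setT theta -> cintegrable mu f ->
  cintegrable mu (fun x => expi (theta x) * f x).
Proof.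
move=> mt cf; apply: (@cintegrable_le _ (fun x => normc (f x))).
- by apply: cmeasurableM; [exact: cmeasurable_expi|exact: cintegrable_cmeasurable].
- exact: integrable_normc.
- by move=> x; rewrite Normc.normcM normc_expi mul1r.
Qed.

Lemma cintegralZl (c : R[i]) f : cintegrable mu f ->
  cintegral mu (fun x => c * f x) = c * cintegral mu f.
Proof.
move=> [i1 i2].
have iZ (r : R) (h : T -> R) : mu.-integrable setT (EFin \o h) -> mu.-integrable setT (EFin \o (fun x => r * h x)).
  by move=> /(integrableZl measurableT r); apply: eq_integrable => // x _; rewrite /= EFinM.
rewrite [RHS]complex_eta ReM ImM /cintegral/=; congr (_ +i* _).
  rewrite -!RintegralZl// -RintegralB//; [|exact: iZ|exact: iZ].
  by apply: eq_Rintegral => x _ /=; rewrite ReM.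
rewrite -!RintegralZl// -RintegralD//; [|exact: iZ|exact: iZ].
by apply: eq_Rintegral => x _ /=; rewrite ImM.
Qed.

Lemma cintegralB f g : cintegrable mu f -> cintegrable mu g ->
  cintegral mu (fun x => f x - g x) = cintegral mu f - cintegral mu g.
Proof.
move=> [f1 f2] [g1 g2]; rewrite [RHS]complex_eta ReD ImD ReN ImN /cintegral/=.
rewrite -!RintegralB//; congr (_ +i* _); apply: eq_Rintegral => x _ /=.
  by rewrite ReD ReN.
by rewrite ImD ImN.
Qed.

Lemma eq_cintegral f g : f =1 g -> cintegral mu f = cintegral mu g.
Proof. by move=> /funext ->. Qed.

(** Limits are taken in the two real components. Convergence and domination are asked on one set A
    of full measure: later the points other than 0, or the points where a majorant is finite. *)
Lemma cdominated_convergence (A : T -> Prop) (F : nat -> T -> R[i]) f (h : T -> R) :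
  {ae mu, forall x, A x} ->
  (forall n, cmeasurable (F n)) -> cmeasurable f -> mu.-integrable setT (EFin \o h) ->
  (forall x, A x -> complex.Re (F n x) @[n --> \oo] --> complex.Re (f x)) ->
  (forall x, A x -> complex.Im (F n x) @[n --> \oo] --> complex.Im (f x)) ->
  (forall n x, A x -> normc (F n x) <= h x) ->
  [/\ cintegrable mu f,
      complex.Re (cintegral mu (F n)) @[n --> \oo] --> complex.Re (cintegral mu f) &
      complex.Im (cintegral mu (F n)) @[n --> \oo] --> complex.Im (cintegral mu f)].
Proof.
move=> aeA mF mf ih cRe cIm Fh.
have D (G : nat -> T -> R) (g : T -> R) : (forall n, measurable_fun setT (G n)) ->
    measurable_fun setT g -> (forall x, A x -> G n x @[n --> \oo] --> g x) ->
    (forall n x, A x -> `|G n x| <= h x) ->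
    mu.-integrable setT (EFin \o g) /\
    \int[mu]_x (G n x) @[n --> \oo] --> \int[mu]_x g x.
  move=> mG mg cG Gh.
  have cGe : {ae mu, forall x, setT x -> (G n x)%:E @[n --> \oo] --> (g x)%:E}.
    by apply: filterS aeA => x Ax _; apply: cvg_EFin; [apply: nearW|exact: cG].
  have bGe : {ae mu, forall x n, setT x -> (`|(G n x)%:E| <= (h x)%:E)%E}.
    by apply: filterS aeA => x Ax n _; exact: Gh.
  have [ig _ cv] := @dominated_convergence _ _ _ mu setT measurableT (fun n x => (G n x)%:E)
    (EFin \o g) (EFin \o h) (fun n => proj2 (measurable_EFinP _ _) (mG n)) (proj2 (measurable_EFinP _ _) mg)
    cGe ih bGe.
  split => //; apply: fine_cvg; rewrite fineK; first exact: cv.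
  exact: integrable_fin_num.
have [i1 c1] := D _ _ (fun n => (mF n).1) mf.1 cRe (fun n x Ax => le_trans (norm_Re_le _) (Fh n x Ax)).
have [i2 c2] := D _ _ (fun n => (mF n).2) mf.2 cIm (fun n x Ax => le_trans (norm_Im_le _) (Fh n x Ax)).
by split.
Qed.

End complex_integral.

Section complex_Fubini.
Context d1 d2 (T1 : measurableType d1) (T2 : measurableType d2) (R : realType).
Variables (m1 : {sigma_finite_measure set T1 -> \bar R}) (m2 : {sigma_finite_measure set T2 -> \bar R}).

Lemma cFubini (F : T1 * T2 -> R[i]) : cintegrable (m1 \x m2)%E F ->
  cintegral m1 (fun x => cintegral m2 (fun y => F (x, y))) =
  cintegral m2 (fun y => cintegral m1 (fun x => F (x, y))).
Proof.
by move=> [i1 i2]; rewrite /cintegral; congr (_ +i* _); [exact: (RFubini i1)|exact: (RFubini i2)].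
Qed.

End complex_Fubini.

(** * Extension of complex densities *)

Section wave.
Context {R : realType}.
Local Notation leb := (@lebesgue_measure R).
Local Notation leb2 := (leb \x leb)%E.
Local Notation RR := (measurableTypeR R * measurableTypeR R)%type.
Variables (alpha p : R).
Hypotheses (alpha0 : 0 < alpha) (alpha1 : alpha - 1 != 0) (p2 : 0 < p - 2).

Let sigma : R := (alpha - 2) / (2 * p).
Let q : R := 2 * p / (2 * p - 3).

Let p0 : 0 < p.
Proof. by rewrite (lt_trans p2)// gtrBl. Qed.

Let p23 : 0 < 2 * p - 3.
Proof.
rewrite (_ : 2 * p - 3 = (p - 2) + (p - 1)); last by ring.
by rewrite addr_gt0// (lt_trans p2)// ltrD2l ltrN2 ltr1n.
Qed.

Let q0 : 0 < q. Proof. by rewrite divr_gt0// mulr_gt0. Qed.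

(** The function of (x, t) that |D|^sigma U(t) phi is when the Fourier transform of phi is w. *)
Definition cwave (w : R -> R[i]) (y : RR) : R[i] :=
  cintegral leb (fun xi => expi (y.1 * xi - y.2 * `|xi| `^ alpha) * ((`|xi| `^ sigma)%:C * w xi)).

(** A bounded density supported away from 0 and infinity: the weighted integrals converge absolutely
    whatever the sign of sigma. The estimates below do not depend on a, b and N. *)
Definition annular (w : R -> R[i]) : Prop :=
  cmeasurable (w : measurableTypeR R -> R[i]) /\
  exists a b N : R, [/\ 0 < a, forall x, normc (w x) <= N & forall x, w x != 0 -> a <= `|x| <= b].

Section one_wave.
Variable w : R -> R[i].
Hypothesis aw : annular w.

Let wr (x : R) : R := complex.Re (w x).
Let wi (x : R) : R := complex.Im (w x).

Lemma cintegrable_annular : cintegrable leb (fun xi => (`|xi| `^ sigma)%:C * w xi).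
Proof.
case: aw => -[mr mi] [a [b [N [a0 wN wab]]]].
have E1 : complex.Re (R:=R) \o (fun xi => (`|xi| `^ sigma)%:C * w xi) = weighted alpha p wr.
  by apply/funext => x; rewrite /= ReM/= mul0r subr0.
have E2 : complex.Im (R:=R) \o (fun xi => (`|xi| `^ sigma)%:C * w xi) = weighted alpha p wi.
  by apply/funext => x; rewrite /= ImM/= mul0r addr0.
rewrite /cintegrable E1 E2; split.
- apply: (integrable_weighted alpha p a0 mr (N := N)).
    by move=> x; apply: le_trans (norm_Re_le _) (wN x).
  by move=> x wx; apply: wab; apply: contraNneq wx => /= ->.
- apply: (integrable_weighted alpha p a0 mi (N := N)).
    by move=> x; apply: le_trans (norm_Im_le _) (wN x).
  by move=> x wx; apply: wab; apply: contraNneq wx => /= ->.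
Qed.

Let ir : leb.-integrable setT (EFin \o weighted alpha p wr).
Proof.
have [+ _] := cintegrable_annular; apply: eq_integrable => // x _.
by rewrite /= ReM/= mul0r subr0.
Qed.

Let ii : leb.-integrable setT (EFin \o weighted alpha p wi).
Proof.
have [_ +] := cintegrable_annular; apply: eq_integrable => // x _.
by rewrite /= ImM/= mul0r addr0.
Qed.

Let phase (x : R) : R := `|x| `^ alpha.

Let mphase (y : RR) : measurable_fun [set: measurableTypeR R] (fun x : R => y.1 * x - y.2 * `|x| `^ alpha).
Proof. by meas. Qed.

Let mcos (y : RR) : measurable_fun [set: measurableTypeR R] (fun x : R => cos (y.1 * x - y.2 * `|x| `^ alpha)).
Proof. exact: (measurableT_comp measurable_cos (mphase y)). Qed.

Let msin (y : RR) : measurable_fun [set: measurableTypeR R] (fun x : R => sin (y.1 * x - y.2 * `|x| `^ alpha)).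
Proof. exact: (measurableT_comp measurable_sin (mphase y)). Qed.

Lemma Re_cwave y : complex.Re (cwave w y) =
  oscC leb id phase (weighted alpha p wr) y - oscS leb id phase (weighted alpha p wi) y.
Proof.
rewrite /oscC /oscS -RintegralB//; last 2 first.
- by apply: integrable_bddM ir; [exact: mcos|move=> x; exact: norm_cos_le1].
- by apply: integrable_bddM ii; [exact: msin|move=> x; exact: norm_sin_le1].
by apply: eq_Rintegral => x _; rewrite /= !(ReM, ImM)/= /weighted /phase; ring.
Qed.

Lemma Im_cwave y : complex.Im (cwave w y) =
  oscC leb id phase (weighted alpha p wi) y + oscS leb id phase (weighted alpha p wr) y.
Proof.
rewrite /oscC /oscS -RintegralD//; last 2 first.
- by apply: integrable_bddM ii; [exact: mcos|move=> x; exact: norm_cos_le1].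
- by apply: integrable_bddM ir; [exact: msin|move=> x; exact: norm_sin_le1].
by apply: eq_Rintegral => x _; rewrite /= !(ReM, ImM)/= /weighted /phase; ring.
Qed.

Lemma cmeasurable_cwave : cmeasurable (cwave w).
Proof.
have mid : measurable_fun [set: measurableTypeR R] (fun x : R => x) by exact: measurable_id.
have mpw : measurable_fun [set: measurableTypeR R] phase by rewrite /phase; meas.
have m1 := @measurable_oscC _ _ _ leb _ _ _ mid mpw ir.
have m2 := @measurable_oscS _ _ _ leb _ _ _ mid mpw ir.
have m3 := @measurable_oscC _ _ _ leb _ _ _ mid mpw ii.
have m4 := @measurable_oscS _ _ _ leb _ _ _ mid mpw ii.
split.
  rewrite (_ : _ \o _ = fun y => oscC leb id phase (weighted alpha p wr) y - oscS leb id phase (weighted alpha p wi) y).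
    exact: measurable_funB.
  by apply/funext => y; exact: Re_cwave.
rewrite (_ : _ \o _ = fun y => oscC leb id phase (weighted alpha p wi) y + oscS leb id phase (weighted alpha p wr) y).
  exact: measurable_funD.
by apply/funext => y; exact: Im_cwave.
Qed.

Definition wave_constant : R := 4 `^ p * (2 * line_constant alpha p).

Lemma cwave_bound (M : R) : 0 < M -> (\int[leb]_x (normc (w x) `^ q)%:E <= (M `^ q)%:E)%E ->
  (\int[leb2]_y (normc (cwave w y) `^ (2 * p))%:E <= (wave_constant * M `^ (2 * p))%:E)%E.
Proof.
move=> M0 wq; have mc := measurable_normc cmeasurable_cwave.
case: aw => -[mr mi] [a [b [N [a0 wN wab]]]].
have mn : measurable_fun [set: measurableTypeR R] (fun x => normc (w x)) by exact: measurable_normc.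
have ler (x : R) : `|wr x| <= normc (w x) by exact: norm_Re_le.
have lei (x : R) : `|wi x| <= normc (w x) by exact: norm_Im_le.
have part (v : R -> R) : measurable_fun [set: measurableTypeR R] v -> (forall x, `|v x| <= normc (w x)) ->
   (\int[leb2]_y (oscn alpha (weighted alpha p v) y `^ p)%:E <= (line_constant alpha p * M `^ (2 * p))%:E)%E.
  move=> mv vw; apply: (real_bound alpha0 alpha1 p2 a0 M0 mv (N := N) (b := b)).
  - by move=> x; exact: le_trans (vw x) (wN x).
  - move=> x vx; apply: wab; apply: contraNneq vx => wx.
    by have := vw x; rewrite wx Normc.normc0 normr_le0.
  apply: le_trans wq; apply: ge0_le_integral => //.
  - by meas.
  - by meas.
  move=> x _; rewrite lee_fin ge0_ler_powR ?nnegrE ?normc_ge0//; exact: ltW.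
have P1 := part _ mr ler; have P2 := part _ mi lei.
have -> : (\int[leb2]_y (normc (cwave w y) `^ (2 * p))%:E = \int[leb2]_y ((normc (cwave w y) ^+ 2) `^ p)%:E)%E.
  by apply: eq_integral => y _; rewrite -powR_mulrn ?normc_ge0// -powRrM.
rewrite /wave_constant; move: (line_constant alpha p) P1 P2 => lc P1 P2.
rewrite -mulrA -[2 * _ * _]mulrA.
have mo1 := measurable_oscn alpha ir; have mo2 := measurable_oscn alpha ii.
have mW : measurable_fun setT (fun y => normc (cwave w y) ^+ 2).
  by apply: measurable_funX.
have sum_le (y : RR) : normc (cwave w y) ^+ 2 <= 2 * (oscn alpha (weighted alpha p wr) y + oscn alpha (weighted alpha p wi) y).
  (* Each component mixes a cosine integral of one part of w with a sine integral of the other; the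
     parallelogram identity separates the two parts. *)
  rewrite normc_sqr Re_cwave Im_cwave /oscn -/phase.
  move: (oscC _ _ _ _ _) (oscC _ _ _ _ _) (oscS _ _ _ _ _) (oscS _ _ _ _ _) => c1 c2 s1 s2.
  rewrite -subr_ge0 (_ : _ - _ = (c2 + s2) ^+ 2 + (c1 - s1) ^+ 2); last by ring.
  by nneg.
refine (@ge0_integral_powR_sum2 _ _ _ _ _ _ _ p _ (ltW p0) mW mo1 mo2 (fun y => sqr_ge0 _)
  (oscn_ge0 _ _) (oscn_ge0 _ _) sum_le P1 P2).
Qed.

(** Fubini's theorem moves the pairing to the frequency side, where the test function enters through
    its inverse Fourier transform, as in [dinv_fourier]. *)
Lemma cwave_pairing (psi : R -> R[i]) (t : R) : cintegrable leb psi ->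
  cintegral leb (fun x => cwave w (x, t) * psi x) =
  cintegral leb (fun xi => ((`|xi| `^ sigma)%:C * (expi (- (t * `|xi| `^ alpha)) * w xi)) * inv_fourier psi xi).
Proof.
move=> ipsi; have iw := cintegrable_annular.
pose W (xi : R) := (`|xi| `^ sigma)%:C * w xi.
pose F (z : RR) : R[i] := psi z.1 * (expi (z.1 * z.2 - t * `|z.2| `^ alpha) * W z.2).
have mpsi := cintegrable_cmeasurable ipsi; have mW := cintegrable_cmeasurable iw.
have mexp : cmeasurable (fun z : RR => expi (z.1 * z.2 - t * `|z.2| `^ alpha)).
  by apply: cmeasurable_expi; meas.
have mF : cmeasurable F.
  apply: cmeasurableM.
    by case: mpsi => m1 m2; split; [exact: (measurableT_comp m1 measurable_fst)|exact: (measurableT_comp m2 measurable_fst)].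
  apply: cmeasurableM => //.
  by case: mW => m1 m2; split; [exact: (measurableT_comp m1 measurable_snd)|exact: (measurableT_comp m2 measurable_snd)].
have iF : cintegrable leb2 F.
  apply: (@cintegrable_le _ _ _ _ _ (fun z : RR => normc (psi z.1) * normc (W z.2)) mF).
    exact: (integrable_tensor (integrable_normc ipsi) (integrable_normc iw)).
  by move=> z; rewrite /F !Normc.normcM normc_expi mul1r.
have iexpW (x : R) : cintegrable leb (fun xi => expi (x * xi - t * `|xi| `^ alpha) * W xi).
  by apply: cintegrable_expiM => //; meas.
have iexppsi (xi : R) : cintegrable leb (fun x => expi (xi * x) * psi x).
  by apply: cintegrable_expiM => //; meas.
transitivity (cintegral leb (fun x => cintegral leb (fun xi => F (x, xi)))).
  apply: eq_cintegral => x; rewrite /F/= cintegralZl; last exact: iexpW.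
  by rewrite mulrC.
rewrite (cFubini iF); apply: eq_cintegral => xi.
transitivity (cintegral leb (fun x => (expi (- (t * `|xi| `^ alpha)) * W xi) * (expi (xi * x) * psi x))).
  apply: eq_cintegral => x; rewrite /F/= expiD (mulrC x xi).
  by move: (expi _) (expi _) (W xi) (psi x) => e1 e2 w1 w2; ring.
rewrite cintegralZl; last exact: iexppsi.
by rewrite /inv_fourier /W; congr (_ * _); rewrite mulrCA.
Qed.

End one_wave.
End wave.

(** * Decomposition into annular pieces *)

Section annular_approximation.
Context {R : realType}.
Local Notation leb := (@lebesgue_measure R).

Lemma annular0 : annular (fun _ : R => 0 : R[i]).
Proof.
split; first by split; exact: measurable_cst.
exists 1, 1, 0; split => // x; first by rewrite Normc.normc0.
by rewrite eqxx.
Qed.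

Lemma annularB (v w : R -> R[i]) : annular v -> annular w -> annular (fun x => v x - w x).
Proof.
move=> [mv [a [b [N [a0 vN vab]]]]] [mw [a' [b' [N' [a0' wN wab]]]]].
split; first exact: (cmeasurableB (mv : cmeasurable (v : measurableTypeR R -> R[i])) mw).
exists (Num.min a a'), (Num.max b b'), (N + N'); split.
- by rewrite lt_min a0.
- move=> x; apply: le_trans (le_normcD _ _) _.
  by rewrite normcN lerD.
- move=> x; rewrite ge_min le_max; have [->|vx _] := eqVneq (v x) 0.
    by rewrite sub0r oppr_eq0 => /wab/andP[-> ->]; rewrite !orbT.
  by have /andP[-> ->] := vab x vx.
Qed.

Variables (q : R) (h : R -> R[i]).
Hypotheses (q0 : 0 < q) (mh : cmeasurable (h : measurableTypeR R -> R[i])).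
Hypothesis ih : leb.-integrable setT (EFin \o (fun x => normc (h x) `^ q)).

Definition truncate (n : nat) (x : R) : R[i] :=
  if [&& n.+1%:R^-1 <= `|x|, `|x| <= n.+1%:R & normc (h x) <= n.+1%:R] then h x else 0.

Lemma annular_truncate n : annular (truncate n).
Proof.
have mn : measurable_fun [set: measurableTypeR R] (fun x => normc (h x)) by exact: measurable_normc.
split; first by apply: cmeasurable_if => //; meas.
exists n.+1%:R^-1, n.+1%:R, n.+1%:R; split => //.
- by move=> x; rewrite /truncate; case: ifP => [/and3P[]//|_]; rewrite Normc.normc0.
- by move=> x; rewrite /truncate; case: ifP => [/and3P[-> ->]//|_]; rewrite eqxx.
Qed.

Lemma truncate_eventually (x : R) : x != 0 -> exists n0, forall n, (n0 <= n)%N -> truncate n x = h x.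
Proof.
move=> x0; have nx0 : 0 < `|x| by rewrite normr_gt0.
pose B := `|x|^-1 + `|x| + normc (h x).
have B0 : 0 <= B by rewrite !addr_ge0 ?invr_ge0 ?normc_ge0.
exists (Num.bound B) => n Bn; rewrite /truncate.
have BltN : B < n.+1%:R.
  by apply: (lt_trans (archi_boundP B0)); rewrite ltr_nat ltnS.
rewrite ifT//; apply/and3P; split.
- rewrite -[leRHS]invrK lef_pV2 ?posrE ?invr_gt0//.
  by apply: le_trans (ltW BltN); rewrite /B -addrA lerDl addr_ge0 ?normc_ge0.
- by apply: le_trans (ltW BltN); rewrite /B addrAC lerDr addr_ge0 ?normc_ge0 ?invr_ge0.
- by apply: le_trans (ltW BltN); rewrite /B lerDr addr_ge0 ?invr_ge0.
Qed.

Lemma normc_truncate_le n x : normc (truncate n x) <= normc (h x).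
Proof. by rewrite /truncate; case: ifP => // _; rewrite Normc.normc0 normc_ge0. Qed.

Lemma ae_neq0 : {ae leb, forall x : R, x != 0}.
Proof.
exists [set 0]; split => //; first exact: lebesgue_measure_set1.
by move=> x /= /negP; rewrite negbK => /eqP.
Qed.

(** The tail is dominated by |h|^q and is eventually 0 at each x other than 0. The condition k <= n
    ensures that the indices chosen later tend to infinity. *)
Lemma truncate_tail (eps : R) (k : nat) : 0 < eps ->
  exists n, (k <= n)%N /\ (\int[leb]_x (normc (h x - truncate n x) `^ q)%:E <= eps%:E)%E.
Proof.
move=> eps0.
pose F n x : R := normc (h x - truncate n x) `^ q.
have mt n : cmeasurable (truncate n : measurableTypeR R -> R[i]) by have [] := annular_truncate n.
have mF n : measurable_fun [set: measurableTypeR R] (F n).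
  have mhg := measurable_normc (cmeasurableB (mh : cmeasurable (h : measurableTypeR R -> R[i])) (mt n)).
  exact: (measurableT_comp (@measurable_powR R q) mhg).
have Fh n x : F n x <= normc (h x) `^ q.
  rewrite /F ge0_ler_powR ?nnegrE ?normc_ge0 ?(ltW q0)// /truncate.
  by case: ifP => _; rewrite ?subr0// subrr Normc.normc0 normc_ge0.
have F0 n x : 0 <= F n x by exact: powR_ge0.
have cF x : x != 0 -> F n x @[n --> \oo] --> 0.
  move=> /truncate_eventually[n0 hn0].
  apply: cvg_near_cst; exists n0 => // n /= n0n.
  by apply/eqP; rewrite /F hn0// subrr Normc.normc0 powR0// gt_eqF.
have Fnh n x : normc (F n x)%:C <= normc (h x) `^ q by rewrite normc_real ger0_norm.
have [_ cv _] := @cdominated_convergence _ (measurableTypeR R) R leb (fun x => x != 0) (fun n x => (F n x)%:C) (fun=> 0) _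
  ae_neq0 (fun n => cmeasurable_real (mF n)) (conj (measurable_cst _) (measurable_cst _)) ih cF (fun x _ => cvg_cst _)
  (fun n x _ => Fnh n x).
have {}cv : \int[leb]_x (F n x) @[n --> \oo] --> 0.
  have R0 : \int[leb]_x (0 : R) = 0 by rewrite /Rintegral integral0.
  by rewrite -[X in _ --> X]R0; exact: cv.
have /cvgrPdist_le/(_ _ eps0)[n0 _ Hn] := cv.
have iF n : leb.-integrable setT (EFin \o F n).
  apply: le_integrable ih => //; first by apply/measurable_EFinP; exact: mF.
  by move=> x _ /=; rewrite lee_fin !ger0_norm ?powR_ge0.
exists (maxn k n0); split; first exact: leq_maxl.
have := Hn (maxn k n0) (leq_maxr _ _); rewrite /= sub0r normrN => Hn'.
rewrite -(@fineK _ (\int[leb]_x _)%E); last exact: (integrable_fin_num measurableT (iF _)).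
rewrite lee_fin; apply: le_trans Hn'; exact: ler_norm.
Qed.

Variable M : R.
Hypothesis M0 : 0 < M.
Hypothesis hM : (\int[leb]_x (normc (h x) `^ q)%:E <= (M `^ q)%:E)%E.

(** Truncations are selected along indices with rapidly decreasing tails. As G 0 = 0, the first
    difference costs the full norm M, and every later one is controlled by tails. *)
Lemma annular_decomposition : exists G : nat -> R -> R[i],
  [/\ G 0%N = (fun=> 0), forall k, annular (G k),
     forall k x, normc (G k x) <= normc (h x),
     forall x, x != 0 -> exists k0, forall k, (k0 <= k)%N -> G k x = h x &
     forall k, (\int[leb]_x (normc (G k.+1 x - G k x)%R `^ q)%:E <= ((4^-1 ^+ k * M) `^ q)%:E)%E].
Proof.
pose m k : R := (4^-1 ^+ k * M) `^ q.
have m0 k : 0 < m k by rewrite powR_gt0// mulr_gt0// exprn_gt0// invr_gt0.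
have mS k : m k.+1 <= m k.
  rewrite /m ge0_ler_powR ?nnegrE ?mulr_ge0 ?exprn_ge0 ?invr_ge0 ?(ltW M0) ?(ltW q0)//.
  by rewrite ler_wpM2r ?(ltW M0)// exprS ler_piMl ?exprn_ge0 ?invr_ge0// invf_le1// ler1n.
(* Half of the next budget is allotted to each tail: the difference of the truncations at N k.+1 and
   N k is bounded by two tails, of size m k.+2 / 2 and m k.+1 / 2. *)
have tails k : exists n, (k <= n)%N /\
    (\int[leb]_x (normc (h x - truncate n x) `^ q)%:E <= (m k.+1 / 2)%:E)%E.
  by apply: truncate_tail; rewrite divr_gt0.
have [N hN] := choice tails.
pose G k : R -> R[i] := if k is k'.+1 then truncate (N k') else fun=> 0.
have aG k : annular (G k) by case: k => [|k]; [exact: annular0|exact: annular_truncate].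
exists G; split => //.
- by case=> [|k] x; [rewrite -[G 0%N x]/(0 : R[i]) Normc.normc0 normc_ge0|exact: normc_truncate_le].
- move=> x /truncate_eventually[n0 hn0]; exists n0.+1; case=> // k n0k.
  by apply: hn0; apply: leq_trans (hN k).1.
have mG k : cmeasurable (G k : measurableTypeR R -> R[i]) by have [] := aG k.
have mhG k : measurable_fun [set: measurableTypeR R] (fun x => normc (h x - G k x)).
  exact: (measurable_normc (cmeasurableB (mh : cmeasurable (h : measurableTypeR R -> R[i])) (mG k))).
have mGG k : measurable_fun [set: measurableTypeR R] (fun x => normc (G k.+1 x - G k x)).
  exact: (measurable_normc (cmeasurableB (mG k.+1) (mG k))).
have mnh : measurable_fun [set: measurableTypeR R] (fun x => normc (h x)) by exact: measurable_normc.
case=> [|k].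
  rewrite expr0 mul1r; apply: le_trans hM; apply: ge0_le_integral => //.
  - by move=> x _; rewrite lee_fin powR_ge0.
  - by have := mGG 0%N => ?; meas.
  - by meas.
  move=> x _; rewrite lee_fin subr0 ge0_ler_powR ?nnegrE ?normc_ge0 ?(ltW q0)//.
  exact: normc_truncate_le.
apply: (@le_trans _ _ (\int[leb]_x ((normc (h x - truncate (N k.+1) x) `^ q)%:E + (normc (h x - truncate (N k) x) `^ q)%:E))%E).
  have m1 := mhG k.+1; have m2 := mhG k.+2; have m3 := mGG k.+1.
  apply: ge0_le_integral => //.
  - by move=> x _; rewrite lee_fin powR_ge0.
  - by meas.
  - by apply: emeasurable_funD; meas.
  (* A difference of two truncations of h is 0, h or -h at each point, and where it is not 0 one of
     the tails equals h; so the q-th powers add without a constant. *)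
  move=> x _; rewrite -EFinD lee_fin /= /truncate.
  case: ifP => _; case: ifP => _; rewrite ?subrr ?subr0 ?sub0r ?normcN ?Normc.normc0 ?(powR0 (lt0r_neq0 q0));
    rewrite ?addr0 ?add0r ?lexx//.
  by rewrite addr_ge0 ?powR_ge0.
have m1 := mhG k.+1; have m2 := mhG k.+2.
rewrite ge0_integralD//; last 4 first.
- by move=> x _; rewrite lee_fin powR_ge0.
- by meas.
- by move=> x _; rewrite lee_fin powR_ge0.
- by meas.
apply: (@le_trans _ _ ((m k.+2 / 2)%:E + (m k.+1 / 2)%:E)%E).
  by apply: leeD; [exact: (hN k.+1).2|exact: (hN k).2].
rewrite -EFinD lee_fin -/(m k.+1) [leRHS]splitr lerD2r.
by rewrite ler_wpM2r ?invr_ge0.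
Qed.

End annular_approximation.

Section geometric_sums.
Context {R : realType}.

Lemma cvg_telescope_geometric (a : nat -> R) (s : R) : 0 <= s ->
  (forall k, 2 ^+ k * `|a k.+1 - a k| <= s) -> cvgn a.
Proof.
move=> s0 ha.
have c : cvgn (series (telescope a)).
  apply: normed_cvg; apply: (@series_le_cvg _ _ (geometric s 2^-1)).
  - by move=> n /=; exact: normr_ge0.
  - by move=> n /=; rewrite mulr_ge0// exprn_ge0.
  - move=> n; rewrite /telescope /geometric/= exprVn ler_pdivlMr ?exprn_gt0//.
    by rewrite mulrC.
  - apply: is_cvg_geometric_series; rewrite ger0_norm//.
    by rewrite invf_lt1// ltr1n.
rewrite telescopeK in c.
rewrite (_ : a = (fun n => a n - a 0%N + a 0%N)); last by apply/funext => n; rewrite subrK.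
by apply: is_cvgD => //; exact: is_cvg_cst.
Qed.

Lemma telescope_geometric_bound (a : nat -> R[i]) (s : R) : a 0%N = 0 ->
  (forall k, 2 ^+ k * normc (a k.+1 - a k) <= s) -> forall k, normc (a k) <= 2 * s.
Proof.
move=> a0 ha k.
have s0 : 0 <= s by apply: le_trans (ha 0%N); rewrite expr0 mul1r normc_ge0.
apply: (@le_trans _ _ (2 * (1 - 2^-1 ^+ k) * s)); last first.
  by rewrite ler_wpM2r// ler_piMr// lerBlDr lerDl exprn_ge0.
elim: k => [|k IH]; first by rewrite a0 Normc.normc0 expr0 subrr mulr0 mul0r.
rewrite -(subrK (a k) (a k.+1)); apply: le_trans (le_normcD _ _) _.
have h : normc (a k.+1 - a k) <= 2^-1 ^+ k * s.
  by rewrite exprVn mulrC ler_pdivlMr ?exprn_gt0// mulrC.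
apply: (le_trans (lerD h IH)); rewrite exprS le_eqVlt; apply/orP; left; apply/eqP.
by field.
Qed.

Lemma nneseries_geometric (r : R) :
  (\sum_(k <oo) (r / 2 ^+ k.+1)%:E = r%:E)%E.
Proof.
have := @cvg_geometric_eseries_half R r 0; rewrite expr0 divr1 => /cvg_lim <- //.
congr (limn _); apply/funext => n; rewrite /eseries/=; apply: eq_bigr => k _.
by rewrite addn1 natrX.
Qed.

Lemma cvg_Re_mul (a : nat -> R[i]) (l c : R[i]) :
  complex.Re (a k) @[k --> \oo] --> complex.Re l -> complex.Im (a k) @[k --> \oo] --> complex.Im l ->
  complex.Re (a k * c) @[k --> \oo] --> complex.Re (l * c).
Proof.
move=> aR aI; rewrite ReM; under eq_fun do rewrite ReM.
by apply: cvgB; apply: cvgMl.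
Qed.

Lemma cvg_Im_mul (a : nat -> R[i]) (l c : R[i]) :
  complex.Re (a k) @[k --> \oo] --> complex.Re l -> complex.Im (a k) @[k --> \oo] --> complex.Im l ->
  complex.Im (a k * c) @[k --> \oo] --> complex.Im (l * c).
Proof.
move=> aR aI; rewrite ImM; under eq_fun do rewrite ImM.
by apply: cvgD; apply: cvgMl.
Qed.

End geometric_sums.

(** * Almost everywhere limit of the extensions *)

Section wave_limit.
Context {R : realType}.
Local Notation leb := (@lebesgue_measure R).
Local Notation leb2 := (leb \x leb)%E.
Local Notation RR := (measurableTypeR R * measurableTypeR R)%type.
Variables (alpha p : R).
Hypotheses (alpha0 : 0 < alpha) (alpha1 : alpha - 1 != 0) (p2 : 0 < p - 2).

Let sigma : R := (alpha - 2) / (2 * p).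
Let q : R := 2 * p / (2 * p - 3).
Let Q : R := 2 * p.

Let p0 : 0 < p.
Proof. by rewrite (lt_trans p2)// gtrBl. Qed.

Let p23 : 0 < 2 * p - 3.
Proof.
rewrite (_ : 2 * p - 3 = (p - 2) + (p - 1)); last by ring.
by rewrite addr_gt0// (lt_trans p2)// ltrD2l ltrN2 ltr1n.
Qed.

Let q0 : 0 < q. Proof. by rewrite divr_gt0// mulr_gt0. Qed.

Let Q0 : 0 < Q. Proof. by rewrite mulr_gt0. Qed.

Let Q1 : 1 <= Q.
Proof.
rewrite -subr_ge0 (_ : Q - 1 = (2 * p - 3) + 2); last by rewrite /Q; ring.
by rewrite addr_ge0// ltW.
Qed.

Lemma cwaveB (v w : R -> R[i]) y : annular v -> annular w ->
  cwave alpha p (fun x => v x - w x) y = cwave alpha p v y - cwave alpha p w y.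
Proof.
move=> av aw; rewrite /cwave -cintegralB; last 2 first.
- by apply: cintegrable_expiM; [meas|exact: cintegrable_annular].
- by apply: cintegrable_expiM; [meas|exact: cintegrable_annular].
by apply: eq_cintegral => x; rewrite !mulrBr.
Qed.

Lemma cwave0 y : cwave alpha p (fun=> 0) y = 0.
Proof.
rewrite /cwave (_ : (fun xi => _) = (fun=> 0)); last by apply/funext => x; rewrite !mulr0.
by rewrite /cintegral /Rintegral/= !integral0_eq.
Qed.

Variables (h : R -> R[i]) (M : R) (G : nat -> R -> R[i]).
Hypotheses (M0 : 0 < M) (mh : cmeasurable (h : measurableTypeR R -> R[i])).
Hypotheses (G0 : G 0%N = (fun=> 0)) (aG : forall k, annular (G k)).
Hypothesis Gh : forall k x, normc (G k x) <= normc (h x).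
Hypothesis Gcvg : forall x, x != 0 -> exists k0, forall k, (k0 <= k)%N -> G k x = h x.
Hypothesis Gq : forall k,
  (\int[leb]_x (normc (G k.+1 x - G k x)%R `^ q)%:E <= ((4^-1 ^+ k * M) `^ q)%:E)%E.

Let D (k : nat) (x : R) : R[i] := G k.+1 x - G k x.

Let aD k : annular (D k). Proof. exact: annularB. Qed.

Let K := wave_constant alpha p.

Let K0 : 0 <= K.
Proof.
have := cwave_bound alpha0 alpha1 p2 (aD 0) (mulr_gt0 _ M0) (Gq 0).
rewrite expr0 => /(_ ltr01); rewrite mul1r => H.
rewrite -(@pmulr_lge0 _ (M `^ (2 * p))) ?powR_gt0// -lee_fin.
by apply: le_trans H; apply: integral_ge0 => y _; rewrite lee_fin powR_ge0.
Qed.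

(* D k has norm at most 4^-k M, so the weighted terms are still summable, and the factor
   2^k makes the differences themselves summable wherever S is finite. *)
Let term (k : nat) (y : RR) : \bar R := ((2 ^+ k * normc (cwave alpha p (D k) y)) `^ Q)%:E.

Let mterm k : measurable_fun setT (term k).
Proof.
have mc := measurable_normc (cmeasurable_cwave alpha p (aD k)).
by rewrite /term; meas.
Qed.

Let term_ge0 k y : (0 <= term k y)%E. Proof. by rewrite lee_fin powR_ge0. Qed.

Let S (y : RR) : \bar R := (\sum_(k <oo) term k y)%E.

Let mS : measurable_fun setT S.
Proof. by apply: ge0_emeasurable_sum => //; move=> k y _ _; exact: term_ge0. Qed.

Let S_ge0 y : (0 <= S y)%E.
Proof. by apply: nneseries_ge0 => k _ _; exact: term_ge0. Qed.

(** The k-th term contributes at most K (2^k 4^-k M)^Q, and (2^-k)^Q <= 2^-k because Q >= 1; the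
    geometric series has sum 2. *)
Let int_S : (\int[leb2]_y S y <= (2 * (K * M `^ Q))%:E)%E.
Proof.
rewrite integral_nneseries//.
rewrite -(nneseries_geometric (2 * (K * M `^ Q))).
apply: lee_nneseries => [k _ _|k _]; first by apply: integral_ge0 => y _; exact: term_ge0.
have mc := measurable_normc (cmeasurable_cwave alpha p (aD k)).
have k4 : 0 < 4^-1 ^+ k :> R by rewrite exprn_gt0// invr_gt0.
have H := cwave_bound alpha0 alpha1 p2 (aD k) (mulr_gt0 k4 M0) (Gq k).
have -> : (\int[leb2]_y term k y = ((2 ^+ k) `^ Q)%:E * \int[leb2]_y (normc (cwave alpha p (D k) y) `^ Q)%:E)%E.
  rewrite -ge0_integralZl//; last 2 first.
  - by meas.
  - by move=> y _; rewrite lee_fin powR_ge0.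
  by apply: eq_integral => y _; rewrite /term powRM ?exprn_ge0 ?normc_ge0// EFinM.
apply: (le_trans (lee_wpmul2l _ H)); first by rewrite lee_fin powR_ge0.
rewrite -EFinM lee_fin -/Q -/K mulrCA -powRM ?exprn_ge0 ?mulr_ge0 ?(ltW M0) ?(ltW k4)//.
rewrite (_ : 2 ^+ k * (4^-1 ^+ k * M) = 2^-1 ^+ k * M); last first.
  by rewrite mulrA -exprMn; congr (_ ^+ _ * _); field.
have k2 : 0 < 2^-1 ^+ k :> R by rewrite exprn_gt0// invr_gt0.
rewrite powRM ?(ltW k2) ?(ltW M0)//.
have -> : 2 * (K * M `^ Q) / 2 ^+ k.+1 = K * (2^-1 ^+ k * M `^ Q).
  rewrite exprS exprVn; field.
  by rewrite expf_neq0.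
rewrite ler_wpM2l// ler_wpM2r ?powR_ge0//; apply: ge1r_powR => //.
by rewrite k2 exprn_ile1// invf_le1// ler1n.
Qed.

(** Every term is at most the sum S, so S^(1 / Q) bounds all weighted differences 2^k |u_(k+1) -
    u_k| where S is finite. *)
Let s (y : RR) : R := (fine (S y)) `^ Q^-1.

Let s_ge0 y : 0 <= s y. Proof. exact: powR_ge0. Qed.

Let u_ (k : nat) (y : RR) : R[i] := cwave alpha p (G k) y.

Let u_step k y : (S y < +oo)%E -> 2 ^+ k * normc (u_ k.+1 y - u_ k y) <= s y.
Proof.
move=> Sy; rewrite /u_ -cwaveB// -/(D k).
have Sfin : S y \is a fin_num by rewrite ge0_fin_numE.
set z := _ * _; have z0 : 0 <= z by rewrite mulr_ge0 ?exprn_ge0 ?normc_ge0.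
have zS : z `^ Q <= fine (S y).
  rewrite -lee_fin fineK//.
  apply: le_trans (nneseries_lim_ge k.+1 _); last by move=> n _ _; exact: term_ge0.
  rewrite big_mkord big_ord_recr/=; apply: leeDr.
  by apply: sume_ge0 => i _; exact: term_ge0.
have Qn0 : Q != 0 by rewrite gt_eqF.
rewrite -[z](@powRr1 _ z)// -(mulfV Qn0) powRrM.
apply: ge0_ler_powR; rewrite ?invr_ge0 ?(ltW Q0) ?nnegrE ?powR_ge0//.
exact: le_trans (powR_ge0 _ _) zS.
Qed.

Let u_bound k y : (S y < +oo)%E -> normc (u_ k y) <= 2 * s y.
Proof.
move=> Sy; apply: (telescope_geometric_bound (a := u_ ^~ y)).
  by rewrite /u_ G0 cwave0.
by move=> j; exact: u_step.
Qed.

Let cvg_Re y : (S y < +oo)%E -> cvgn (fun k => complex.Re (u_ k y)).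
Proof.
move=> Sy; apply: (@cvg_telescope_geometric _ _ (s y)) => // k.
apply: le_trans (u_step k Sy); rewrite ler_wpM2l ?exprn_ge0//.
by rewrite -ReN -ReD; exact: norm_Re_le.
Qed.

Let cvg_Im y : (S y < +oo)%E -> cvgn (fun k => complex.Im (u_ k y)).
Proof.
move=> Sy; apply: (@cvg_telescope_geometric _ _ (s y)) => // k.
apply: le_trans (u_step k Sy); rewrite ler_wpM2l ?exprn_ge0//.
by rewrite -ImN -ImD; exact: norm_Im_le.
Qed.

(** The value 0 is a default on the set where S is infinite, which is null by [int_S]. *)
Definition wave_limit (y : RR) : R[i] :=
  if (S y < +oo)%E then limn (fun k => complex.Re (u_ k y)) +i* limn (fun k => complex.Im (u_ k y)) else 0.

Lemma cmeasurable_wave_limit : cmeasurable wave_limit.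
Proof.
have mP : measurable_fun setT (fun y => S y < +oo)%E by apply: measurable_fun_lte.
have mu k : cmeasurable (u_ k) by exact: cmeasurable_cwave.
split.
- apply: (@measurable_fun_cvg _ _ _ _ (fun k y => if (S y < +oo)%E then complex.Re (u_ k y) else 0)) => //.
    by move=> k; apply: measurable_indic_bool => //; exact: (mu k).1.
  move=> y _; rewrite /wave_limit/=; case: ifPn => [Sy|_] /=; last exact: cvg_cst.
  exact: cvg_Re.
- apply: (@measurable_fun_cvg _ _ _ _ (fun k y => if (S y < +oo)%E then complex.Im (u_ k y) else 0)) => //.
    by move=> k; apply: measurable_indic_bool => //; exact: (mu k).2.
  move=> y _; rewrite /wave_limit/=; case: ifPn => [Sy|_] /=; last exact: cvg_cst.
  exact: cvg_Im.
Qed.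

Let lim_norm_bound (a : nat -> R) (B : R) : cvgn a -> (forall k, `|a k| <= B) -> `|limn a| <= B.
Proof.
move=> ca aB; rewrite ler_norml; apply/andP; split.
  by apply: limr_ge => //; apply: nearW => n; have := aB n; rewrite ler_norml => /andP[].
by apply: limr_le => //; apply: nearW => n; have := aB n; rewrite ler_norml => /andP[].
Qed.

(** Each component of the limit is at most 2 s, so the modulus is at most 4 s, and (4 s)^Q = 4^Q
    S. *)
Lemma wave_limit_bound : (\int[leb2]_y (normc (wave_limit y) `^ Q)%:E <= (4 `^ Q * (2 * (K * M `^ Q)))%:E)%E.
Proof.
have mn := measurable_normc cmeasurable_wave_limit.
apply: (@le_trans _ _ (\int[leb2]_y ((4 `^ Q)%:E * S y))%E).
  apply: ge0_le_integral => //.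
  - by move=> y _; rewrite lee_fin powR_ge0.
  - by meas.
  - by apply: emeasurable_funM => //; meas.
  move=> y _; rewrite /wave_limit; case: ifPn => [Sy|_]; last first.
    by rewrite Normc.normc0 powR0 ?gt_eqF// mule_ge0.
  have Sfin : S y \is a fin_num by rewrite ge0_fin_numE.
  rewrite -(fineK Sfin) -EFinM lee_fin.
  have -> : 4 `^ Q * fine (S y) = (4 * s y) `^ Q.
    by rewrite powRM// /s -powRrM mulVf ?gt_eqF// powRr1// fine_ge0.
  apply: ge0_ler_powR; rewrite ?(ltW Q0) ?nnegrE ?normc_ge0 ?mulr_ge0//.
  apply: le_trans (normc_le_sum _) _ => /=.
  rewrite (_ : 4 * s y = 2 * s y + 2 * s y); last by ring.
  apply: lerD; apply: lim_norm_bound; [exact: cvg_Re| |exact: cvg_Im|] => k.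
    by apply: le_trans (norm_Re_le _) (u_bound k Sy).
  by apply: le_trans (norm_Im_le _) (u_bound k Sy).
rewrite ge0_integralZl// ?lee_fin ?powR_ge0// EFinM.
by apply: lee_wpmul2l; [rewrite lee_fin powR_ge0|exact: int_S].
Qed.

(** By Tonelli's theorem the exceptional times are fixed before any test function is chosen. *)
Let ae_S : {ae leb, forall t : R, leb.-integrable setT (fun x => S (x, t))}.
Proof.
have mG := measurable_fun_fubini_tonelli_G (m1 := leb) _ mS S_ge0.
have iG : leb.-integrable setT (fubini_G leb S).
  apply/integrableP; split => //.
  under eq_integral => t _ do rewrite gee0_abs ?integral_ge0//.
  rewrite -(fubini_tonelli2 (m1 := leb) (m2 := leb) _ mS S_ge0).
  by apply: le_lt_trans int_S _; rewrite ltry.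
have := integrable_ae measurableT iG; apply: filterS => t /(_ I) fint.
apply/integrableP; split; first by apply: (measurableT_comp mS); exact: pair2_measurable.
under eq_integral => x _ do rewrite gee0_abs//.
by have := fint; rewrite ge0_fin_numE// integral_ge0.
Qed.

(** Both sides of [cwave_pairing] pass to the limit by dominated convergence: in x with a majorant
    made from S(., t), in frequency with the majorant whose integrability is assumed. *)
Lemma wave_limit_pairing : {ae leb, forall t : R, forall (psi : R -> R[i]) (B : R),
  cintegrable leb psi -> (forall x, normc (psi x) <= B) ->
  cmeasurable (inv_fourier psi : measurableTypeR R -> R[i]) ->
  leb.-integrable setT (EFin \o (fun xi => `|xi| `^ sigma * normc (h xi) * normc (inv_fourier psi xi))) ->
  cintegrable leb (fun x => wave_limit (x, t) * psi x) /\
  cintegral leb (fun x => wave_limit (x, t) * psi x) =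
  cintegral leb (fun xi => ((`|xi| `^ sigma)%:C * (expi (- (t * `|xi| `^ alpha)) * h xi)) * inv_fourier psi xi)}.
Proof.
have [Z [mZ Z0 sZ]] := ae_S; exists Z; split => // t Ht; apply: sZ => iS; apply: Ht.
move=> psi B ipsi psiB minv iinv.
have B0 : 0 <= B by apply: le_trans (psiB 0); exact: normc_ge0.
have mpsi := cintegrable_cmeasurable ipsi.
have sect (f : RR -> R[i]) : cmeasurable f -> cmeasurable (fun x : measurableTypeR R => f (x, t)).
  by move=> [f1 f2]; split; [apply: (measurableT_comp f1)|apply: (measurableT_comp f2)]; exact: pair2_measurable.
(* Since 1 / Q <= 1, the power S^(1 / Q) is at most 1 + S. The 1 is paid by the integrability of
   psi, and S by its boundedness. *)
have s_le y : s y <= 1 + fine (S y).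
  have fS0 : 0 <= fine (S y) by exact: fine_ge0.
  have Q1' : Q^-1 <= 1 by rewrite invf_le1.
  have [S1|S1] := leP 1 (fine (S y)).
    by apply: (le_trans (ler1_powR S1 Q1')); rewrite lerDr.
  apply: (@le_trans _ _ 1); last by rewrite lerDl.
  have one : (1 : R) = 1 `^ Q^-1 by rewrite powR1.
  rewrite [leRHS]one; apply: ge0_ler_powR; rewrite ?invr_ge0 ?(ltW Q0) ?nnegrE//.
  exact: ltW.
have ifS : leb.-integrable setT (EFin \o (fun x => fine (S (x, t)))).
  apply: (le_integrable _ _ _ iS) => //.
    apply/measurable_EFinP; apply: (measurableT_comp (fine_measurable measurableT)).
    by apply: (measurableT_comp mS); exact: pair2_measurable.
  by move=> x _ /=; move: (S_ge0 (x, t)); case: (S (x, t)) => [r||]//= _; rewrite normr0 leey.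
pose dom x := 2 * (normc (psi x) + B * fine (S (x, t))).
have idom : leb.-integrable setT (EFin \o dom).
  have i2 := integrableZl measurableT 2 (integrableD measurableT (integrable_normc ipsi) (integrableZl measurableT B ifS)).
  by move: i2; apply: eq_integrable => // x _; rewrite /= -EFinM -EFinD -EFinM.
have aeS : {ae leb, forall x : R, (S (x, t) < +oo)%E}.
  by have := integrable_ae measurableT iS; apply: filterS => x /(_ I); rewrite ge0_fin_numE.
have mu k : cmeasurable (fun x : measurableTypeR R => u_ k (x, t) * psi x).
  by apply: cmeasurableM => //; apply: sect; exact: cmeasurable_cwave.
have mW : cmeasurable (fun x : measurableTypeR R => wave_limit (x, t) * psi x).
  by apply: cmeasurableM => //; apply: sect; exact: cmeasurable_wave_limit.
have cR x : (S (x, t) < +oo)%E -> complex.Re (u_ k (x, t)) @[k --> \oo] --> complex.Re (wave_limit (x, t)).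
  by move=> Sx; rewrite /wave_limit Sx; exact: cvg_Re.
have cI x : (S (x, t) < +oo)%E -> complex.Im (u_ k (x, t)) @[k --> \oo] --> complex.Im (wave_limit (x, t)).
  by move=> Sx; rewrite /wave_limit Sx; exact: cvg_Im.
have u_psi_bound k x : (S (x, t) < +oo)%E -> normc (u_ k (x, t) * psi x) <= dom x.
  move=> Sx; rewrite Normc.normcM /dom.
  apply: (le_trans (ler_wpM2r (normc_ge0 _) (u_bound k Sx))); rewrite -mulrA ler_wpM2l//.
  apply: (le_trans (ler_wpM2r (normc_ge0 _) (s_le _))); rewrite mulrDl mul1r lerD2l mulrC.
  by rewrite ler_wpM2r// fine_ge0.
have [iW lR lI] := @cdominated_convergence _ (measurableTypeR R) R leb (fun x => (S (x, t) < +oo)%E) (fun k x => u_ k (x, t) * psi x)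
  _ dom aeS mu mW idom
  (fun x Sx => cvg_Re_mul (cR x Sx) (cI x Sx)) (fun x Sx => cvg_Im_mul (cR x Sx) (cI x Sx))
  (fun k x Sx => u_psi_bound k x Sx).
split => //.
pose V (w : R -> R[i]) xi : R[i] := ((`|xi| `^ sigma)%:C * (expi (- (t * `|xi| `^ alpha)) * w xi)) * inv_fourier psi xi.
have mV (w : R -> R[i]) : cmeasurable (w : measurableTypeR R -> R[i]) -> cmeasurable (V w : measurableTypeR R -> R[i]).
  move=> mw; apply: cmeasurableM => //; apply: cmeasurableM; first by apply: cmeasurable_real; meas.
  by apply: cmeasurableM => //; apply: cmeasurable_expi; meas.
have cV xi : xi != 0 -> \forall k \near \oo, V (G k) xi = V h xi.
  by move=> /Gcvg[k0 hk0]; exists k0 => // k /= kk; rewrite /V hk0.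
have VG k xi : normc (V (G k) xi) <= `|xi| `^ sigma * normc (h xi) * normc (inv_fourier psi xi).
  rewrite /V !Normc.normcM normc_expi normc_real mul1r ger0_norm ?powR_ge0//.
  by rewrite ler_wpM2r ?normc_ge0// ler_wpM2l ?powR_ge0.
have mGk k : cmeasurable (V (G k) : measurableTypeR R -> R[i]) by apply: mV; case: (aG k).
have cVR xi : xi != 0 -> complex.Re (V (G k) xi) @[k --> \oo] --> complex.Re (V h xi).
  by move=> /cV cVk; apply: cvg_near_cst; apply: filterS cVk => k ->.
have cVI xi : xi != 0 -> complex.Im (V (G k) xi) @[k --> \oo] --> complex.Im (V h xi).
  by move=> /cV cVk; apply: cvg_near_cst; apply: filterS cVk => k ->.
have [_ vR vI] := @cdominated_convergence _ (measurableTypeR R) R leb (fun xi => xi != 0) (fun k xi => V (G k) xi) (V h)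
  _ ae_neq0 mGk (mV _ mh) iinv
  cVR cVI
  (fun k xi _ => VG k xi).
have E k : cintegral leb (V (G k)) = cintegral leb (fun x => u_ k (x, t) * psi x).
  by rewrite /V /u_ cwave_pairing.
have RE : (fun k => complex.Re (cintegral leb (V (G k)))) = (fun k => complex.Re (cintegral leb (fun x => u_ k (x, t) * psi x))).
  by apply/funext => k; rewrite E.
have IE : (fun k => complex.Im (cintegral leb (V (G k)))) = (fun k => complex.Im (cintegral leb (fun x => u_ k (x, t) * psi x))).
  by apply/funext => k; rewrite E.
rewrite RE in vR; rewrite IE in vI.
rewrite [LHS]complex_eta [RHS]complex_eta; congr (_ +i* _).
  exact: (cvg_unique _ lR vR).
exact: (cvg_unique _ lI vI).
Qed.

End wave_limit.

(** * Schwartz functions and Fourier inversion *)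

Section line_FTC.
Context {R : realType}.
Local Notation leb := (@lebesgue_measure R).
Implicit Types f F : R -> R.

Definition quadratic_decay (B : R) f : Prop := forall x, (1 + x ^+ 2) * `|f x| <= B.

Lemma sqrD1_gt0 (x : R) : 0 < 1 + x ^+ 2.
Proof. by rewrite ltr_pwDl// sqr_ge0. Qed.

(** The integrand is half of the Poisson kernel with e = 1. *)
Lemma ge0_integral_invD1sqr : (\int[leb]_x ((1 + x ^+ 2)^-1)%:E = pi%:E)%E.
Proof.
have := @ge0_integral_pk R 1 ltr01; rewrite pkE => H.
have E : (\int[leb]_x (2 * 1 / (1 ^+ 2 + x ^+ 2))%:E = 2%:E * \int[leb]_x ((1 + x ^+ 2)^-1)%:E)%E.
  rewrite -ge0_integralZl//.
  - by apply: eq_integral => x _; rewrite -EFinM mulr1 expr1n.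
  - by meas.
  - by move=> x _; rewrite lee_fin invr_ge0 ltW// sqrD1_gt0.
have {H} : (2%:E * \int[leb]_x ((1 + x ^+ 2)^-1)%:E = 2%:E * pi%:E)%E by rewrite -E H EFinM.
move=> /(congr1 (fun z => (2^-1)%:E * z)%E); rewrite !muleA -EFinM mulVf// !mul1e.
by [].
Qed.

Lemma integrable_invD1sqr (c : R) : leb.-integrable setT (EFin \o (fun x : R => c / (1 + x ^+ 2))).
Proof.
have i1 : leb.-integrable setT (EFin \o (fun x : R => (1 + x ^+ 2)^-1)).
  apply/integrableP; split; first by meas.
  under eq_integral do rewrite /= ger0_norm ?invr_ge0 ?ltW ?sqrD1_gt0//.
  by rewrite ge0_integral_invD1sqr ltry.
by have := integrableZl measurableT c i1; apply: eq_integrable => // x _; rewrite /= EFinM.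
Qed.

Lemma quadratic_decay_le B f x : quadratic_decay B f -> `|f x| <= B / (1 + x ^+ 2).
Proof. by move=> fB; rewrite ler_pdivlMr ?sqrD1_gt0// mulrC. Qed.

Lemma quadratic_decay_ge0 B f : quadratic_decay B f -> 0 <= B.
Proof. by move=> /(_ 0); apply: le_trans; rewrite mulr_ge0// ltW// sqrD1_gt0. Qed.

Lemma quadratic_decay_bounded B f x : quadratic_decay B f -> `|f x| <= B.
Proof.
move=> fB; apply: le_trans (fB x); rewrite ler_peMl// lerDl; exact: sqr_ge0.
Qed.

Lemma integrable_quadratic_decay B f : measurable_fun [set: measurableTypeR R] f ->
  quadratic_decay B f -> leb.-integrable setT (EFin \o f).
Proof.
move=> mf fB; apply: le_integrable (integrable_invD1sqr B) => //; first by apply/measurable_EFinP.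
move=> x _ /=; rewrite lee_fin; apply: le_trans (quadratic_decay_le x fB) _; exact: ler_norm.
Qed.

Lemma norm_Rintegral_quadratic_decay B f : measurable_fun [set: measurableTypeR R] f ->
  quadratic_decay B f -> `|\int[leb]_x f x| <= B * pi.
Proof.
move=> mf fB; have if_ := integrable_quadratic_decay mf fB.
apply: (le_trans (le_normr_Rintegral measurableT if_)).
have -> : B * pi = \int[leb]_x (B / (1 + x ^+ 2)).
  rewrite /Rintegral -[LHS]/(fine (B * pi)%:E) EFinM -ge0_integral_invD1sqr; congr fine.
  rewrite -ge0_integralZl//.
  - by meas.
  - by move=> x _; rewrite lee_fin invr_ge0 ltW// sqrD1_gt0.
  - by rewrite lee_fin; exact: quadratic_decay_ge0 fB.
apply: le_Rintegral => //.
- by have := integrable_abse if_; apply: eq_integrable.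
- exact: integrable_invD1sqr.
- by move=> x _; exact: quadratic_decay_le.
Qed.

Lemma cvg_quadratic_decay B F (u : nat -> R) : quadratic_decay B F -> (forall n, n%:R <= `|u n|) ->
  F (u n) @[n --> \oo] --> 0.
Proof.
move=> FB un; have B0 := quadratic_decay_ge0 FB.
have n1 n : n.+1%:R <= 1 + u n ^+ 2 :> R.
  rewrite -addn1 natrD addrC lerD2l -real_normK ?num_real//.
  apply: (@le_trans _ _ (n%:R ^+ 2)); last by rewrite ler_pXn2r// nnegrE.
  by rewrite -natrX ler_nat -mulnn; case: n => // n; rewrite leq_pmulr.
have Fh n : `|F (u n)| <= B * harmonic n.
  apply: (le_trans (quadratic_decay_le _ FB)); rewrite ler_wpM2l// /harmonic.
  by rewrite lef_pV2 ?posrE ?sqrD1_gt0.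
have Bh : B * harmonic n @[n --> \oo] --> 0.
  by rewrite -(mulr0 B); apply: cvgMr; exact: cvg_harmonic.
apply: (@squeeze_cvgr _ _ _ _ (fun n => - (B * harmonic n)) (fun n => B * harmonic n)) => //.
- by apply: nearW => n; rewrite -ler_norml.
- by rewrite -oppr0; apply: cvgN.
Qed.

(** The integral over [-n, n] is F(n) - F(-n), which tends to 0 by the decay of F. *)
Lemma Rintegral_derivative B F f : continuous f -> (forall x : R, is_derive x 1 F (f x)) ->
  quadratic_decay B F -> leb.-integrable setT (EFin \o f) -> \int[leb]_x f x = 0.
Proof.
move=> cf dF FB if_.
have mf : measurable_fun [set: measurableTypeR R] f by exact: continuous_measurable_fun.
pose G n (x : R) : R := if (- n%:R <= x) && (x <= n%:R) then f x else 0.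
have EG n : \int[leb]_x G n x = F n%:R - F (- n%:R).
  rewrite /Rintegral.
  have -> : (\int[leb]_x (G n x)%:E = \int[leb]_(x in `[(- n%:R)%R, n%:R%R]) (f x)%:E)%E.
    rewrite [RHS]integral_mkcond; apply: eq_integral => x _.
    by rewrite patchE mem_setE in_itv/= /G; case: ifP.
  rewrite (@FTC2 _ _ F)//; first by rewrite (@le_trans _ _ 0)// oppr_le0.
  by move=> x _; exact: cf.
have mG n : measurable_fun [set: measurableTypeR R] (G n) by rewrite /G; meas.
have cG x : G n x @[n --> \oo] --> f x.
  apply: cvg_near_cst; exists (Num.bound `|x|) => // n /= xn.
  have xn' : `|x| < n%:R by apply: (lt_le_trans (archi_boundP (normr_ge0 x))); rewrite ler_nat.
  by rewrite /G -ler_norml ltW.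
have GnF n x : normc (G n x)%:C <= `|f x|.
  by rewrite normc_real /G; case: ifP => //; rewrite normr0.
have [_ cv _] := @cdominated_convergence _ (measurableTypeR R) R leb (fun=> True) (fun n x => (G n x)%:C) (fun x => (f x)%:C) (fun x => `|f x|)
  (aeW _ (fun=> I)) (fun n => cmeasurable_real (mG n)) (cmeasurable_real mf) (integrable_abse if_) (fun x _ => cG x) (fun x _ => cvg_cst _)
  (fun n x _ => GnF n x).
have {}cv : \int[leb]_x (G n x) @[n --> \oo] --> \int[leb]_x f x by exact: cv.
have c0 : F n%:R - F (- n%:R) @[n --> \oo] --> 0.
  rewrite -[X in _ --> X](subrr 0); apply: cvgB; apply: (cvg_quadratic_decay FB) => n.
    by rewrite ger0_norm.
  by rewrite normrN ger0_norm.
have E : (fun n => \int[leb]_x G n x) = (fun n => F n%:R - F (- n%:R)) by apply/funext => n; exact: EG.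
by rewrite E in cv; exact: (cvg_unique _ cv c0).
Qed.

Lemma quadratic_decayD B B' f g : quadratic_decay B f -> quadratic_decay B' g ->
  quadratic_decay (B + B') (fun x => f x + g x).
Proof.
move=> fB gB x; apply: le_trans (lerD (fB x) (gB x)).
by rewrite -mulrDr ler_wpM2l ?ler_normD// ltW// sqrD1_gt0.
Qed.

Lemma quadratic_decayM B f g c : (forall x, `|g x| <= c) -> quadratic_decay B f ->
  quadratic_decay (c * B) (fun x => g x * f x).
Proof.
move=> gc fB x; rewrite normrM mulrCA; apply: ler_pM => //.
by rewrite mulr_ge0// ltW// sqrD1_gt0.
Qed.

(** Two integrations by parts in one stroke: cos(xi x) f2 + xi^2 cos(xi x) f is the derivative of
    cos(xi x) f1 + xi sin(xi x) f and has integral 0, so xi^2 times the transform of f is minus that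
    of f2. The sine is analogous. *)
Lemma fourier_decay (f f1 f2 : R -> R) (B : R) (trig : R -> R) (xi : R) :
  trig = cos \/ trig = sin ->
  (forall x : R, is_derive x 1 f (f1 x)) -> (forall x : R, is_derive x 1 f1 (f2 x)) ->
  continuous f2 ->
  quadratic_decay B f -> quadratic_decay B f1 -> quadratic_decay B f2 ->
  (1 + xi ^+ 2) * `|\int[leb]_x (trig (xi * x) * f x)| <= 2 * (B * pi).
Proof.
move=> trigE df df1 cf2 fB f1B f2B.
have cf : continuous f by move=> x; exact: der_continuous (df x).
have mf : measurable_fun [set: measurableTypeR R] f by exact: continuous_measurable_fun.
have mf2 : measurable_fun [set: measurableTypeR R] f2 by exact: continuous_measurable_fun.
have B0 := quadratic_decay_ge0 fB.
have mt : measurable_fun [set: measurableTypeR R] (fun x : R => trig (xi * x)).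
  by case: trigE => ->; meas.
have t1 x : `|trig x| <= 1 by case: trigE => ->; [exact: norm_cos_le1|exact: norm_sin_le1].
pose g x := trig (xi * x) * f x; pose g2 x := trig (xi * x) * f2 x.
have gB : quadratic_decay B g.
  by rewrite -[B]mul1r; apply: quadratic_decayM fB.
have g2B : quadratic_decay B g2.
  by rewrite -[B]mul1r; apply: quadratic_decayM f2B.
have mg : measurable_fun [set: measurableTypeR R] g by exact: measurable_funM.
have mg2 : measurable_fun [set: measurableTypeR R] g2 by exact: measurable_funM.
have ig := integrable_quadratic_decay mg gB; have ig2 := integrable_quadratic_decay mg2 g2B.
have parts : \int[leb]_x (g2 x + xi ^+ 2 * g x) = 0.
  have i0 : leb.-integrable setT (EFin \o (fun x => g2 x + xi ^+ 2 * g x)).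
    have := integrableD measurableT ig2 (integrableZl measurableT (xi ^+ 2) ig).
    by apply: eq_integrable => // x _; rewrite /= EFinD EFinM.
  have c2 : continuous (fun x => g2 x + xi ^+ 2 * g x).
    have ct : continuous trig by case: trigE => ->; [exact: continuous_cos|exact: continuous_sin].
    have cx : continuous (fun x : R => trig (xi * x)).
      by move=> x; apply: (@continuous_comp _ _ _ (fun x : R => xi * x) trig); [exact: mulrl_continuous|exact: ct].
    by move=> x; apply: continuousD; [apply: continuousM; [exact: cx|exact: cf2]|
      apply: continuousM; [exact: cst_continuous|apply: continuousM; [exact: cx|exact: cf]]].
  have decay (t' t'' : R -> R) : (forall x, `|t' x| <= 1) -> (forall x, `|t'' x| <= 1) ->
      quadratic_decay (1 * B + `|xi| * B) (fun x => t' (xi * x) * f1 x + (xi * t'' (xi * x)) * f x).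
    move=> t'1 t''1; apply: quadratic_decayD; apply: quadratic_decayM => // x.
    by rewrite normrM ler_piMr.
  case: trigE => tE.
  - apply: (Rintegral_derivative c2 (F := fun x => cos (xi * x) * f1 x + (xi * sin (xi * x)) * f x) _ (decay _ _ norm_cos_le1 norm_sin_le1) i0).
    move=> x; have dfx := df x; have df1x := df1 x.
    by der_to; [der|cbv beta; rewrite /g /g2 tE; ring].
  - apply: (Rintegral_derivative c2 (F := fun x => sin (xi * x) * f1 x + (xi * (- cos (xi * x))) * f x) _ (decay _ (fun x => - cos x) norm_sin_le1 _) i0).
      move=> x; have dfx := df x; have df1x := df1 x.
      by der_to; [der|cbv beta; rewrite /g /g2 tE; ring].
    by move=> x; rewrite normrN norm_cos_le1.
have ixg : leb.-integrable setT (EFin \o (fun x => xi ^+ 2 * g x)).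
  by have := integrableZl measurableT (xi ^+ 2) ig; apply: eq_integrable => // x _; rewrite /= EFinM.
move: parts; rewrite RintegralD// RintegralZl// => parts.
have N1 := norm_Rintegral_quadratic_decay mg gB; have N2 := norm_Rintegral_quadratic_decay mg2 g2B.
rewrite mulrDl mul1r [leRHS]mulr_natl mulr2n lerD//.
by rewrite -[xi ^+ 2]ger0_norm ?sqr_ge0// -normrM -(addr0_eq parts) normrN.
Qed.

End line_FTC.

Section schwartz_decay.
Context {R : realType}.
Local Notation leb := (@lebesgue_measure R).

Lemma schwartz_seminorm_bound (f : R -> R[i]) (k n : nat) : schwartz f ->
  exists B : R, forall x, `|x| ^+ k * normc (cderiven n f x) <= B.
Proof.
move=> [_ /(_ k n)]; rewrite /schwartz_seminorm => H.
exists (fine (schwartz_seminorm k n f)) => x.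
have ub : ((`|x| ^+ k * normc (cderiven n f x))%:E <= schwartz_seminorm k n f)%E.
  by apply: ereal_sup_ubound; exists x.
rewrite -lee_fin fineK// ge0_fin_numE//.
by apply: le_trans ub; rewrite lee_fin mulr_ge0 ?normc_ge0.
Qed.

Lemma schwartz_deriv_decay (f : R -> R[i]) (n : nat) : schwartz f ->
  exists B : R, quadratic_decay B (fun x => normc (cderiven n f x)).
Proof.
move=> sf; have [B0 hB0] := schwartz_seminorm_bound 0 n sf.
have [B2 hB2] := schwartz_seminorm_bound 2 n sf.
exists (B0 + B2) => x; rewrite ger0_norm ?normc_ge0// mulrDl mul1r.
by rewrite lerD//; [have := hB0 x; rewrite expr0 mul1r|have := hB2 x; rewrite real_normK ?num_real].
Qed.

Let part (re : bool) (z : R[i]) : R := if re then complex.Re z else complex.Im z.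

(** The flag [re] treats both components at once. Two derivatives are extracted, as many as
    [fourier_decay] integrates by parts. *)
Lemma schwartz_part_smooth (f : R -> R[i]) (re : bool) : schwartz f ->
  exists B (f0 f1 f2 : R -> R), [/\ f0 = part re \o f, forall x : R, is_derive x 1 f0 (f1 x),
     forall x : R, is_derive x 1 f1 (f2 x) & continuous f2] /\
     [/\ quadratic_decay B f0, quadratic_decay B f1 & quadratic_decay B f2].
Proof.
move=> sf; have [B0 h0] := schwartz_deriv_decay 0 sf; have [B1 h1] := schwartz_deriv_decay 1 sf.
have [B2 h2] := schwartz_deriv_decay 2 sf.
have Bp0 := quadratic_decay_ge0 h0; have Bp1 := quadratic_decay_ge0 h1; have Bp2 := quadratic_decay_ge0 h2.
have dg n (x : R) : derivable (derive1n n (part re \o f)) x 1.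
  by have [sm _] := sf; have [h h'] := sm n x; rewrite /part; case: re.
have gle n (x : R) : `|derive1n n (part re \o f) x| <= normc (cderiven n f x).
  by case: re {dg}; [have := norm_Re_le (cderiven n f x)|have := norm_Im_le (cderiven n f x)].
pose g n : R -> R := derive1n n (part re \o f).
have isd n (x : R) : is_derive x 1 (g n) (g n.+1 x).
  rewrite /g derive1nS derive1E; apply/derivableP; exact: dg.
have gd n B : quadratic_decay B (fun x => normc (cderiven n f x)) -> quadratic_decay B (g n).
  move=> hB x; apply: le_trans (hB x); rewrite ler_wpM2l ?(ltW (sqrD1_gt0 _))//.
  by rewrite [leRHS]ger0_norm ?normc_ge0//; exact: gle.
have mono B B' h : B <= B' -> quadratic_decay B h -> quadratic_decay B' h.
  by move=> BB hB x; exact: le_trans (hB x) BB.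
exists (B0 + B1 + B2), (g 0%N), (g 1%N), (g 2%N); split; split => //.
- by move=> x; exact: der_continuous (isd 2%N x).
- by apply: mono (gd _ _ h0); rewrite -addrA lerDl addr_ge0.
- by apply: mono (gd _ _ h1); rewrite addrAC lerDr addr_ge0.
- by apply: mono (gd _ _ h2); rewrite lerDr addr_ge0.
Qed.

Lemma schwartz_cmeasurable (f : R -> R[i]) : schwartz f -> cmeasurable (f : measurableTypeR R -> R[i]).
Proof.
move=> sf; split.
- have [B [f0 [f1 [f2 [[E d0 _ _] _]]]]] := schwartz_part_smooth true sf.
  rewrite (_ : _ \o _ = f0)//; apply: continuous_measurable_fun => x.
  exact: der_continuous (d0 x).
- have [B [f0 [f1 [f2 [[E d0 _ _] _]]]]] := schwartz_part_smooth false sf.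
  rewrite (_ : _ \o _ = f0)//; apply: continuous_measurable_fun => x.
  exact: der_continuous (d0 x).
Qed.

Lemma schwartz_decay (f : R -> R[i]) : schwartz f ->
  exists B : R, quadratic_decay B (fun x => normc (f x)).
Proof.
move=> sf; have [B hB] := schwartz_deriv_decay 0 sf; exists B => x.
have := hB x.
by rewrite (_ : cderiven 0 f x = f x)// /cderiven !derive1n0 [RHS]complex_eta.
Qed.

Lemma schwartz_cintegrable (f : R -> R[i]) : schwartz f -> cintegrable leb f.
Proof.
move=> sf; have [B hB] := schwartz_decay sf.
apply: (cintegrable_le (schwartz_cmeasurable sf) (integrable_invD1sqr B)) => x.
by have := quadratic_decay_le x hB; rewrite ger0_norm ?normc_ge0.
Qed.

Lemma cmeasurable_inv_fourier (f : R -> R[i]) : cmeasurable (f : measurableTypeR R -> R[i]) ->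
  cmeasurable (inv_fourier f : measurableTypeR R -> R[i]).
Proof.
move=> [m1 m2].
have mc : cmeasurable (fun z : measurableTypeR R * measurableTypeR R => expi (z.1 * z.2) * f z.2).
  apply: cmeasurableM; first by apply: cmeasurable_expi; meas.
  by split; [exact: (measurableT_comp m1 measurable_snd)|exact: (measurableT_comp m2 measurable_snd)].
by split; [exact: (measurable_Rintegral_param leb mc.1)|exact: (measurable_Rintegral_param leb mc.2)].
Qed.

Lemma inv_fourier_decay (f : R -> R[i]) : schwartz f ->
  exists B : R, quadratic_decay B (fun xi => normc (inv_fourier f xi)).
Proof.
move=> sf.
have [B [f0 [f1 [f2 [[E d0 d1 c2] [b0 b1 b2]]]]]] := schwartz_part_smooth true sf.
have [C [g0 [g1 [g2 [[E' d0' d1' c2'] [b0' b1' b2']]]]]] := schwartz_part_smooth false sf.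
exists (4 * (B * pi + C * pi)) => xi; rewrite ger0_norm ?normc_ge0//.
have Re_f x : complex.Re (f x) = f0 x by rewrite E.
have Im_f x : complex.Im (f x) = g0 x by rewrite E'.
have mf : measurable_fun [set: measurableTypeR R] f0.
  by apply: continuous_measurable_fun => x; exact: der_continuous (d0 x).
have mg : measurable_fun [set: measurableTypeR R] g0.
  by apply: continuous_measurable_fun => x; exact: der_continuous (d0' x).
have i0 := integrable_quadratic_decay mf b0; have i0' := integrable_quadratic_decay mg b0'.
have mc : measurable_fun [set: measurableTypeR R] (fun x : R => cos (xi * x)) by meas.
have ms : measurable_fun [set: measurableTypeR R] (fun x : R => sin (xi * x)) by meas.
have ReE : complex.Re (inv_fourier f xi) = \int[leb]_x (cos (xi * x) * f0 x) - \int[leb]_x (sin (xi * x) * g0 x).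
  rewrite -RintegralB//; last 2 first.
  - by apply: integrable_bddM i0 => // x; exact: norm_cos_le1.
  - by apply: integrable_bddM i0' => // x; exact: norm_sin_le1.
  by apply: eq_Rintegral => x _; rewrite /= ReM/= Re_f Im_f.
have ImE : complex.Im (inv_fourier f xi) = \int[leb]_x (cos (xi * x) * g0 x) + \int[leb]_x (sin (xi * x) * f0 x).
  rewrite -RintegralD//; last 2 first.
  - by apply: integrable_bddM i0' => // x; exact: norm_cos_le1.
  - by apply: integrable_bddM i0 => // x; exact: norm_sin_le1.
  by apply: eq_Rintegral => x _; rewrite /= ImM/= Re_f Im_f.
have h1 := fourier_decay xi (or_introl erefl) d0 d1 c2 b0 b1 b2.
have h2 := fourier_decay xi (or_intror erefl) d0 d1 c2 b0 b1 b2.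
have h3 := fourier_decay xi (or_introl erefl) d0' d1' c2' b0' b1' b2'.
have h4 := fourier_decay xi (or_intror erefl) d0' d1' c2' b0' b1' b2'.
have X0 := sqrD1_gt0 xi.
apply: (@le_trans _ _ ((1 + xi ^+ 2) * (`|\int[leb]_x (cos (xi * x) * f0 x)| + `|\int[leb]_x (sin (xi * x) * g0 x)|
   + (`|\int[leb]_x (cos (xi * x) * g0 x)| + `|\int[leb]_x (sin (xi * x) * f0 x)|)))).
  rewrite ler_wpM2l ?(ltW X0)//; apply: (le_trans (normc_le_sum _)); rewrite ReE ImE.
  by apply: lerD; [exact: ler_normB|exact: ler_normD].
rewrite [leLHS]mulrDr [X in X + _]mulrDr [X in _ + X <= _]mulrDr.
apply: (le_trans (lerD (lerD h1 h4) (lerD h3 h2))).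
by move: pi => P; rewrite le_eqVlt; apply/orP; left; apply/eqP; ring.
Qed.

End schwartz_decay.

(** * Fourier inversion by Abel summation *)

Section fourier_inversion.
Context {R : realType}.
Local Notation leb := (@lebesgue_measure R).
Local Notation leb2 := (leb \x leb)%E.
Local Notation RR := (measurableTypeR R * measurableTypeR R)%type.

Lemma ge0_integral_affine (g : R -> R) (b e : R) : 0 < e ->
  measurable_fun [set: measurableTypeR R] g -> (forall x, 0 <= g x) ->
  (e%:E * \int[leb]_v (g (b - e * v))%:E = \int[leb]_y (g y)%:E)%E.
Proof.
move=> e0 mg g0.
have mgE : measurable_fun [set: measurableTypeR R] (fun y : R => (g y)%:E) by meas.
have mgb : measurable_fun [set: measurableTypeR R] (fun y : R => (g (y + b))%:E) by meas.
rewrite -(@ge0_integral_shift _ _ b mgE); last by move=> y; rewrite lee_fin.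
have en0 : - e != 0 by rewrite oppr_eq0 gt_eqF.
rewrite -(ge0_integral_scale en0 mgb); last by move=> y; rewrite lee_fin.
rewrite normrN gtr0_norm//; congr (_ * _)%E; apply: eq_integral => v _.
by rewrite mulNr addrC.
Qed.

Lemma Rintegral_affine (f : R -> R) (b e : R) : 0 < e -> leb.-integrable setT (EFin \o f) ->
  leb.-integrable setT (EFin \o (fun v => f (b - e * v))) /\
  e * \int[leb]_v f (b - e * v) = \int[leb]_y f y.
Proof.
move=> e0 if_.
have mf : measurable_fun [set: measurableTypeR R] f by apply/measurable_EFinP; exact: measurable_int if_.
have pos (g : R -> R) : measurable_fun [set: measurableTypeR R] g -> (forall x, 0 <= g x) ->
   leb.-integrable setT (EFin \o g) ->
   leb.-integrable setT (EFin \o (fun v => g (b - e * v))) /\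
   e * \int[leb]_v g (b - e * v) = \int[leb]_y g y.
  move=> mg g0 ig.
  have mge : measurable_fun [set: measurableTypeR R] (fun v : R => g (b - e * v)) by meas.
  have H := ge0_integral_affine b e0 mg g0.
  have fin := integrable_fin_num measurableT ig.
  have I0 : (0 <= \int[leb]_v (g (b - e * v))%:E)%E by apply: integral_ge0 => v _; rewrite lee_fin.
  have ige : leb.-integrable setT (EFin \o (fun v => g (b - e * v))).
    apply/integrableP; split; first by meas.
    under eq_integral do rewrite /= ger0_norm//.
    rewrite ltey; apply: contraTneq fin => /= E.
    by rewrite -H E gt0_muley// lte_fin.
  split => //; rewrite /Rintegral -H -(fineK (integrable_fin_num measurableT ige)).
  by rewrite -EFinM.
pose fp x := Num.max (f x) 0; pose fm x := Num.max (- f x) 0.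
have mfp : measurable_fun [set: measurableTypeR R] fp by apply: measurable_maxr; meas.
have mfm : measurable_fun [set: measurableTypeR R] fm by apply: measurable_maxr; meas.
have fp0 x : 0 <= fp x by rewrite /fp le_max lexx orbT.
have fm0 x : 0 <= fm x by rewrite /fm le_max lexx orbT.
have fE x : f x = fp x - fm x.
  by rewrite /fp /fm; have [f0|f0] := leP 0 (f x); [rewrite max_r ?oppr_le0// subr0|
    rewrite max_l ?opprK ?add0r// oppr_ge0 ltW].
have ifp : leb.-integrable setT (EFin \o fp).
  apply: le_integrable if_ => //; first by apply/measurable_EFinP.
  by move=> x _ /=; rewrite lee_fin ger0_norm// ge_max normr_ge0 ler_norm.
have ifm : leb.-integrable setT (EFin \o fm).
  apply: le_integrable if_ => //; first by apply/measurable_EFinP.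
  by move=> x _ /=; rewrite lee_fin ger0_norm// ge_max normr_ge0 -normrN ler_norm.
have [ip Ep] := pos _ mfp fp0 ifp; have [im Em] := pos _ mfm fm0 ifm.
split.
  have := integrableB measurableT ip im; apply: eq_integrable => // v _.
  by rewrite /= -EFinB -fE.
under [in RHS]eq_Rintegral do rewrite fE.
under eq_Rintegral do rewrite fE.
by rewrite !RintegralB// mulrBr Ep Em.
Qed.

Lemma cintegral_affine (f : R -> R[i]) (b e : R) : 0 < e -> cintegrable leb f ->
  cintegral leb f = cintegral leb (fun v => e%:C * f (b - e * v)).
Proof.
move=> e0 [i1 i2].
have [j1 E1] := Rintegral_affine b e0 i1; have [j2 E2] := Rintegral_affine b e0 i2.
rewrite cintegralZl; last by split.
by rewrite [RHS]complex_eta ReM ImM/= !mul0r subr0 addr0 E1 E2.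
Qed.

Lemma pk_scale (e v : R) : 0 < e -> e * pk e (e * v) = pk 1 v.
Proof.
move=> e0; rewrite !pkE; field.
have h : 1 + v ^+ 2 != 0 by rewrite gt_eqF// sqrD1_gt0.
by rewrite h gt_eqF// ltr_wpDr ?sqr_ge0 ?exprn_gt0.
Qed.

Lemma cintegral_wt_expi (e a : R) : 0 < e ->
  cintegral leb (fun xi => (wt e xi)%:C * expi (a * xi)) = (pk e a)%:C.
Proof.
move=> e0.
transitivity (\int[leb]_xi (wt e xi * cos (a * xi)) +i* \int[leb]_xi (wt e xi * sin (a * xi))); last first.
  by rewrite Rintegral_wt_cos// Rintegral_wt_sin.
congr (_ +i* _); apply: eq_Rintegral => xi _.
  by rewrite ReM/= mul0r subr0.
by rewrite ImM/= mul0r addr0.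
Qed.

Variable psi : R -> R[i].
Hypothesis spsi : schwartz psi.

Lemma fourierE (xi : R) : fourier psi xi = ((2 * pi)^-1)%:C * inv_fourier psi (- xi).
Proof.
rewrite /fourier /inv_fourier; congr (_ * _); apply: eq_cintegral => x.
by congr (expi _ * _); rewrite mulNr mulrC.
Qed.

Let ipsi := schwartz_cintegrable spsi.
Let mpsi := schwartz_cmeasurable spsi.

Lemma cmeasurable_fourier : cmeasurable (fourier psi : measurableTypeR R -> R[i]).
Proof.
rewrite (_ : fourier psi = fun xi => ((2 * pi)^-1)%:C * inv_fourier psi (- xi)); last first.
  by apply/funext => xi; rewrite fourierE.
apply: cmeasurableM; first by apply: cmeasurable_real; meas.
have [m1 m2] := cmeasurable_inv_fourier mpsi.
by split; [apply: (measurableT_comp m1); meas|apply: (measurableT_comp m2); meas].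
Qed.

Lemma cintegrable_fourier : cintegrable leb (fourier psi).
Proof.
have [B hB] := inv_fourier_decay spsi.
apply: (cintegrable_le cmeasurable_fourier (integrable_invD1sqr ((2 * pi)^-1 * B))) => xi.
rewrite fourierE Normc.normcM normc_real ger0_norm ?invr_ge0 ?mulr_ge0 ?pi_ge0//.
rewrite -mulrA ler_wpM2l ?invr_ge0 ?mulr_ge0 ?pi_ge0//.
by have := quadratic_decay_le (- xi) hB; rewrite ger0_norm ?normc_ge0// sqrrN.
Qed.

(** The Abel weight makes the double integral absolutely convergent; integrating in frequency first
    turns it into the Poisson kernel centred at x. *)
Let regularized (x e : R) : 0 < e ->
  cintegral leb (fun xi => (wt e xi)%:C * (expi (x * xi) * fourier psi xi)) =
  ((2 * pi)^-1)%:C * cintegral leb (fun y => (pk e (x - y))%:C * psi y).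
Proof.
move=> e0.
pose F (z : RR) : R[i] := ((wt e z.1)%:C * expi (x * z.1 - z.2 * z.1)) * psi z.2.
have mw := @measurable_wt R e.
have m2 : cmeasurable (fun z : RR => psi z.2).
  by case: mpsi => p1 p2; split; [exact: (measurableT_comp p1 measurable_snd)|exact: (measurableT_comp p2 measurable_snd)].
have mF : cmeasurable F.
  apply: cmeasurableM => //; apply: cmeasurableM; first by apply: cmeasurable_real; meas.
  by apply: cmeasurable_expi; meas.
have iF : cintegrable leb2 F.
  apply: (@cintegrable_le _ _ _ _ _ (fun z : RR => wt e z.1 * normc (psi z.2)) mF).
    exact: (integrable_tensor (integrable_wt e0) (integrable_normc ipsi)).
  by move=> z; rewrite /F !Normc.normcM normc_expi mulr1 normc_real ger0_norm ?wt_ge0.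
have iW : cintegrable leb (fun xi => (wt e xi)%:C * (expi (x * xi) * fourier psi xi)).
  have mfo := cmeasurable_fourier.
  apply: (cintegrable_le _ (integrable_normc cintegrable_fourier)) => [|xi].
    apply: cmeasurableM; first by apply: cmeasurable_real; meas.
    by apply: cmeasurableM => //; apply: cmeasurable_expi; meas.
  rewrite Normc.normcM [normc (expi _ * _)]Normc.normcM normc_expi mul1r normc_real ger0_norm ?wt_ge0//.
  by rewrite ler_piMl ?normc_ge0// wt_le1// ltW.
have iwt (a : R) : cintegrable leb (fun xi => (wt e xi)%:C * expi (a * xi)).
  apply: (cintegrable_le _ (integrable_wt e0)) => [|xi].
    by apply: cmeasurableM; [apply: cmeasurable_real; meas|apply: cmeasurable_expi; meas].
  by rewrite !Normc.normcM normc_expi mulr1 normc_real ger0_norm ?wt_ge0.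
have c1 : ((2 * pi)^-1)%:C * (2 * pi)%:C = 1 :> R[i].
  by rewrite -rmorphM mulVf ?rmorph1// gt_eqF// mulr_gt0// pi_gt0.
transitivity (((2 * pi)^-1)%:C * cintegral leb (fun xi => cintegral leb (fun y => F (xi, y)))).
  transitivity (((2 * pi)^-1)%:C * ((2 * pi)%:C * cintegral leb (fun xi => (wt e xi)%:C * (expi (x * xi) * fourier psi xi)))).
    by rewrite mulrA c1 mul1r.
  rewrite -cintegralZl//; congr (_ * _); apply: eq_cintegral => xi; rewrite /fourier.
  transitivity (((2 * pi)^-1)%:C * (2 * pi)%:C * (((wt e xi)%:C * expi (x * xi)) * cintegral leb (fun y => expi (- (y * xi)) * psi y))).
    by move: (cintegral _ _) (expi _) (_%:C) (_%:C) (_%:C) => u1 u2 u3 u4 u5; ring.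
  rewrite c1 mul1r -cintegralZl; last by apply: cintegrable_expiM => //; meas.
  by apply: eq_cintegral => y; rewrite /F/= expiD !mulrA.
congr (_ * _); rewrite (cFubini iF); apply: eq_cintegral => y.
rewrite -cintegral_wt_expi// [RHS]mulrC -cintegralZl//.
apply: eq_cintegral => xi; rewrite /F/= mulrC; congr (_ * (_ * expi _)).
by ring.
Qed.

Let eps (n : nat) : R := n.+1%:R^-1.

Let eps0 n : 0 < eps n. Proof. by rewrite invr_gt0. Qed.

Let cvg_eps (v : R) : eps n * v @[n --> \oo] --> 0.
Proof. by rewrite -(mul0r v); apply: cvgMl; exact: cvg_harmonic. Qed.

Let continuous_part (re : bool) : continuous (fun x : R => if re then complex.Re (psi x) else complex.Im (psi x)).
Proof.
have [B [f0 [f1 [f2 [[E d0 _ _] _]]]]] := schwartz_part_smooth re spsi.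
rewrite (_ : (fun x : R => _) = f0); last by rewrite E.
by move=> x; exact: der_continuous (d0 x).
Qed.

(** The substitution y = x - eps v replaces the shrinking kernel by the fixed [pk 1] of mass 2 pi;
    continuity of psi and dominated convergence then give the limit. *)
Let cvg_regularized (x : R) :
  complex.Re (cintegral leb (fun y => (pk (eps n) (x - y))%:C * psi y)) @[n --> \oo] --> complex.Re ((2 * pi)%:C * psi x) /\
  complex.Im (cintegral leb (fun y => (pk (eps n) (x - y))%:C * psi y)) @[n --> \oo] --> complex.Im ((2 * pi)%:C * psi x).
Proof.
have mp e := @measurable_pk R e.
have [B hB] := schwartz_decay spsi.
have psiB y : normc (psi y) <= B.
  by have := quadratic_decay_bounded y hB; rewrite ger0_norm ?normc_ge0.
have E n : cintegral leb (fun y => (pk (eps n) (x - y))%:C * psi y) =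
    cintegral leb (fun v => psi (x - eps n * v) * (pk 1 v)%:C).
  have i1 : cintegrable leb (fun y => (pk (eps n) (x - y))%:C * psi y).
    have mpe := mp (eps n).
    have ib : leb.-integrable setT (EFin \o (fun y => pk (eps n) 0 * normc (psi y))).
      have := integrableZl measurableT (pk (eps n) 0) (integrable_normc ipsi).
      by apply: eq_integrable => // y _; rewrite /= EFinM.
    apply: (cintegrable_le _ ib).
    - by apply: cmeasurableM => //; apply: cmeasurable_real; meas.
    - move=> y; rewrite Normc.normcM normc_real ler_wpM2r ?normc_ge0//.
      by rewrite ger0_norm ?pk_ge0 ?(ltW (eps0 n))// pk_le_pk0.
  rewrite (cintegral_affine x (eps0 n) i1); apply: eq_cintegral => v.
  rewrite opprB addrC subrK mulrA -rmorphM pk_scale// mulrC.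
  by [].
have ipk : leb.-integrable setT (EFin \o (fun v => B * pk 1 v)).
  have i0 : leb.-integrable setT (EFin \o pk 1).
    have mp1 := mp 1; apply/integrableP; split; first by meas.
    under eq_integral do rewrite /= ger0_norm ?pk_ge0//.
    by rewrite ge0_integral_pk// ltry.
  by have := integrableZl measurableT B i0; apply: eq_integrable => // v _; rewrite /= EFinM.
have cx v : x - eps n * v @[n --> \oo] --> x.
  by rewrite -[X in _ --> X]subr0; apply: cvgB; [exact: cvg_cst|exact: cvg_eps].
have cR v : complex.Re (psi (x - eps n * v)) @[n --> \oo] --> complex.Re (psi x).
  apply: (@cvg_comp _ _ _ (fun n => x - eps n * v) (fun z => complex.Re (psi z)) \oo (nbhs x) _ (cx v)).
  exact: (@continuous_part true x).
have cI v : complex.Im (psi (x - eps n * v)) @[n --> \oo] --> complex.Im (psi x).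
  apply: (@cvg_comp _ _ _ (fun n => x - eps n * v) (fun z => complex.Im (psi z)) \oo (nbhs x) _ (cx v)).
  exact: (@continuous_part false x).
have mp1 := mp 1.
have mF n : cmeasurable (fun v : measurableTypeR R => psi (x - eps n * v) * (pk 1 v)%:C).
  apply: cmeasurableM; last by apply: cmeasurable_real; exact: mp1.
  by case: mpsi => m1 m2; split; [apply: (measurableT_comp m1); meas|apply: (measurableT_comp m2); meas].
have mf : cmeasurable (fun v : measurableTypeR R => psi x * (pk 1 v)%:C).
  by apply: cmeasurableM; [split; exact: measurable_cst|apply: cmeasurable_real; exact: mp1].
have bF n v : normc (psi (x - eps n * v) * (pk 1 v)%:C) <= B * pk 1 v.
  by rewrite Normc.normcM normc_real [`|pk 1 v|]ger0_norm ?pk_ge0// ler_wpM2r ?pk_ge0.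
have [_ lR lI] := @cdominated_convergence _ (measurableTypeR R) R leb (fun=> True) (fun n v => psi (x - eps n * v) * (pk 1 v)%:C)
  (fun v => psi x * (pk 1 v)%:C) _ (aeW _ (fun=> I)) mF mf ipk
  (fun v _ => cvg_Re_mul (cR v) (cI v)) (fun v _ => cvg_Im_mul (cR v) (cI v)) (fun n v _ => bF n v).
have lim : cintegral leb (fun v => psi x * (pk 1 v)%:C) = (2 * pi)%:C * psi x.
  have ip1 : cintegrable leb (fun v => (pk 1 v)%:C).
    have ib : leb.-integrable setT (EFin \o pk 1).
      apply/integrableP; split; first by meas.
      under eq_integral do rewrite /= ger0_norm ?pk_ge0//.
      by rewrite ge0_integral_pk// ltry.
    apply: (cintegrable_le _ ib); first by apply: cmeasurable_real; exact: mp1.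
    by move=> v; rewrite normc_real ger0_norm ?pk_ge0.
  rewrite cintegralZl// mulrC; congr (_ * _).
  by rewrite /cintegral /Rintegral/= ge0_integral_pk//= integral0.
have ER : (fun n => complex.Re (cintegral leb (fun y => (pk (eps n) (x - y))%:C * psi y))) =
    (fun n => complex.Re (cintegral leb (fun v => psi (x - eps n * v) * (pk 1 v)%:C))).
  by apply/funext => n; rewrite E.
have EI : (fun n => complex.Im (cintegral leb (fun y => (pk (eps n) (x - y))%:C * psi y))) =
    (fun n => complex.Im (cintegral leb (fun v => psi (x - eps n * v) * (pk 1 v)%:C))).
  by apply/funext => n; rewrite E.
by rewrite -lim ER EI; split.
Qed.

(** The regularised integral has two limits: the inverse transform, because the weights tend to 1,
    and psi x, because the Poisson kernel concentrates. Its mass 2 pi cancels the normalisation of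
    [fourier]. *)
Lemma fourier_inversion (x : R) : inv_fourier (fourier psi) x = psi x.
Proof.
have c1 : ((2 * pi)^-1)%:C * (2 * pi)%:C = 1 :> R[i].
  by rewrite -rmorphM mulVf ?rmorph1// gt_eqF// mulr_gt0// pi_gt0.
have [rR rI] := cvg_regularized x.
have mfo := cmeasurable_fourier.
have iA : cintegrable leb (fun xi => expi (x * xi) * fourier psi xi).
  by apply: cintegrable_expiM; [meas|exact: cintegrable_fourier].
have mw n := @measurable_wt R (eps n).
have mF n : cmeasurable (fun xi : measurableTypeR R => (expi (x * xi) * fourier psi xi) * (wt (eps n) xi)%:C).
  by apply: cmeasurableM; [exact: cintegrable_cmeasurable iA|apply: cmeasurable_real; exact: mw].
have cw xi : wt (eps n) xi @[n --> \oo] --> (1 : R) by exact: cvg_wt.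
have c0 : (0 : R) @[n --> \oo] --> (0 : R) by exact: cvg_cst.
have cR xi : complex.Re ((expi (x * xi) * fourier psi xi) * (wt (eps n) xi)%:C) @[n --> \oo] --> complex.Re (expi (x * xi) * fourier psi xi).
  have := @cvg_Re_mul _ (fun n => (wt (eps n) xi)%:C) 1 (expi (x * xi) * fourier psi xi) (cw xi) c0.
  rewrite mul1r (_ : (fun k => _) = (fun n => complex.Re ((expi (x * xi) * fourier psi xi) * (wt (eps n) xi)%:C)))//.
  by apply/funext => n; rewrite mulrC.
have cI xi : complex.Im ((expi (x * xi) * fourier psi xi) * (wt (eps n) xi)%:C) @[n --> \oo] --> complex.Im (expi (x * xi) * fourier psi xi).
  have := @cvg_Im_mul _ (fun n => (wt (eps n) xi)%:C) 1 (expi (x * xi) * fourier psi xi) (cw xi) c0.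
  rewrite mul1r (_ : (fun k => _) = (fun n => complex.Im ((expi (x * xi) * fourier psi xi) * (wt (eps n) xi)%:C)))//.
  by apply/funext => n; rewrite mulrC.
have bF n xi : normc ((expi (x * xi) * fourier psi xi) * (wt (eps n) xi)%:C) <= normc (expi (x * xi) * fourier psi xi).
  rewrite Normc.normcM [normc (wt _ _)%:C]normc_real ger0_norm ?wt_ge0//.
  by rewrite ler_piMr ?normc_ge0// wt_le1// ltW.
have [_ lR lI] := @cdominated_convergence _ (measurableTypeR R) R leb (fun=> True) (fun n xi => (expi (x * xi) * fourier psi xi) * (wt (eps n) xi)%:C)
  (fun xi => expi (x * xi) * fourier psi xi) _ (aeW _ (fun=> I)) mF (cintegrable_cmeasurable iA) (integrable_normc iA)
  (fun xi _ => cR xi) (fun xi _ => cI xi) (fun n xi _ => bF n xi).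
have E n : cintegral leb (fun xi => (expi (x * xi) * fourier psi xi) * (wt (eps n) xi)%:C) =
   cintegral leb (fun y => (pk (eps n) (x - y))%:C * psi y) * ((2 * pi)^-1)%:C.
  by rewrite [RHS]mulrC -regularized//; apply: eq_cintegral => xi; rewrite mulrC.
have RE : (fun n => complex.Re (cintegral leb (fun xi => (expi (x * xi) * fourier psi xi) * (wt (eps n) xi)%:C))) =
   (fun n => complex.Re (cintegral leb (fun y => (pk (eps n) (x - y))%:C * psi y) * ((2 * pi)^-1)%:C)).
  by apply/funext => n; rewrite E.
have IE : (fun n => complex.Im (cintegral leb (fun xi => (expi (x * xi) * fourier psi xi) * (wt (eps n) xi)%:C))) =
   (fun n => complex.Im (cintegral leb (fun y => (pk (eps n) (x - y))%:C * psi y) * ((2 * pi)^-1)%:C)).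
  by apply/funext => n; rewrite E.
rewrite RE in lR; rewrite IE in lI.
have e1 : psi x = (2 * pi)%:C * psi x * ((2 * pi)^-1)%:C by rewrite mulrC mulrA c1 mul1r.
rewrite [RHS]e1 [LHS]complex_eta [RHS]complex_eta; congr (_ +i* _).
  exact: (cvg_unique _ lR (cvg_Re_mul rR rI)).
exact: (cvg_unique _ lI (cvg_Im_mul rR rI)).
Qed.

End fourier_inversion.

(** * Uniqueness of the representing function *)

Section schwartz_test_functions.
Context {R : realType}.
Local Notation leb := (@lebesgue_measure R).

(* A smooth step: it converges to the indicator of x < a as c tends to +oo,
   and its derivative is a polynomial in itself. *)
Definition step (c a x : R) : R := (1 + expR (c * (x - a)))^-1.

Lemma step_gt0 (c a x : R) : 0 < step c a x.
Proof. by rewrite invr_gt0 addr_gt0 ?expR_gt0. Qed.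

Lemma step_le1 (c a x : R) : step c a x <= 1.
Proof. by rewrite invf_le1 ?addr_gt0 ?expR_gt0// lerDl expR_ge0. Qed.

Lemma is_derive_step (c a x : R) :
  is_derive x 1 (step c a) (- c * step c a x * (1 - step c a x)).
Proof.
have h : 1 + expR (c * (x - a)) != 0 by rewrite gt_eqF// addr_gt0 ?expR_gt0.
rewrite /step; der_to; [der|cbv beta].
  exact: h.
by field.
Qed.

(** The algebra generated by the constants, x and one step is closed under differentiation and has
    polynomial growth, so its members become Schwartz functions after multiplication by a
    Gaussian. *)
Inductive step_algebra (c a : R) : (R -> R) -> Prop :=
| step_algebra_cst (k : R) : step_algebra c a (fun=> k)
| step_algebra_id : step_algebra c a (fun x => x)
| step_algebra_step : step_algebra c a (step c a)
| step_algebraD f g : step_algebra c a f -> step_algebra c a g -> step_algebra c a (fun x => f x + g x)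
| step_algebraM f g : step_algebra c a f -> step_algebra c a g -> step_algebra c a (fun x => f x * g x).

Lemma step_algebra_derive (c a : R) f : step_algebra c a f ->
  exists f', step_algebra c a f' /\ forall x : R, is_derive x 1 f (f' x).
Proof.
elim=> [k|||{}f g fA [f' [f'A df]] gA [g' [g'A dg]]|{}f g fA [f' [f'A df]] gA [g' [g'A dg]]].
- by exists (fun=> 0); split; [exact: step_algebra_cst|move=> x; der_to; [der|]].
- by exists (fun=> 1); split; [exact: step_algebra_cst|move=> x; der_to; [der|]].
- exists (fun x => (- c * step c a x) * (1 + -1 * step c a x)); split.
    apply: step_algebraM; first by apply: step_algebraM; [exact: step_algebra_cst|exact: step_algebra_step].
    apply: step_algebraD; first exact: step_algebra_cst.
    by apply: step_algebraM; [exact: step_algebra_cst|exact: step_algebra_step].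
  by move=> x; have := is_derive_step c a x; rewrite mulN1r.
- exists (fun x => f' x + g' x); split; first exact: step_algebraD.
  by move=> x; have dfx := df x; have dgx := dg x; der_to; [der|].
- exists (fun x => f' x * g x + f x * g' x); split.
    by apply: step_algebraD; exact: step_algebraM.
  by move=> x; have dfx := df x; have dgx := dg x; der_to; [der|cbv beta; ring].
Qed.

Lemma step_algebra_growth (c a : R) f : step_algebra c a f ->
  exists (C : R) (m : nat), 0 <= C /\ forall x, `|f x| <= C * (1 + x ^+ 2) ^+ m.
Proof.
have D1 (x : R) : 1 <= 1 + x ^+ 2 by rewrite lerDl sqr_ge0.
have Dn (x : R) m : 0 <= (1 + x ^+ 2) ^+ m by rewrite exprn_ge0// ltW// sqrD1_gt0.
have up (x : R) m n : (1 + x ^+ 2) ^+ m <= (1 + x ^+ 2) ^+ (m + n) by rewrite ler_weXn2l// leq_addr.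
elim=> [k|||{}f g fA [B [m [B0 hf]]] gA [C [n [C0 hg]]]|{}f g fA [B [m [B0 hf]]] gA [C [n [C0 hg]]]].
- by exists `|k|, 0%N; split => // x; rewrite expr0 mulr1.
- exists 1, 1%N; split => // x; rewrite mul1r expr1 -[x ^+ 2]real_normK ?num_real//.
  by move: `|x| => y; nra.
- exists 1, 0%N; split => // x; rewrite expr0 mulr1 ger0_norm ?step_le1//.
  by rewrite ltW// step_gt0.
- exists (B + C), (m + n)%N; split; first exact: addr_ge0.
  move=> x; apply: (le_trans (ler_normD _ _)); rewrite mulrDl; apply: lerD.
    by apply: (le_trans (hf x)); rewrite ler_wpM2l.
  by apply: (le_trans (hg x)); rewrite ler_wpM2l// addnC.
- exists (B * C), (m + n)%N; split; first exact: mulr_ge0.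
  move=> x; rewrite normrM exprD mulrACA; apply: ler_pM => //.
Qed.

Let gauss (x : R) : R := expR (- x ^+ 2).

(** A single term of the exponential series at 1 + x^2 controls the power. Its exponent is raised to
    m + 1 to be positive, which is harmless as 1 + x^2 >= 1. *)
Lemma gauss_moment (m : nat) (x : R) : (1 + x ^+ 2) ^+ m * gauss x <= m.+1`!%:R * expR 1.
Proof.
have D1 : 1 <= 1 + x ^+ 2 by rewrite lerDl sqr_ge0.
have D0 : 0 <= 1 + x ^+ 2 by exact: le_trans D1.
have F0 : 0 < m.+1`!%:R :> R by rewrite ltr0n fact_gt0.
have H : (1 + x ^+ 2) ^+ m.+1 <= m.+1`!%:R * expR (1 + x ^+ 2).
  rewrite mulrC -ler_pdivrMr//; apply: le_trans (expR_ge1Dxn m D0).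
  by rewrite lerDr.
apply: (@le_trans _ _ ((1 + x ^+ 2) ^+ m.+1 * gauss x)).
  by rewrite ler_wpM2r ?expR_ge0// ler_weXn2l.
apply: (le_trans (ler_wpM2r (expR_ge0 _) H)).
by rewrite -mulrA -expRD addrK.
Qed.

(** Differentiation replaces the factor h of the Gaussian by h' - 2 x h, which is again in the
    algebra. *)
Lemma step_algebra_derive1n (c a : R) (n : nat) f : step_algebra c a f ->
  exists h, step_algebra c a h /\
    derive1n n (fun x => f x * gauss x) = (fun x => h x * gauss x).
Proof.
move=> fA; elim: n => [|n [h [hA hE]]]; first by exists f.
have [h' [h'A dh]] := step_algebra_derive hA.
exists (fun x => h' x + (-2 * x) * h x); split.
  apply: step_algebraD => //; apply: step_algebraM => //.
  by apply: step_algebraM; [exact: step_algebra_cst|exact: step_algebra_id].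
rewrite derive1nS hE; apply/funext => x; rewrite derive1E; apply: derive_val.
by have dhx := dh x; rewrite /gauss; der_to; [der|cbv beta; ring].
Qed.

Lemma derive1n_cst0 (n : nat) : derive1n n (fun=> 0 : R) = (fun=> 0).
Proof.
elim: n => // n IHn; rewrite derive1nS IHn; apply/funext => x; exact: derive1_cst.
Qed.

Lemma schwartz_step_algebra (c a : R) f : step_algebra c a f ->
  schwartz (fun x => (f x * gauss x)%:C).
Proof.
move=> fA; split => [n x|k n].
  have [h [hA hE]] := step_algebra_derive1n n fA.
  rewrite (_ : complex.Re (R:=R) \o _ = fun x => f x * gauss x)//.
  rewrite (_ : complex.Im (R:=R) \o _ = fun=> 0)// derive1n_cst0 hE; split; last exact: derivable_cst.
  have [h' [h'A dh]] := step_algebra_derive hA; have dhx := dh x.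
  apply: (@ex_derive _ _ _ _ _ _ (h' x * gauss x + (-2 * x * h x) * gauss x)).
  by rewrite /gauss; der_to; [der|cbv beta; ring].
have [h [hA hE]] := step_algebra_derive1n n fA.
have [C [m [C0 hC]]] := step_algebra_growth hA.
apply: (@le_lt_trans _ _ (C * ((k + m).+1`!%:R * expR 1))%:E); last exact: ltry.
apply: ge_ereal_sup => _ [x _ <-]; rewrite lee_fin /cderiven.
rewrite (_ : complex.Re (R:=R) \o _ = fun x => f x * gauss x)//.
rewrite (_ : complex.Im (R:=R) \o _ = fun=> 0)// derive1n_cst0 hE normc_real normrM.
rewrite [`|gauss x|]ger0_norm ?expR_ge0//.
apply: le_trans (ler_wpM2l C0 (gauss_moment (k + m) x)).
have xk : `|x| ^+ k <= (1 + x ^+ 2) ^+ k.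
  apply: lerXn2r; rewrite ?nnegrE ?normr_ge0 ?(ltW (sqrD1_gt0 _))//.
  by rewrite -[x ^+ 2]real_normK ?num_real//; move: `|x| => y; nra.
rewrite !mulrA ler_wpM2r ?expR_ge0// exprD mulrCA mulrA -mulrA.
by apply: ler_pM => //; rewrite exprn_ge0.
Qed.

Lemma cvg_step (a x : R) : x != a ->
  step n%:R a x @[n --> \oo] --> (if x <= a then 1 else 0 : R).
Proof.
have neg (y : R) : y < 0 -> expR (n%:R * y) @[n --> \oo] --> 0.
  move=> y0; rewrite (_ : (fun n => _) = (fun n => expR y ^+ n)); last first.
    by apply/funext => n; rewrite expRM_natl.
  by apply: cvg_expr; rewrite ger0_norm ?expR_ge0// expR_lt1.
move=> xa; case: ifPn => [le|].
  have lt : x - a < 0 by rewrite subr_lt0 lt_neqAle xa.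
  rewrite /step -[X in _ --> X]invr1; apply: cvgV; first exact: oner_neq0.
  by rewrite -[X in _ --> X]addr0; apply: cvgD; [exact: cvg_cst|exact: neg].
rewrite -ltNge => lt; have lt' : a - x < 0 by rewrite subr_lt0.
apply: (@squeeze_cvgr _ _ _ _ (fun=> 0) (fun n => expR (n%:R * (a - x)))).
- apply: nearW => n; rewrite ltW ?step_gt0//=.
  rewrite /step (_ : n%:R * (a - x) = - (n%:R * (x - a))); last by rewrite -mulrN opprB.
  rewrite expRN lef_pV2 ?posrE ?addr_gt0 ?expR_gt0//.
  by rewrite lerDr.
- exact: cvg_cst.
- exact: neg.
Qed.

(** As the steps sharpen, k times the Gaussian is seen to have integral 0 over each half line ]-oo,
    a]. Its primitive is thus constant, Lebesgue differentiation gives 0 almost everywhere, and the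
    Gaussian has no zero. *)
Lemma step_orthogonal_ae0 (k : R -> R) :
  (forall c a f, step_algebra c a f -> leb.-integrable setT (EFin \o (fun x => k x * (f x * gauss x))) /\
     \int[leb]_x (k x * (f x * gauss x)) = 0) ->
  {ae leb, forall x, k x = 0}.
Proof.
move=> H; pose K x := k x * gauss x.
have iK : leb.-integrable setT (EFin \o K).
  have [i1 _] := H 0 0 _ (step_algebra_cst 0 0 1).
  by apply: eq_integrable i1 => // x _ /=; rewrite mul1r.
have mK : measurable_fun [set: measurableTypeR R] K.
  by apply/measurable_EFinP; exact: measurable_int iK.
have int0 (a : R) : \int[leb]_(x in `]-oo, a]) K x = 0.
  have ms n : measurable_fun [set: measurableTypeR R] (step n%:R a) by rewrite /step; meas.
  have mf : measurable_fun [set: measurableTypeR R] (fun x => if x <= a then K x else 0) by meas.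
  have cR x : x != a -> K x * step n%:R a x @[n --> \oo] --> (if x <= a then K x else 0).
    move=> xa; have cK : K x @[n --> \oo] --> K x by exact: cvg_cst.
    have : K x * step n%:R a x @[n --> \oo] --> K x * (if x <= a then 1 else 0).
      by apply: cvgM => //; exact: cvg_step.
    by case: ifP; rewrite ?mulr1 ?mulr0.
  have aeA : {ae leb, forall x, x != a}.
    exists [set a]; split => //; first exact: lebesgue_measure_set1.
    by move=> x /= /negP; rewrite negbK => /eqP.
  have mF n : cmeasurable (fun x : measurableTypeR R => (K x * step n%:R a x)%:C).
    by have msn := ms n; apply: cmeasurable_real; meas.
  have c0 (x : R) : x != a -> (0 : R) @[n --> \oo] --> (0 : R) by move=> _; exact: cvg_cst.
  have bF n x : x != a -> normc (K x * step n%:R a x)%:C <= `|K x|.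
    move=> _; rewrite normc_real normrM ler_piMr//.
    by rewrite ger0_norm ?step_le1// ltW// step_gt0.
  have [_ cv _] := @cdominated_convergence _ (measurableTypeR R) R leb (fun x => x != a) (fun n x => (K x * step n%:R a x)%:C)
    (fun x => (if x <= a then K x else 0)%:C) (fun x => `|K x|) aeA mF (cmeasurable_real mf) (integrable_abse iK) cR c0 bF.
  have E0 n : \int[leb]_x (K x * step n%:R a x) = 0.
    have [_ <-] := H n%:R a _ (step_algebra_step n%:R a).
    by apply: eq_Rintegral => x _; rewrite /K -mulrA [gauss x * _]mulrC.
  have E : (fun n => complex.Re (cintegral leb (fun x : measurableTypeR R => (K x * step n%:R a x)%:C))) = (fun=> 0).
    by apply/funext => n; exact: E0.
  rewrite E in cv; have lim0 : \int[leb]_x (if x <= a then K x else 0) = 0.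
    exact: (cvg_unique _ cv (cvg_cst 0)).
  rewrite -[RHS]lim0 Rintegral_mkcond; apply: eq_Rintegral => x _.
  by rewrite patchE mem_setE in_itv/=.
have iKy y : leb.-integrable `]-oo, y] (EFin \o K) by apply: integrableS iK.
have := FTC1Ny iKy (open_integrable_locally openT iK).
apply: (@filterS _ _ (ae_filter_ringOfSetsType leb)) => x [_]; rewrite (_ : (fun y => _) = fun=> 0); last by apply/funext => y; rewrite int0.
rewrite derive1_cst /K => /esym/eqP; rewrite mulf_eq0 => /orP[/eqP//|].
by rewrite gt_eqF// expR_gt0.
Qed.

(** The test functions used are real-valued, so the real and the imaginary part of g are orthogonal
    to them separately. *)
Lemma schwartz_orthogonal_ae0 (g : R -> R[i]) :
  (forall psi, schwartz psi -> cintegrable leb (fun x => g x * psi x) /\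
     cintegral leb (fun x => g x * psi x) = 0) ->
  {ae leb, forall x, g x = 0}.
Proof.
move=> H.
have r0 : {ae leb, forall x, complex.Re (g x) = 0}.
  apply: step_orthogonal_ae0 => c a f fA; have [[i1 _] [E _]] := H _ (schwartz_step_algebra fA).
  split; first by apply: eq_integrable i1 => // x _; rewrite /= ReM/= mulr0 subr0.
  by rewrite -[RHS]E; apply: eq_Rintegral => x _; rewrite /= ReM/= mulr0 subr0.
have i0 : {ae leb, forall x, complex.Im (g x) = 0}.
  apply: step_orthogonal_ae0 => c a f fA; have [[_ i1] [_ E]] := H _ (schwartz_step_algebra fA).
  split; first by apply: eq_integrable i1 => // x _; rewrite /= ImM/= mulr0 add0r.
  by rewrite -[RHS]E; apply: eq_Rintegral => x _; rewrite /= ImM/= mulr0 add0r.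
apply: (@filterS2 _ _ (ae_filter_ringOfSetsType leb) _ _ _ _ r0 i0) => x h1 h2.
by rewrite [g x]complex_eta h1 h2.
Qed.

End schwartz_test_functions.

Section represented_distributions.
Context {R : realType}.
Local Notation leb := (@lebesgue_measure R).

Lemma ae_eq_cintegral (f g : R -> R[i]) :
  cmeasurable (f : measurableTypeR R -> R[i]) -> cmeasurable (g : measurableTypeR R -> R[i]) ->
  {ae leb, forall x, f x = g x} -> cintegral leb f = cintegral leb g.
Proof.
move=> [f1 f2] [g1 g2] fg; rewrite /cintegral /Rintegral; congr (fine _ +i* fine _).
- apply: ae_eq_integral => //; [by apply/measurable_EFinP|by apply/measurable_EFinP|].
  by apply: (@filterS _ _ (ae_filter_ringOfSetsType leb) _ _ _ fg) => x /= ->.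
- apply: ae_eq_integral => //; [by apply/measurable_EFinP|by apply/measurable_EFinP|].
  by apply: (@filterS _ _ (ae_filter_ringOfSetsType leb) _ _ _ fg) => x /= ->.
Qed.

Lemma represents_ae_unique (T : distr R) (f g : R -> R[i]) :
  represents T f -> represents T g -> {ae leb, forall x, f x = g x}.
Proof.
move=> [mf Hf] [mg Hg].
suff : {ae leb, forall x, f x - g x = 0}.
  apply: (@filterS _ _ (ae_filter_ringOfSetsType leb)) => x /eqP.
  by rewrite subr_eq0 => /eqP.
apply: schwartz_orthogonal_ae0 => psi spsi.
have [if_ Ef] := Hf _ spsi; have [ig Eg] := Hg _ spsi.
have E : (fun x => (f x - g x) * psi x) = (fun x => f x * psi x - g x * psi x).
  by apply/funext => x; rewrite mulrBl.
rewrite E; split; last by rewrite cintegralB// -Ef -Eg subrr.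
have ib : leb.-integrable setT (EFin \o (fun x => normc (f x * psi x) + normc (g x * psi x))).
  have := integrableD measurableT (integrable_normc if_) (integrable_normc ig).
  by apply: eq_integrable.
apply: (cintegrable_le _ ib).
  exact: (cmeasurableB (cintegrable_cmeasurable if_) (cintegrable_cmeasurable ig)).
by move=> x; apply: (le_trans (le_normcD _ _)); rewrite normcN.
Qed.

(** The choice made by [xget] is a genuine representative as soon as one exists. *)
Lemma represents_hat (phi : distr R) (g : R -> R[i]) :
  represents (dfourier phi) g -> represents (dfourier phi) (hat phi).
Proof. by move=> H; exact: (@xgetI _ (fun=> 0) [set g | represents (dfourier phi) g] g). Qed.

(** Evaluating the transform of the multiplied distribution at psi produces
    [inv_fourier (fourier psi)], which is psi; the bound on m keeps the pairing integrable. *)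
Lemma hat_fourier_multiplier (m : R -> R[i]) (phi : distr R) :
  cmeasurable (m : measurableTypeR R -> R[i]) -> (forall x, normc (m x) <= 1) ->
  represents (dfourier phi) (hat phi) ->
  represents (dfourier (fourier_multiplier m phi)) (fun xi => m xi * hat phi xi).
Proof.
move=> mm m1 [mh Hh]; split; first exact: cmeasurableM.
move=> psi spsi; have [ih _] := Hh _ spsi; split.
  apply: (cintegrable_le _ (integrable_normc ih)) => [|x].
    under eq_fun do rewrite -mulrA.
    by apply: cmeasurableM => //; exact: cintegrable_cmeasurable ih.
  rewrite -mulrA Normc.normcM ler_piMl ?normc_ge0//.
rewrite /dfourier /fourier_multiplier /dinv_fourier /fun_distr.
by apply: eq_cintegral => xi; rewrite fourier_inversion.
Qed.

Lemma near_powR_integrable (c : R) : 0 < c ->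
  leb.-integrable setT (EFin \o (fun x : R => if (0 < `|x|) && (`|x| <= 1) then `|x| `^ (c - 1) else 0)).
Proof.
move=> c0; pose f (y : R) := if (0 < y) && (y <= 1) then y `^ (c - 1) else 0.
have f0 y : 0 <= f y by rewrite /f; case: ifP => // _; exact: powR_ge0.
have mf : measurable_fun [set: measurableTypeR R] f by rewrite /f; meas.
apply/integrableP; split; first by meas.
under eq_integral do rewrite /= ger0_norm ?(f0 `|_|)//.
have E : (\int[leb]_x (f `|x|)%:E = \int[leb]_x (f `|0 - x|)%:E)%E.
  by apply: eq_integral => x _; rewrite sub0r normrN.
rewrite -/(f _) E ge0_integral_radial//; last by rewrite /f ltxx.
rewrite lte_mul_pinfty ?lee_fin//.
apply: (@le_lt_trans _ _ (\int[leb]_y (f y)%:E)%E).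
  apply: ge0_subset_integral => //; first by meas.
  by move=> y _; rewrite lee_fin.
by rewrite /f ge0_integral_powR_below// ltry.
Qed.

(** Near 0 the transform is bounded and |xi|^s is integrable because s > -1; away from 0 the power
    is at most 1 because s <= 0, and the transform decays quadratically. *)
Lemma integrable_powR_inv_fourier (psi : R -> R[i]) (s P : R) : schwartz psi ->
  -1 < s -> s <= 0 -> 1 <= P ->
  leb.-integrable setT (EFin \o (fun xi => `|xi| `^ s * normc (inv_fourier psi xi) `^ P)).
Proof.
move=> spsi s1 s0 P1; have [B hB] := inv_fourier_decay spsi.
have P0 : 0 <= P by exact: le_trans P1.
have B0 := quadratic_decay_ge0 hB.
have mi := measurable_normc (cmeasurable_inv_fourier (schwartz_cmeasurable spsi)).
pose near (x : R) := if (0 < `|x|) && (`|x| <= 1) then `|x| `^ (s + 1 - 1) else 0.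
have near0 x : 0 <= near x by rewrite /near; case: ifP => // _; exact: powR_ge0.
have inear : leb.-integrable setT (EFin \o near).
  by apply: near_powR_integrable; rewrite -ltrBlDr sub0r.
have ib : leb.-integrable setT (EFin \o (fun x => B `^ P * near x + B `^ P / (1 + x ^+ 2))).
  have := integrableD measurableT (integrableZl measurableT (B `^ P) inear) (integrable_invD1sqr (B `^ P)).
  by apply: eq_integrable => // x _; rewrite /= EFinD EFinM.
apply: le_integrable ib => //; first by meas.
move=> x _; rewrite /= lee_fin.
have D1 : 1 <= 1 + x ^+ 2 by rewrite lerDl sqr_ge0.
have D0 := sqrD1_gt0 x.
have BP0 : 0 <= B `^ P by exact: powR_ge0.
rewrite ger0_norm ?mulr_ge0 ?powR_ge0//.
apply: (le_trans _ (ler_norm _)).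
have b1 : normc (inv_fourier psi x) <= B / (1 + x ^+ 2).
  by have := quadratic_decay_le x hB; rewrite ger0_norm ?normc_ge0.
have b2 : normc (inv_fourier psi x) `^ P <= B `^ P / (1 + x ^+ 2).
  apply: (@le_trans _ _ ((B / (1 + x ^+ 2)) `^ P)).
    by rewrite ge0_ler_powR// ?nnegrE ?normc_ge0// divr_ge0// ltW.
  rewrite powRM ?invr_ge0 ?(ltW D0)// ler_wpM2l// -[leRHS]powRr1 ?invr_ge0 ?(ltW D0)//.
  by rewrite ger_powR// invr_gt0 D0/= invf_le1.
have x1 : `|x| `^ s <= near x + 1.
  (* At 0 the power is 0 or 1 by convention, which the summand 1 covers. *)
  rewrite /near addrK; have [->|x0] := eqVneq x 0.
    by rewrite normr0 ltxx/= add0r /powR eqxx; case: (s == 0) => /=.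
  rewrite normr_gt0 x0/=; have [x1|x1] := leP `|x| 1; first by rewrite lerDl.
  rewrite add0r -(powRr0 `|x|) ler_powR// ltW//.
apply: (@le_trans _ _ ((near x + 1) * (B `^ P / (1 + x ^+ 2)))).
  by apply: ler_pM => //; exact: powR_ge0.
rewrite mulrDl mul1r lerD2r mulrC ler_wpM2r// ler_piMr// invf_le1//.
Qed.

(** Young's inequality separates h, whose q-th power is integrable, from the test function, which
    absorbs the singular weight at the conjugate power sigma Q. *)
Lemma integrable_young_pairing (h psi : R -> R[i]) (sigma q Q : R) :
  0 < q -> 1 <= Q -> q^-1 + Q^-1 = 1 -> -1 < sigma * Q -> sigma * Q <= 0 ->
  cmeasurable (h : measurableTypeR R -> R[i]) ->
  leb.-integrable setT (EFin \o (fun x => normc (h x) `^ q)) -> schwartz psi ->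
  leb.-integrable setT (EFin \o (fun xi => `|xi| `^ sigma * normc (h xi) * normc (inv_fourier psi xi))).
Proof.
move=> q0 Q1 qQ s1 s0 mh ih spsi.
have Q0 : 0 < Q by exact: lt_le_trans Q1.
have mn := measurable_normc mh.
have mi := measurable_normc (cmeasurable_inv_fourier (schwartz_cmeasurable spsi)).
have i2 := integrable_powR_inv_fourier spsi s1 s0 Q1.
have ib : leb.-integrable setT (EFin \o (fun x => q^-1 * normc (h x) `^ q +
    Q^-1 * (`|x| `^ (sigma * Q) * normc (inv_fourier psi x) `^ Q))).
  have := integrableD measurableT (integrableZl measurableT q^-1 ih) (integrableZl measurableT Q^-1 i2).
  by apply: eq_integrable => // x _; rewrite /= EFinD !EFinM.
apply: le_integrable ib => //; first by meas.
move=> x _; rewrite /= lee_fin ger0_norm ?mulr_ge0 ?powR_ge0 ?normc_ge0//.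
apply: le_trans (ler_norm _); rewrite [_ * normc (h x)]mulrC -mulrA.
apply: (le_trans (@conjugate_powR _ _ (`|x| `^ sigma * normc (inv_fourier psi x)) q Q _ _ q0 Q0 qQ)).
- exact: normc_ge0.
- by rewrite mulr_ge0 ?powR_ge0 ?normc_ge0.
by rewrite powRM ?powR_ge0 ?normc_ge0// powRrM [_ / q]mulrC [_ / Q]mulrC.
Qed.

End represented_distributions.

(** * The estimate *)

Section restricted_Lhat_estimate.
Context {R : realType}.
Local Notation leb := (@lebesgue_measure R).
Local Notation leb2 := (leb \x leb)%E.
Local Notation RR := (measurableTypeR R * measurableTypeR R)%type.

(** Here 2 p stands for the exponent 3 p of the theorem. The witness is the limit of the extensions
    of the annular truncations of [hat phi]. *)
Lemma absD_propagator_function (alpha p M : R) (phi : distr R) :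
  0 < alpha -> alpha <= 2 -> alpha - 1 != 0 -> 0 < p - 2 -> 0 < M ->
  represents (dfourier phi) (hat phi) ->
  (\int[leb]_x (normc (hat phi x) `^ (2 * p / (2 * p - 3)))%:E <= (M `^ (2 * p / (2 * p - 3)))%:E)%E ->
  exists u : RR -> R[i],
    represents_xt (fun t : R => absD ((alpha - 2) / (2 * p)) (propagator alpha t phi)) u /\
    (\int[leb2]_y (normc (u y) `^ (2 * p))%:E <=
      (4 `^ (2 * p) * (2 * (wave_constant alpha p * M `^ (2 * p))))%:E)%E.
Proof.
move=> alpha0 alpha2 alpha1 p2 M0 rh hM.
have p0 : 0 < p by rewrite (lt_trans p2)// gtrBl.
have p23 : 0 < 2 * p - 3.
  rewrite (_ : 2 * p - 3 = (p - 2) + (p - 1)); last by ring.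
  by rewrite addr_gt0// (lt_trans p2)// ltrD2l ltrN2 ltr1n.
have q0 : 0 < 2 * p / (2 * p - 3) by rewrite divr_gt0// mulr_gt0.
have mh := rh.1; have mn := measurable_normc mh.
have ih : leb.-integrable setT (EFin \o (fun x => normc (hat phi x) `^ (2 * p / (2 * p - 3)))).
  apply/integrableP; split; first by meas.
  under eq_integral do rewrite /= ger0_norm ?powR_ge0//.
  exact: le_lt_trans hM (ltry _).
have [G [G0 aG Gh Gcvg Gq]] := annular_decomposition q0 mh ih M0 hM.
exists (wave_limit alpha p G); split; last first.
  exact: (wave_limit_bound alpha0 alpha1 p2 M0 G0 aG Gq).
have mu := cmeasurable_wave_limit alpha p2 aG.
split; first exact: mu.
have := wave_limit_pairing alpha0 alpha1 p2 M0 mh G0 aG Gh Gcvg Gq.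
move=> [Z [mZ Z0 sZ]]; exists Z; split => // t Ht; apply: sZ => Hp; apply: Ht; split.
  have [m1 m2] := mu.
  by split; [exact: (measurableT_comp m1 (pair2_measurable t))|exact: (measurableT_comp m2 (pair2_measurable t))].
move=> psi spsi; have [B hB] := schwartz_decay spsi.
have mpsi := schwartz_cmeasurable spsi.
have psiB x : normc (psi x) <= B.
  by have := quadratic_decay_bounded x hB; rewrite ger0_norm ?normc_ge0.
have mi := cmeasurable_inv_fourier mpsi.
have iy : leb.-integrable setT (EFin \o (fun xi =>
    `|xi| `^ ((alpha - 2) / (2 * p)) * normc (hat phi xi) * normc (inv_fourier psi xi))).
  (* The exponent conjugate to 2 p / (2 p - 3) is 2 p / 3, and sigma times it is (alpha - 2) / 3,
     which lies in ]-1, 0] for 0 < alpha <= 2. *)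
  apply: (@integrable_young_pairing _ _ _ _ (2 * p / (2 * p - 3)) (2 * p / 3)) => //.
  - by rewrite ler_pdivlMr// mul1r -subr_ge0 ltW.
  - by field; rewrite !gt_eqF.
  - rewrite (_ : _ * _ = (alpha - 2) / 3); last by field; rewrite gt_eqF.
    by rewrite ltr_pdivlMr// mulN1r ltrBrDr -subr_gt0 (_ : _ - _ = alpha + 1) ?addr_gt0//; ring.
  - rewrite (_ : _ * _ = (alpha - 2) / 3); last by field; rewrite gt_eqF.
    by rewrite pmulr_lle0 ?invr_gt0// subr_le0.
have [ip ->] := Hp psi B (schwartz_cintegrable spsi) psiB mi iy; split => //.
pose m (xi : R) : R[i] := expi (- (t * `|xi| `^ alpha)).
have mm : cmeasurable (m : measurableTypeR R -> R[i]) by apply: cmeasurable_expi; meas.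
have m1 x : normc (m x) <= 1 by rewrite normc_expi.
(* [absD] works with the chosen transform of the propagated distribution, which agrees with m times
   [hat phi] only almost everywhere; the integrals over frequency still coincide. *)
have rp := hat_fourier_multiplier mm m1 rh.
have rp' := represents_hat rp.
rewrite /absD /fourier_multiplier /dinv_fourier /fun_distr -/m.
have mr : cmeasurable (fun xi : measurableTypeR R => (`|xi| `^ ((alpha - 2) / (2 * p)))%:C).
  by apply: cmeasurable_real; meas.
apply: ae_eq_cintegral.
- by apply: cmeasurableM => //; apply: cmeasurableM => //; exact: rp'.1.
- by apply: cmeasurableM => //; apply: cmeasurableM => //; exact: rp.1.
- apply: (@filterS _ _ (ae_filter_ringOfSetsType leb) _ _ _ (represents_ae_unique rp' rp)) => x E.
  by congr (_ * _ * _).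
Qed.

Lemma cLnorm_le d (T : measurableType d) (mu : {measure set T -> \bar R}) (Q K : R) (u : T -> R[i]) :
  0 < Q -> 0 <= K -> (\int[mu]_y (normc (u y) `^ Q)%:E <= (K `^ Q)%:E)%E ->
  (cLnorm mu Q%:E u <= K%:E)%E.
Proof.
move=> Q0 K0 H; rewrite /cLnorm unlock.
have I0 : (0 <= \int[mu]_y `|(normc (u y))%:E| `^ Q)%E by apply: integral_ge0 => y _; exact: poweR_ge0.
have -> : (K%:E = ((K `^ Q)%:E `^ Q^-1)%E) by rewrite poweR_EFin -powRrM mulfV ?gt_eqF// powRr1.
rewrite gt0_ler_poweR ?invr_ge0 ?(ltW Q0)//.
- by rewrite in_itv/= leey andbT.
- by rewrite in_itv/= leey andbT lee_fin powR_ge0.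
apply: le_trans H; rewrite le_eqVlt; apply/orP; left; apply/eqP; apply: eq_integral => y _.
by rewrite abse_EFin ger0_norm ?normc_ge0.
Qed.

Lemma cLnorm_powR d (T : measurableType d) (mu : {measure set T -> \bar R}) (q : R) (u : T -> R[i]) :
  0 < q -> (cLnorm mu q%:E u `^ q = \int[mu]_y (normc (u y) `^ q)%:E)%E.
Proof.
move=> q0; rewrite /cLnorm poweR_Lnorm ?gt_eqF//; apply: eq_integral => y _.
by rewrite abse_EFin ger0_norm ?normc_ge0.
Qed.

End restricted_Lhat_estimate.

Theorem theorem1p1 (R : realType) (p alpha : R)
    (hp : 4 / 3 < p) (halpha0 : 0 < alpha) (halpha2 : alpha <= 2)
    (halpha1 : alpha != 1) :
  exists C : R, 0 < C /\
    forall phi : distr R, Lhat p phi ->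
      (Lxt_norm (3 * p)
         (fun t : R => absD ((alpha - 2) / (3 * p)) (propagator alpha t phi))
       <= C%:E * Lhat_norm p phi)%E.
Proof.
(* The condition P > 2 is p > 4 / 3, and 2 P / (2 P - 3) is the conjugate exponent p / (p - 1). *)
pose P := 3 * p / 2; pose K := 4 `^ (2 * P) * (2 * wave_constant alpha P).
have p1 : 1 < p by apply: lt_trans hp; rewrite ltr_pdivlMr// mul1r ltr_nat.
have p0 : 0 < p by exact: lt_trans p1.
have P2 : 0 < P - 2.
  by rewrite subr_gt0 ltr_pdivlMr// [3 * p]mulrC -ltr_pdivrMr// -natrM.
have a1 : alpha - 1 != 0 by rewrite subr_eq0.
have EP : 2 * P = 3 * p by rewrite /P; field.
have EQ : 2 * P / (2 * P - 3) = p / (p - 1).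
  have p10 : p - 1 != 0 by rewrite subr_eq0 gt_eqF.
  have p33 : 3 * p - 3 != 0 by rewrite -{2}(mulr1 3) -mulrBr mulf_neq0.
  by rewrite EP; field; rewrite p10 p33.
have q0 : 0 < p / (p - 1) by rewrite divr_gt0// subr_gt0.
have Q0 : 0 < 3 * p by rewrite mulr_gt0.
pose C0 := K `^ (3 * p)^-1.
have C00 : 0 <= C0 by exact: powR_ge0.
(* C0 is known to be nonnegative; adding 1 makes the constant positive and provides a divisor for
   the limiting argument below. *)
exists (C0 + 1); split; first by rewrite ltr_wpDl.
move=> phi [_ rh Lfin].
have qE : hoelder_conjugate p%:E = (p / (p - 1))%:E.
  rewrite /hoelder_conjugate/= eqe gt_eqF//= -EFinB inver gt_eqF ?subr_gt0//.
have N0 : (0 <= Lhat_norm p phi)%E by exact: Lnorm_ge0.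
pose r := fine (Lhat_norm p phi).
have Nr : Lhat_norm p phi = r%:E by rewrite fineK// ge0_fin_numE.
have r0 : 0 <= r by exact: fine_ge0.
have hint : (\int[@lebesgue_measure R]_x (normc (hat phi x) `^ (p / (p - 1)))%:E = (r `^ (p / (p - 1)))%:E)%E.
  by rewrite -cLnorm_powR// -poweR_EFin -Nr /Lhat_norm qE.
(* The estimates above need a positive bound M, while the norm r may be 0; they are applied to every
   M > r, and M is then let decrease to r. *)
have step (M : R) : r < M -> (Lxt_norm (3 * p)
    (fun t : R => absD ((alpha - 2) / (3 * p)) (propagator alpha t phi)) <= (C0 * M)%:E)%E.
  move=> rM; have M0 : 0 < M by exact: le_lt_trans rM.
  have hM : (\int[@lebesgue_measure R]_x (normc (hat phi x) `^ (2 * P / (2 * P - 3)))%:E <=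
      (M `^ (2 * P / (2 * P - 3)))%:E)%E.
    by rewrite EQ hint lee_fin ge0_ler_powR ?nnegrE ?(ltW M0) ?(ltW q0) ?(ltW rM).
  have [u [ru hu]] := absD_propagator_function halpha0 halpha2 a1 P2 M0 rh hM.
  rewrite EP in ru hu.
  apply: (@le_trans _ _ (cLnorm (lebesgue_measure \x lebesgue_measure)%E (3 * p)%:E u)).
    by apply: ereal_inf_lbound; exists u.
  apply: cLnorm_le => //; first by rewrite mulr_ge0// ltW.
  apply: (le_trans hu); rewrite lee_fin.
  have KM : 4 `^ (3 * p) * (2 * (wave_constant alpha P * M `^ (3 * p))) = K * M `^ (3 * p).
    by rewrite /K EP !mulrA.
  (* The sign of K is read off from the estimate [hu], whose left-hand side is nonnegative. *)
  have K0 : 0 <= K.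
    rewrite -(@pmulr_lge0 _ (M `^ (3 * p))) ?powR_gt0// -KM -lee_fin.
    by apply: le_trans hu; apply: integral_ge0 => y _; rewrite lee_fin powR_ge0.
  by rewrite KM powRM ?(ltW M0)// /C0 -powRrM mulVf ?gt_eqF// powRr1.
rewrite Nr -EFinM; apply/lee_addgt0Pr => e e0.
have d0 : 0 < e / (C0 + 1) by rewrite divr_gt0// ltr_wpDl.
apply: (le_trans (step (r + e / (C0 + 1)) _)); first by rewrite ltrDl.
rewrite -EFinD lee_fin mulrDr lerD//; first by rewrite ler_wpM2r// lerDl.
by rewrite mulrA [C0 * e]mulrC -mulrA ler_piMr ?(ltW e0)// ler_pdivrMr ?ltr_wpDl// mul1r lerDl.
Qed.
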